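(* Let $\alpha>0$, $\beta\in\mathbb{R}$ and $k\in[0,1)$. Suppose $f\in\mathcal{A}$ is such that the expression below is defined and finite for all $z\in\mathbb{D}$ (with $zf'(z)/f(z):=1$ at $z=0$) and $$\left|1+\frac{zf''(z)}{f'(z)}+(\alpha+i\beta-1)\frac{zf'(z)}{f(z)}-\frac{\alpha^2+\beta^2}{\alpha}\right|\le M\qquad(z\in\mathbb{D}),$$ where $M=k$ if $\alpha<\alpha^2+\beta^2$ and $M=k(\alpha^2+\beta^2)/\alpha$ if $\alpha^2+\beta^2\le\alpha$. Then $f$ is a Bazilevič function of type $(\alpha,\beta)$ and $f$ extends to a $\tilde k$-quasiconformal automorphism of $\mathbb{C}$, where $$\tilde k=\frac{2k\alpha+(1-k^2)|\beta|}{(1+k^2)\alpha+(1-k^2)\sqrt{\alpha^2+\beta^2}}.$$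
   Context: $\mathbb{D}=\{z\in\mathbb{C}:|z|<1\}$. $\mathcal{A}$ denotes the family of analytic functions $f$ on $\mathbb{D}$ of the form $f(z)=z+\sum_{n\ge2}a_nz^n$. A function $f\in\mathcal{A}$ is a Bazilevič function of type $(\alpha,\beta)$ if $$f(z)=\left[(\alpha+i\beta)\int_0^z g(\zeta)^\alpha h(\zeta)\zeta^{i\beta-1}\,d\zeta\right]^{1/(\alpha+i\beta)}$$ for some starlike univalent function $g\in\mathcal{A}$ and some analytic function $h$ on $\mathbb{D}$ with $h(0)=1$ and $\mathrm{Re}(e^{i\lambda}h)>0$ on $\mathbb{D}$ for some $\lambda\in\mathbb{R}$ (branches of powers chosen appropriately). A sense-preserving homeomorphism $F$ of a plane domain $G$ is $k$-quasiconformal ($0\le k<1$) if $F$ is absolutely continuous on almost all lines parallel to the coordinate axes and $|F_{\bar z}|\le k|F_z|$ almost everywhere in $G$; a $k$-quasiconformal automorphism of $\mathbb{C}$ extending $f$ is such a homeomorphism of $\mathbb{C}$ onto itself whose restriction to $\mathbb{D}$ is $f$. *)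

(* Defs.v *)
From Stdlib Require Import Reals List.
From mathcomp Require Import all_boot all_algebra.
From mathcomp Require Import all_classical all_reals all_analysis.
From mathcomp Require Import Rstruct Rstruct_topology.
(* re-import Stdlib reals so that exp/ln/cos/sin/... refer to Stdlib *)
Import Rdefinitions Rtrigo_def Rpower RIneq Rbasic_fun R_sqrt Rtrigo1.
From Coquelicot Require Import Coquelicot.

Definition leb1 := (@lebesgue_measure R).
Definition leb2 := (leb1 \x leb1)%E.
Definition null1 (N : R -> Prop) : Prop := leb1.-negligible N.
Definition null2 (N : C -> Prop) : Prop := leb2.-negligible N.

(* restore Stdlib's meaning of the %R delimiter (MathComp rebinds it) *)
Delimit Scope R_scope with R.
Open Scope R_scope.
Open Scope C_scope.

Definition Ci : C := (0%R, 1%R).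

Definition cexp (z : C) : C :=
  (Rtrigo_def.exp (fst z) * Rtrigo_def.cos (snd z), Rtrigo_def.exp (fst z) * Rtrigo_def.sin (snd z))%R.

Definition rpowc (t : R) (w : C) : C := cexp (RtoC (Rpower.ln t) * w).

Definition disk (z : C) : Prop := (Cmod z < 1)%R.

Definition C_is_derive (f : C -> C) (z l : C) : Prop :=
  is_derive (K := C_AbsRing) (V := C_NormedModule) f z l.

Definition analytic_on_disk (f : C -> C) : Prop :=
  forall z, disk z -> exists l, C_is_derive f z l.

Definition classA (f : C -> C) : Prop :=
  analytic_on_disk f /\ f 0 = 0 /\ C_is_derive f 0 1.

Definition starlike_univalent (g : C -> C) : Prop :=
  classA g /\
  (forall z w, disk z -> disk w -> g z = g w -> z = w) /\
  (forall z (t : R), disk z -> (0 <= t <= 1)%R ->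
      exists w, disk w /\ g w = RtoC t * g z).

(* Bazilevic function of type (alpha, beta).
   With c = alpha + i beta, the defining formula
     f(z) = [ c * int_0^z g(s)^alpha h(s) s^(i beta - 1) ds ]^(1/c)
   is read with the branches made explicit:  g(s)^alpha = s^alpha (g(s)/s)^alpha
   where (g(s)/s)^alpha = exp(alpha Lg(s)), Lg the analytic branch of
   log(g(s)/s) with Lg(0) = 0; integrating along the segment s = t z gives
   c * int_0^z ... = z^c * c * I(z) with
     I(z) = int_0^1 t^(c-1) exp(alpha Lg(t z)) h(t z) dt   (improper at 0),
   and the power 1/c is  z * exp(Phi(z)/c) with Phi the analytic branch of
   log(c I(z)) with Phi(0) = 0. *)
Definition Bazilevic (alpha beta : R) (f : C -> C) : Prop :=
  let c : C := (alpha, beta) in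
  classA f /\
  exists (g Lg h Phi I : C -> C) (lambda : R),
    starlike_univalent g /\
    analytic_on_disk Lg /\ Lg 0 = 0 /\
    (forall z, disk z -> z <> 0 -> cexp (Lg z) = g z / z) /\
    analytic_on_disk h /\ h 0 = 1 /\
    (forall z, disk z -> (0 < Re (cexp (0%R, lambda) * h z))%R) /\
    (forall z, disk z ->
       is_RInt_gen
         (fun t : R => rpowc t (c - 1) * cexp (RtoC alpha * Lg (RtoC t * z))
                         * h (RtoC t * z))
         (at_right 0) (at_point 1) (I z)) /\
    analytic_on_disk Phi /\ Phi 0 = 0 /\
    (forall z, disk z -> cexp (Phi z) = c * I z) /\
    (forall z, disk z -> f z = z * cexp (Phi z / c)).

Fixpoint sum_list (l : list R) : R :=
  match l with nil => 0%R | cons x l' => (x + sum_list l')%R end.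

Definition abs_cont_on (a b : R) (phi : R -> C) : Prop :=
  forall eps : R, (0 < eps)%R -> exists delta : R, (0 < delta)%R /\
    forall l : list (R * R),
      (forall i, Nat.lt i (List.length l) ->
         (a <= fst (List.nth i l (0%R, 0%R)) <= snd (List.nth i l (0%R, 0%R)) /\
          snd (List.nth i l (0%R, 0%R)) <= b)%R) ->
      (forall i j, Nat.lt i j -> Nat.lt j (List.length l) ->
         (snd (List.nth i l (0%R, 0%R)) <= fst (List.nth j l (0%R, 0%R)) \/
          snd (List.nth j l (0%R, 0%R)) <= fst (List.nth i l (0%R, 0%R)))%R) ->
      (sum_list (List.map (fun p => snd p - fst p) l) < delta)%R ->
      (sum_list (List.map (fun p => Cmod (phi (snd p) - phi (fst p))) l) < eps)%R.

(* F is absolutely continuous on almost all lines parallel to the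
   coordinate axes (here the domain is all of C, so: on every compact
   interval of almost every horizontal and almost every vertical line). *)
Definition ACL (F : C -> C) : Prop :=
  null1 (fun y => ~ forall a b, (a <= b)%R -> abs_cont_on a b (fun x => F (x, y))) /\
  null1 (fun x => ~ forall a b, (a <= b)%R -> abs_cont_on a b (fun y => F (x, y))).

Definition R_is_derive (phi : R -> C) (t : R) (l : C) : Prop :=
  is_derive (K := R_AbsRing) (V := C_R_NormedModule) phi t l.

(* |F_zbar| <= k |F_z| at z, where F_z = (F_x - i F_y)/2 and
   F_zbar = (F_x + i F_y)/2 (the common factor 1/2 cancels). *)
Definition dilatation_bound_at (k : R) (F : C -> C) (z : C) : Prop :=
  exists Fx Fy : C,
    R_is_derive (fun x => F (x, snd z)) (fst z) Fx /\
    R_is_derive (fun y => F (fst z, y)) (snd z) Fy /\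
    (Cmod (Fx + Ci * Fy) <= k * Cmod (Fx - Ci * Fy))%R.

Definition homeomorphism_C (F : C -> C) : Prop :=
  exists G : C -> C,
    (forall z, continuous F z) /\ (forall z, continuous G z) /\
    (forall z, G (F z) = z) /\ (forall w, F (G w) = w).

(* sense-preserving: the image under F of every positively oriented circle
   around z0 winds exactly once (positively) around F z0, i.e. a continuous
   argument of F(z0 + r e^{2 pi i t}) - F(z0), t in [0,1], increases by 2 pi. *)
Definition sense_preserving (F : C -> C) : Prop :=
  forall (z0 : C) (r : R), (0 < r)%R ->
    exists theta : R -> R,
      (forall t, continuous theta t) /\
      (forall t, (0 <= t <= 1)%R ->
         F (z0 + RtoC r * cexp (0%R, 2 * PI * t)%R) - F z0 =
         RtoC (Cmod (F (z0 + RtoC r * cexp (0%R, 2 * PI * t)%R) - F z0))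
           * cexp (0%R, theta t)) /\
      (theta 1 - theta 0 = 2 * PI)%R.

Definition qc_automorphism (k : R) (F : C -> C) : Prop :=
  (0 <= k < 1)%R /\
  homeomorphism_C F /\ sense_preserving F /\ ACL F /\
  null2 (fun z => ~ dilatation_bound_at k F z).

Definition Rdec_eq (x y : R) : {x = y} + {x <> y} := RIneq.Req_dec_T x y.

Definition zfp_over_f (f : C -> C) (z : C) : C :=
  match Rdec_eq (fst z) 0 with
  | left _ => match Rdec_eq (snd z) 0 with
              | left _ => 1
              | right _ => z * C_derive f z / f z
              end
  | right _ => z * C_derive f z / f z
  end.

Definition bound_M (alpha beta k : R) : R :=
  if Rlt_dec alpha (alpha ^ 2 + beta ^ 2) then k
  else (k * (alpha ^ 2 + beta ^ 2) / alpha)%R.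

Definition k_tilde (alpha beta k : R) : R :=
  ((2 * k * alpha + (1 - k ^ 2) * Rabs beta) /
   ((1 + k ^ 2) * alpha + (1 - k ^ 2) * sqrt (alpha ^ 2 + beta ^ 2)))%R.

(* Main.v *)
Require Import Defs.
From Stdlib Require Import Reals.
From Coquelicot Require Import Coquelicot.
From Stdlib Require Import Lra Lia Classical ClassicalEpsilon.
From mathcomp Require ssrbool boolp all_analysis ssreflect ssrfun.
Open Scope R_scope.
Open Scope C_scope.

(** Write [c = alpha + i beta], [a = |c|^2 / alpha], [Q = c z f'/f] and
[P = 1 + z f''/f' + (c - 1) z f'/f = Q + z Q'/Q].  In both cases of the hypothesis
[|P - a| <= M] with [M <= k] and [M <= k a], and by Jack's lemma [|Q - a| <= M] too.

For the Bazilevic representation take [g = id] and [h = f' (f/z)^(c-1)].  Since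
[z h'/h = P - P 0], the Schwarz-Pick lemma and [M <= k < 1] give [|log h| <= 4/3 < pi/2].

With [zeta = 1 / conj z] and [B = (|z|^(2a) - 1) / a], extend [f] to [|z| >= 1] by
[F z = f zeta * (1 + B (Q zeta))^(1/c)].  There
[|F_zbar / F_z| = (1 - |z|^(-2a)) |P zeta - a| / a <= k], and [k <= k_tilde], so [F]
satisfies a better bound than required.  The function [F] is continuously differentiable
on the whole plane, the unit circle included (where [F_zbar = 0]), so no exceptional set
occurs.  It is proper with nonvanishing Jacobian and takes the value [0] only at [0],
hence every value exactly once. *)

(** * Derivatives of pairs of points *)

(** The exterior formula is a Loewner chain read on the unit circle. For [z = e^(t + i s)] one has
    [zeta = e^(-t + i s)], and [F z] is the value at [x = e^(i s)] of [f(y) (1 + (e^(2 a t) - 1) / a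
    Q(y))^(1/c)] with [y = e^(-t) x]. The centre [a] fits the growth: [Re (1/c) = 1/a], so the power
    has modulus comparable to [|z|^2] and [|F z|] is comparable to [|z|]. No Loewner theory enters;
    [F] is examined directly.

    The obstacle is the unit circle, where nothing is known about [f] beforehand. The bounds on [P]
    and [Q] bound [L'] and [Q'], where [L = log (f/z)], so that [L] and [Q] have Lipschitz
    extensions to the closed disk. Since [z L' = Q/c - 1], the extended [L] is even continuously
    differentiable up to the circle. [Q] is only known to be Lipschitz there, but it enters [F]
    through the product with [B], which vanishes on the circle.

    Differentiability is taken in the strict, two-point form: it can be glued across the circle, it
    yields local injectivity and local Lipschitz bounds at once, and it needs no discussion of
    continuous partial derivatives. *)

Lemma is_derive_eps {K : AbsRing} {V : NormedModule K} (W : K -> V) (t : K) (l : V) :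
  is_derive W t l <->
  (forall eps : R, (0 < eps)%R -> exists d : R, (0 < d)%R /\
     forall s : K, (abs (minus s t) < d)%R ->
       (norm (minus (minus (W s) (W t)) (scal (minus s t) l)) <= eps * abs (minus s t))%R).
Proof.
  split.
  - intros [_ H] eps He.
    destruct (H t (fun P HP => HP) (mkposreal eps He)) as [d Hd].
    exists d. split. apply cond_pos. intros s Hs. exact (Hd s Hs).
  - intros H. split. apply is_linear_scal_l.
    intros x Hx eps.
    apply (is_filter_lim_locally_unique (V := AbsRing_NormedModule K)) in Hx. rewrite <- Hx.
    destruct (H eps (cond_pos eps)) as [d [Hd0 Hd]].
    exists (mkposreal d Hd0). intros s Hs. exact (Hd s Hs).
Qed.

Definition ev_pair (rel : C -> C -> Prop) (z : C) (P : C -> C -> Prop) : Prop :=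
  exists d : R, (0 < d)%R /\
    forall x y, rel x y -> (Cmod (x - z) < d)%R -> (Cmod (y - z) < d)%R -> P x y.

(* A and B play the roles of F_z and F_zbar.  The relation [rel] selects the admissible
   pairs: [y = z] gives the ordinary derivative at [z], and membership of both points in
   a set gives strict differentiability relative to that set. *)
Definition pair_diff (rel : C -> C -> Prop) (f : C -> C) (z A B : C) : Prop :=
  forall eps : R, (0 < eps)%R -> ev_pair rel z (fun x y =>
    (Cmod (f x - f y - A * (x - y) - B * Cconj (x - y)) <= eps * Cmod (x - y))%R).

(** Each member of an admissible pair may itself be paired with [z]. Products and compositions need
    this to keep [f x] and [f y] near [f z]. *)
Definition based (rel : C -> C -> Prop) (z : C) : Prop :=
  forall x y, rel x y -> rel x z /\ rel y z.

Definition holo_at (f : C -> C) (z l : C) : Prop := pair_diff (fun _ y => y = z) f z l 0.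

Definition cont_at (f : C -> C) (z : C) : Prop :=
  forall eps : R, (0 < eps)%R -> exists d : R, (0 < d)%R /\
    forall x, (Cmod (x - z) < d)%R -> (Cmod (f x - f z) < eps)%R.

Lemma Cmod_sub_sym (x y : C) : Cmod (x - y) = Cmod (y - x).
Proof. rewrite <- Cmod_opp. f_equal. ring. Qed.

Lemma Cmod_self_sub (x : C) : Cmod (x - x) = 0%R.
Proof. replace (x - x) with (RtoC 0) by ring. apply Cmod_0. Qed.

Lemma Cmod_tri_sub (x y z : C) : (Cmod (x - z) <= Cmod (x - y) + Cmod (y - z))%R.
Proof. replace (x - z) with ((x - y) + (y - z)) by ring. apply Cmod_triangle. Qed.

Lemma Cmod_ge_sub (x y : C) : (Cmod x - Cmod y <= Cmod (x - y))%R.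
Proof. pose proof (Cmod_triangle (x - y) y) as H. replace (x - y + y) with x in H by ring. lra. Qed.

Lemma Cmod_fst (x : C) : (Rabs (fst x) <= Cmod x)%R.
Proof. eapply Rle_trans; [apply Rmax_l | apply Rmax_Cmod]. Qed.

Lemma Cmod_snd (x : C) : (Rabs (snd x) <= Cmod x)%R.
Proof. eapply Rle_trans; [apply Rmax_r | apply Rmax_Cmod]. Qed.

Lemma Cmod_le_add (x : C) : (Cmod x <= Rabs (fst x) + Rabs (snd x))%R.
Proof.
  pose proof (Cmod_triangle (fst x, 0%R) (0%R, snd x)) as H.
  replace ((fst x, 0%R) + (0%R, snd x)) with x in H
    by (destruct x; unfold Cplus; simpl; f_equal; ring).
  replace (Cmod (fst x, 0%R)) with (Rabs (fst x)) in H
    by (symmetry; exact (Cmod_R (fst x))).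
  replace (Cmod (0%R, snd x)) with (Rabs (snd x)) in H; [exact H|].
  unfold Cmod; simpl. rewrite <- sqrt_Rsqr_abs. unfold Rsqr. f_equal. ring.
Qed.

Lemma based_eq (z : C) : based (fun _ y => y = z) z.
Proof. intros x y H. split; [reflexivity | reflexivity]. Qed.

Lemma ev_pair_and (rel : C -> C -> Prop) (z : C) (P Q : C -> C -> Prop) :
  ev_pair rel z P -> ev_pair rel z Q -> ev_pair rel z (fun x y => P x y /\ Q x y).
Proof.
  intros [d1 [Hd1 H1]] [d2 [Hd2 H2]]. exists (Rmin d1 d2).
  split; [apply Rmin_pos; assumption|]. intros x y Hxy Hx Hy.
  pose proof (Rmin_l d1 d2). pose proof (Rmin_r d1 d2).
  split; [apply H1 | apply H2]; try assumption; lra.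
Qed.

Section PairDiff.

Variables (rel : C -> C -> Prop) (z : C).
Hypothesis rel_based : based rel z.

Lemma pair_diff_lipschitz (f : C -> C) (A B : C) :
  pair_diff rel f z A B -> exists K : R, (0 < K)%R /\
    ev_pair rel z (fun x y => (Cmod (f x - f y) <= K * Cmod (x - y))%R).
Proof.
  intros H. destruct (H 1%R Rlt_0_1) as [d [Hd0 Hd]].
  pose proof (Cmod_ge_0 A). pose proof (Cmod_ge_0 B).
  exists (Cmod A + Cmod B + 1)%R. split; [lra|]. exists d. split; [exact Hd0|].
  intros x y Hxy Hx Hy. specialize (Hd x y Hxy Hx Hy).
  replace (f x - f y) with ((f x - f y - A * (x - y) - B * Cconj (x - y))
     + (A * (x - y) + B * Cconj (x - y))) by ring.
  eapply Rle_trans; [apply Cmod_triangle|].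
  pose proof (Cmod_triangle (A * (x - y)) (B * Cconj (x - y))) as HT.
  rewrite !Cmod_mult, Cmod_conj in HT. lra.
Qed.

Lemma pair_diff_lim (f : C -> C) (A B : C) : pair_diff rel f z A B ->
  forall eps, (0 < eps)%R ->
  ev_pair rel z (fun x y => (Cmod (f x - f z) <= eps)%R /\ (Cmod (f y - f z) <= eps)%R).
Proof.
  intros H eps He. destruct (pair_diff_lipschitz f A B H) as [K [HK [d [Hd Hl]]]].
  exists (Rmin d (eps / K)). split.
  - apply Rmin_pos; [lra|]. apply Rdiv_lt_0_compat; lra.
  - assert (Hp : forall x, rel x z -> (Cmod (x - z) < Rmin d (eps / K))%R -> (Cmod (f x - f z) <= eps)%R).
    { intros x Hx Hxd.
      assert (H1 : (Cmod (x - z) < d)%R) by (eapply Rlt_le_trans; [exact Hxd | apply Rmin_l]).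
      assert (H2 : (Cmod (x - z) < eps / K)%R) by (eapply Rlt_le_trans; [exact Hxd | apply Rmin_r]).
      eapply Rle_trans; [apply Hl; try assumption|].
      + rewrite Cmod_self_sub. exact Hd.
      + apply (Rmult_lt_compat_l K) in H2; [|exact HK].
        replace (K * (eps / K))%R with eps in H2 by (field; lra). lra. }
    intros x y Hxy Hx Hy. destruct (rel_based x y Hxy). split; apply Hp; assumption.
Qed.

Lemma pair_diff_const (a : C) : pair_diff rel (fun _ => a) z 0 0.
Proof.
  intros eps He. exists 1%R. split; [lra|]. intros x y _ _ _.
  replace (a - a - 0 * (x - y) - 0 * Cconj (x - y)) with (RtoC 0) by ring.
  rewrite Cmod_0. pose proof (Cmod_ge_0 (x - y)). nra.
Qed.

Lemma pair_diff_id : pair_diff rel (fun x => x) z 1 0.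
Proof.
  intros eps He. exists 1%R. split; [lra|]. intros x y _ _ _.
  replace (x - y - 1 * (x - y) - 0 * Cconj (x - y)) with (RtoC 0) by ring.
  rewrite Cmod_0. pose proof (Cmod_ge_0 (x - y)). nra.
Qed.

Lemma pair_diff_conj : pair_diff rel Cconj z 0 1.
Proof.
  intros eps He. exists 1%R. split; [lra|]. intros x y _ _ _.
  replace (Cconj x - Cconj y - 0 * (x - y) - 1 * Cconj (x - y)) with (RtoC 0)
    by (rewrite Cminus_conj; ring).
  rewrite Cmod_0. pose proof (Cmod_ge_0 (x - y)). nra.
Qed.

Lemma pair_diff_plus (f g : C -> C) (A B A' B' : C) :
  pair_diff rel f z A B -> pair_diff rel g z A' B' ->
  pair_diff rel (fun x => f x + g x) z (A + A') (B + B').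
Proof.
  intros Hf Hg eps He.
  destruct (ev_pair_and _ _ _ _ (Hf (eps / 2)%R ltac:(lra)) (Hg (eps / 2)%R ltac:(lra)))
    as [d [Hd H]].
  exists d. split; [exact Hd|]. intros x y Hxy Hx Hy.
  destruct (H x y Hxy Hx Hy) as [H1 H2].
  match type of H1 with (Cmod ?a <= _)%R => match type of H2 with (Cmod ?b <= _)%R =>
    replace (f x + g x - (f y + g y) - (A + A') * (x - y) - (B + B') * Cconj (x - y))
      with (a + b) by ring end end.
  eapply Rle_trans; [apply Cmod_triangle|]. lra.
Qed.

Lemma pair_diff_eq (f g : C -> C) (A B A' B' : C) :
  pair_diff rel f z A B -> ev_pair rel z (fun x y => f x = g x /\ f y = g y) ->
  A = A' -> B = B' -> pair_diff rel g z A' B'.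
Proof.
  intros Hf Hfg <- <- eps He.
  destruct (ev_pair_and _ _ _ _ (Hf eps He) Hfg) as [d [Hd H]].
  exists d. split; [exact Hd|]. intros x y Hxy Hx Hy.
  destruct (H x y Hxy Hx Hy) as [H1 [<- <-]]. exact H1.
Qed.

Lemma pair_diff_scal (f : C -> C) (A B m : C) :
  pair_diff rel f z A B -> pair_diff rel (fun x => m * f x) z (m * A) (m * B).
Proof.
  intros Hf eps He. pose proof (Cmod_ge_0 m).
  assert (Hp : (0 < eps / (Cmod m + 1))%R) by (apply Rdiv_lt_0_compat; lra).
  destruct (Hf _ Hp) as [d [Hd H1]]. exists d. split; [exact Hd|].
  intros x y Hxy Hx Hy. specialize (H1 x y Hxy Hx Hy).
  replace (m * f x - m * f y - m * A * (x - y) - m * B * Cconj (x - y)) with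
    (m * (f x - f y - A * (x - y) - B * Cconj (x - y))) by ring.
  rewrite Cmod_mult.
  apply (Rmult_le_compat_l (Cmod m)) in H1; [|assumption].
  eapply Rle_trans; [exact H1|].
  rewrite <- Rmult_assoc. apply Rmult_le_compat_r; [apply Cmod_ge_0|].
  replace (Cmod m * (eps / (Cmod m + 1)))%R with (eps - eps / (Cmod m + 1))%R by (field; lra).
  lra.
Qed.

Lemma pair_diff_mult (f g : C -> C) (A B A' B' : C) :
  pair_diff rel f z A B -> pair_diff rel g z A' B' ->
  pair_diff rel (fun x => f x * g x) z (A * g z + f z * A') (B * g z + f z * B').
Proof.
  intros Hf Hg eps He.
  destruct (pair_diff_lipschitz f A B Hf) as [K [HK Hl]].
  destruct (pair_diff_lipschitz g A' B' Hg) as [K' [HK' Hl']].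
  set (N := (Cmod (f z) + Cmod (g z) + K + K')%R).
  pose proof (Cmod_ge_0 (f z)) as Pf. pose proof (Cmod_ge_0 (g z)) as Pg.
  assert (HN : (0 < N)%R) by (unfold N; lra).
  assert (He2 : (0 < eps / N)%R) by (apply Rdiv_lt_0_compat; lra).
  set (e := (eps / N)%R) in *. assert (HeN : (eps = e * N)%R) by (unfold e; field; lra).
  destruct (ev_pair_and _ _ _ _ (ev_pair_and _ _ _ _ Hl Hl') (ev_pair_and _ _ _ _
     (ev_pair_and _ _ _ _ (Hf e He2) (Hg e He2))
     (ev_pair_and _ _ _ _ (pair_diff_lim f A B Hf e He2) (pair_diff_lim g A' B' Hg e He2))))
     as [d [Hd H]].
  exists d. split; [exact Hd|]. intros x y Hxy Hx Hy.
  destruct (H x y Hxy Hx Hy) as [[Kf Kg] [[H1 H2] [[_ H3] [H4 _]]]]. clear H Hf Hg Hl Hl'.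
  set (r1 := f x - f y - A * (x - y) - B * Cconj (x - y)) in *.
  set (r2 := g x - g y - A' * (x - y) - B' * Cconj (x - y)) in *.
  (* Inserting the values at [z] leaves products of a Lipschitz increment with a small difference;
     hence [N] adds the moduli at [z] and both Lipschitz constants. *)
  replace (f x * g x - f y * g y - (A * g z + f z * A') * (x - y) - (B * g z + f z * B') * Cconj (x - y))
    with (((f x - f y) * (g x - g z) + r1 * g z) + ((f y - f z) * (g x - g y) + f z * r2))
    by (unfold r1, r2; ring).
  eapply Rle_trans; [apply Cmod_triangle|].
  eapply Rle_trans; [apply Rplus_le_compat; apply Cmod_triangle|].
  rewrite !Cmod_mult, HeN. unfold N.
  pose proof (Cmod_ge_0 (x - y)) as P0.
  pose proof (Rmult_le_compat _ _ _ _ (Cmod_ge_0 _) (Cmod_ge_0 _) Kf H4).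
  pose proof (Rmult_le_compat_r _ _ _ Pg H1).
  pose proof (Rmult_le_compat _ _ _ _ (Cmod_ge_0 _) (Cmod_ge_0 _) H3 Kg).
  pose proof (Rmult_le_compat_l _ _ _ Pf H2). nra.
Qed.

(** The chain rule for Wirtinger derivatives; [conj f] contributes the conjugated coefficients with
    their roles exchanged. The relation may change from [rel] to [rel']: reflection in the circle
    later carries pairs outside the disk to pairs inside it. *)
Lemma pair_diff_comp (rel' : C -> C -> Prop) (f g : C -> C) (A B A' B' : C) :
  pair_diff rel f z A B -> pair_diff rel' g (f z) A' B' ->
  ev_pair rel z (fun x y => rel' (f x) (f y)) ->
  pair_diff rel (fun x => g (f x)) z (A' * A + B' * Cconj B) (A' * B + B' * Cconj A).
Proof.
  intros Hf Hg Hr eps He.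
  destruct (pair_diff_lipschitz f A B Hf) as [K [HK Hl]].
  set (N := (K + Cmod A' + Cmod B')%R).
  pose proof (Cmod_ge_0 A') as PA. pose proof (Cmod_ge_0 B') as PB.
  assert (HN : (0 < N)%R) by (unfold N; lra).
  assert (He2 : (0 < eps / N)%R) by (apply Rdiv_lt_0_compat; lra).
  set (e := (eps / N)%R) in *. assert (HeN : (eps = e * N)%R) by (unfold e; field; lra).
  destruct (Hg e He2) as [d' [Hd' Hg']].
  destruct (ev_pair_and _ _ _ _ (ev_pair_and _ _ _ _ Hl Hr) (ev_pair_and _ _ _ _
     (Hf e He2) (pair_diff_lim f A B Hf (d' / 2)%R ltac:(lra)))) as [d [Hd H]].
  exists d. split; [exact Hd|]. intros x y Hxy Hx Hy.
  destruct (H x y Hxy Hx Hy) as [[Kf R'] [H1 [H2 H3]]].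
  specialize (Hg' (f x) (f y) R' ltac:(lra) ltac:(lra)). clear H Hf Hg Hl Hr.
  set (r1 := f x - f y - A * (x - y) - B * Cconj (x - y)) in *.
  set (r2 := g (f x) - g (f y) - A' * (f x - f y) - B' * Cconj (f x - f y)) in *.
  assert (Hc : Cconj (f x - f y) = Cconj r1 + Cconj A * Cconj (x - y) + Cconj B * (x - y)).
  { replace (f x - f y) with (r1 + A * (x - y) + B * Cconj (x - y)) by (unfold r1; ring).
    rewrite !Cplus_conj, !Cmult_conj, Cconj_conj. reflexivity. }
  replace (g (f x) - g (f y) - (A' * A + B' * Cconj B) * (x - y) - (A' * B + B' * Cconj A) * Cconj (x - y))
    with (r2 + (A' * r1 + B' * Cconj r1)).
  2:{ replace (B' * Cconj r1) with (B' * (Cconj (f x - f y) - Cconj A * Cconj (x - y) - Cconj B * (x - y)))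
        by (rewrite Hc; ring). unfold r1, r2. ring. }
  eapply Rle_trans; [apply Cmod_triangle|].
  eapply Rle_trans; [apply Rplus_le_compat_l; apply Cmod_triangle|].
  rewrite !Cmod_mult, Cmod_conj, HeN. unfold N.
  pose proof (Cmod_ge_0 (x - y)) as P0.
  pose proof (Rmult_le_compat_l e _ _ ltac:(lra) Kf).
  pose proof (Rmult_le_compat_l _ _ _ PA H1).
  pose proof (Rmult_le_compat_l _ _ _ PB H1). nra.
Qed.

End PairDiff.

Lemma Cconj_RtoC (x : R) : Cconj x = x.
Proof. unfold Cconj, RtoC; simpl. rewrite Ropp_0. reflexivity. Qed.

Lemma holo_at_iff (f : C -> C) (z l : C) : holo_at f z l <-> C_is_derive f z l.
Proof.
  unfold C_is_derive. rewrite is_derive_eps. split; intros H eps He; destruct (H eps He) as [d [Hd H1]];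
    exists d; (split; [exact Hd|]).
  - intros s Hs. assert (Hs' : (Cmod (s - z) < d)%R) by exact Hs.
    specialize (H1 s z eq_refl Hs' ltac:(rewrite Cmod_self_sub; exact Hd)).
    replace (f s - f z - l * (s - z) - 0 * Cconj (s - z)) with ((f s - f z) - (s - z) * l) in H1 by ring.
    exact H1.
  - intros x y -> Hx _. specialize (H1 x Hx).
    replace (f x - f z - l * (x - z) - 0 * Cconj (x - z)) with ((f x - f z) - (x - z) * l) by ring.
    exact H1.
Qed.

Lemma holo_at_eq (f : C -> C) (z l l' : C) : holo_at f z l -> l = l' -> holo_at f z l'.
Proof. intros H <-. exact H. Qed.

Lemma holo_at_local (f g : C -> C) (z l : C) (d : R) : (0 < d)%R ->
  (forall x, (Cmod (x - z) < d)%R -> f x = g x) -> holo_at f z l -> holo_at g z l.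
Proof.
  intros Hd Hfg H. apply (pair_diff_eq _ _ f g l 0); try reflexivity; try assumption.
  exists d. split; [exact Hd|]. intros x y _ Hx Hy. split; apply Hfg; assumption.
Qed.

Lemma holo_at_cont (f : C -> C) (z l : C) : holo_at f z l -> cont_at f z.
Proof.
  intros H eps He.
  destruct (pair_diff_lim _ _ (based_eq z) f _ _ H (eps / 2)%R ltac:(lra)) as [d [Hd H1]].
  exists d. split; [exact Hd|]. intros x Hx.
  destruct (H1 x z eq_refl Hx ltac:(rewrite Cmod_self_sub; exact Hd)). lra.
Qed.

Lemma holo_at_const (a z : C) : holo_at (fun _ => a) z 0.
Proof. apply pair_diff_const. Qed.

Lemma holo_at_id (z : C) : holo_at (fun x => x) z 1.
Proof. apply pair_diff_id. Qed.

Lemma holo_at_plus (f g : C -> C) (z a b : C) :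
  holo_at f z a -> holo_at g z b -> holo_at (fun x => f x + g x) z (a + b).
Proof.
  intros Hf Hg. pose proof (pair_diff_plus _ _ f g _ _ _ _ Hf Hg) as H.
  replace (RtoC 0 + RtoC 0) with (RtoC 0) in H by ring. exact H.
Qed.

Lemma holo_at_scal (m : C) (f : C -> C) (z a : C) :
  holo_at f z a -> holo_at (fun x => m * f x) z (m * a).
Proof.
  intros Hf. pose proof (pair_diff_scal _ _ f _ _ m Hf) as H.
  replace (m * RtoC 0) with (RtoC 0) in H by ring. exact H.
Qed.

Lemma holo_at_minus (f g : C -> C) (z a b : C) :
  holo_at f z a -> holo_at g z b -> holo_at (fun x => f x - g x) z (a - b).
Proof.
  intros Hf Hg.
  apply (holo_at_local (fun x => f x + (- (1)) * g x) _ z _ 1); [lra | intros; unfold Cminus; ring |].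
  apply (holo_at_eq _ _ (a + - (1) * b)); [|ring].
  apply holo_at_plus; [exact Hf|]. apply holo_at_scal. exact Hg.
Qed.

Lemma holo_at_mult (f g : C -> C) (z a b : C) :
  holo_at f z a -> holo_at g z b -> holo_at (fun x => f x * g x) z (a * g z + f z * b).
Proof.
  intros Hf Hg. pose proof (pair_diff_mult _ _ (based_eq z) f g _ _ _ _ Hf Hg) as H.
  replace (RtoC 0 * g z + f z * RtoC 0) with (RtoC 0) in H by ring. exact H.
Qed.

Lemma holo_at_comp (f g : C -> C) (z a b : C) :
  holo_at f z a -> holo_at g (f z) b -> holo_at (fun x => g (f x)) z (b * a).
Proof.
  intros Hf Hg.
  assert (Hr : ev_pair (fun _ y => y = z) z (fun x y => f y = f z)).
  { exists 1%R. split; [lra|]. intros x y -> _ _. reflexivity. }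
  pose proof (pair_diff_comp _ _ (based_eq z) (fun _ y => y = f z) f g _ _ _ _ Hf Hg Hr) as H.
  apply (pair_diff_eq _ _ _ _ _ _ _ _ H).
  - exists 1%R. split; [lra|]. intros; split; reflexivity.
  - rewrite Cconj_RtoC. ring.
  - ring.
Qed.

Lemma holo_at_unique (f : C -> C) (z l l' : C) : holo_at f z l -> holo_at f z l' -> l = l'.
Proof.
  intros H H'. apply holo_at_iff, is_C_derive_unique in H. apply holo_at_iff, is_C_derive_unique in H'.
  congruence.
Qed.

Lemma holo_at_inv (z : C) : z <> 0 -> holo_at Cinv z (- / (z * z)).
Proof.
  intros Hz eps He. assert (Hz' := proj1 (Cmod_gt_0 z) Hz).
  set (m := Cmod z) in *.
  (* The remainder is [(x - z)^2 / (x z^2)]. The first entry gives [|x| >= m/2], and the second then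
     bounds [|x - z| / (|x| m^2)] by [eps]. *)
  set (d := Rmin (m / 2) (eps * (m * m * m) / 2)).
  assert (Hm3 : (0 < m * m * m)%R) by (repeat apply Rmult_lt_0_compat; lra).
  assert (Hd : (0 < d)%R) by (apply Rmin_pos; nra).
  exists d. split; [exact Hd|]. intros x y -> Hx _.
  pose proof (Rmin_l (m / 2) (eps * (m * m * m) / 2)) as D1.
  pose proof (Rmin_r (m / 2) (eps * (m * m * m) / 2)) as D2. fold d in D1, D2.
  assert (Hxm : (m / 2 <= Cmod x)%R).
  { pose proof (Cmod_ge_sub z x) as H. rewrite Cmod_sub_sym in H. fold m in H. lra. }
  assert (Hx0 : x <> 0) by (apply Cmod_gt_0; lra).
  replace (/ x - / z - - / (z * z) * (x - z) - 0 * Cconj (x - z))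
    with ((x - z) * (x - z) / (x * z * z)) by (field; split; assumption).
  rewrite Cmod_div by (repeat apply Cmult_neq_0; assumption).
  rewrite !Cmod_mult. fold m.
  pose proof (Cmod_ge_0 (x - z)) as P.
  apply Rle_trans with ((eps * (m * m * m) / 2) * Cmod (x - z) / (m / 2 * m * m))%R.
  - unfold Rdiv at 1 2. apply Rmult_le_compat.
    + nra.
    + left. apply Rinv_0_lt_compat. repeat apply Rmult_lt_0_compat; lra.
    + apply Rmult_le_compat_r; lra.
    + apply Rinv_le_contravar; [repeat apply Rmult_lt_0_compat; lra|].
      repeat apply Rmult_le_compat_r; lra.
  - right. field. lra.
Qed.

(** * The complex exponential and the principal logarithm *)

Lemma cexp_plus (x y : C) : cexp (x + y) = cexp x * cexp y.
Proof.
  unfold cexp, Cmult; simpl. rewrite exp_plus, cos_plus, sin_plus. f_equal; ring.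
Qed.

Lemma cexp_0 : cexp 0 = 1.
Proof. unfold cexp; simpl. rewrite exp_0, cos_0, sin_0. unfold RtoC. f_equal; ring. Qed.

Lemma Cmod_cexp (z : C) : Cmod (cexp z) = exp (fst z).
Proof.
  unfold Cmod, cexp; simpl.
  replace (_ + _)%R with (Rsqr (exp (fst z)) * (Rsqr (sin (snd z)) + Rsqr (cos (snd z))))%R
    by (unfold Rsqr; ring).
  rewrite sin2_cos2, Rmult_1_r. apply sqrt_Rsqr. left. apply exp_pos.
Qed.

Lemma cexp_neq_0 (z : C) : cexp z <> 0.
Proof. apply Cmod_gt_0. rewrite Cmod_cexp. apply exp_pos. Qed.

Lemma cexp_opp (z : C) : cexp (- z) = / cexp z.
Proof.
  pose proof (cexp_neq_0 z).
  assert (E : cexp (- z) * cexp z = 1).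
  { rewrite <- cexp_plus, <- cexp_0. f_equal. ring. }
  replace (cexp (- z)) with (cexp (- z) * cexp z * / cexp z) by (field; assumption).
  rewrite E. ring.
Qed.

Lemma cexp_minus (x y : C) : cexp (x - y) = cexp x / cexp y.
Proof. unfold Cminus. rewrite cexp_plus, cexp_opp. reflexivity. Qed.

Lemma derivable_pt_lim_eps (g : R -> R) (l : R) : derivable_pt_lim g 0 l ->
  forall eps, (0 < eps)%R -> exists d, (0 < d)%R /\
    forall h, (Rabs h < d)%R -> (Rabs (g h - g 0 - l * h) <= eps * Rabs h)%R.
Proof.
  intros H eps He. apply is_derive_Reals in H. rewrite is_derive_eps in H.
  destruct (H eps He) as [d [Hd H1]]. exists d. split; [exact Hd|].
  intros h Hh.
  assert (H1' : (Rabs (h + - 0) < d -> Rabs ((g h + - g 0) + - ((h + - 0) * l)) <= eps * Rabs (h + - 0))%R)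
    by exact (H1 h).
  replace (h + - 0)%R with h in H1' by ring.
  replace (g h - g 0 - l * h)%R with ((g h + - g 0) + - (h * l))%R by ring. exact (H1' Hh).
Qed.

Lemma holo_at_cexp_0 : holo_at cexp 0 1.
Proof.
  intros eps He.
  (* [9 = 3 + 1 + 3 + 2]: the cosine and sine remainders carry [exp x <= 3], the remainder of
     [exp x] counts once, and [|y| |exp x - 1| <= 2 |x| |y|] is absorbed because [d <= e]. *)
  set (e := Rmin 1 (eps / 9)). assert (He' : (0 < e)%R) by (apply Rmin_pos; lra).
  pose proof (Rmin_l 1 (eps / 9)) as E1. pose proof (Rmin_r 1 (eps / 9)) as E2. fold e in E1, E2.
  destruct (derivable_pt_lim_eps exp 1 derivable_pt_lim_exp_0 e He') as [d1 [Hd1 H1]].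
  pose proof (derivable_pt_lim_cos 0) as Hc. rewrite sin_0, Ropp_0 in Hc.
  destruct (derivable_pt_lim_eps cos 0 Hc e He') as [d2 [Hd2 H2]].
  pose proof (derivable_pt_lim_sin 0) as Hs. rewrite cos_0 in Hs.
  destruct (derivable_pt_lim_eps sin 1 Hs e He') as [d3 [Hd3 H3]].
  set (d := Rmin (Rmin d1 d2) (Rmin d3 e)).
  assert (Hd : (0 < d)%R) by (apply Rmin_pos; apply Rmin_pos; assumption).
  assert (HdM : (d <= d1 /\ d <= d2 /\ d <= d3 /\ d <= e)%R).
  { unfold d. pose proof (Rmin_l (Rmin d1 d2) (Rmin d3 e)). pose proof (Rmin_r (Rmin d1 d2) (Rmin d3 e)).
    pose proof (Rmin_l d1 d2). pose proof (Rmin_r d1 d2).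
    pose proof (Rmin_l d3 e). pose proof (Rmin_r d3 e). lra. }
  clearbody d. exists d. split; [exact Hd|]. intros h y -> Hh _.
  replace (h - 0) with h in * by ring.
  rewrite cexp_0. destruct h as [x y]. pose proof (Cmod_fst (x, y)) as Fx. pose proof (Cmod_snd (x, y)) as Fy.
  simpl fst in *. simpl snd in *.
  specialize (H1 x ltac:(lra)). specialize (H2 y ltac:(lra)). specialize (H3 y ltac:(lra)).
  rewrite exp_0 in H1. rewrite cos_0 in H2. rewrite sin_0 in H3.
  eapply Rle_trans; [apply Cmod_le_add|].
  unfold cexp, Cminus, Cplus, Copp, Cmult, Cconj, RtoC; simpl.
  replace (exp x * cos y + - (1) + - (1 * x - 0 * y) + - (0 * x - 0 * - y))%R
    with (exp x * (cos y - 1 - 0 * y) + (exp x - 1 - 1 * x))%R by ring.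
  replace (exp x * sin y + - 0 + - (1 * y + 0 * x) + - (0 * - y + 0 * x))%R
    with (exp x * (sin y - 0 - 1 * y) + y * (exp x - 1))%R by ring.
  assert (Ha : (Rabs (exp x - 1) <= 2 * Rabs x)%R).
  { replace (exp x - 1)%R with ((exp x - 1 - 1 * x) + x)%R by ring.
    eapply Rle_trans; [apply Rabs_triang|]. pose proof (Rabs_pos x). nra. }
  assert (Hb : (Rabs (exp x) <= 3)%R).
  { replace (exp x)%R with ((exp x - 1) + 1)%R by ring.
    eapply Rle_trans; [apply Rabs_triang|]. rewrite Rabs_R1. lra. }
  set (m := Cmod (x, y)) in *.
  pose proof (Rabs_pos x). pose proof (Rabs_pos y).
  eapply Rle_trans; [apply Rplus_le_compat; apply Rabs_triang|].
  rewrite !Rabs_mult.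
  pose proof (Rmult_le_compat _ _ _ _ (Rabs_pos _) (Rabs_pos _) Hb H2).
  pose proof (Rmult_le_compat _ _ _ _ (Rabs_pos _) (Rabs_pos _) Hb H3).
  pose proof (Rmult_le_compat_l _ _ _ (Rabs_pos y) Ha). nra.
Qed.

Lemma holo_at_cexp (z : C) : holo_at cexp z (cexp z).
Proof.
  apply (holo_at_local (fun x => cexp z * cexp (x - z)) _ z _ 1); [lra| |].
  { intros x _. rewrite <- cexp_plus. f_equal. ring. }
  apply (holo_at_eq _ _ (cexp z * (1 * (1 - 0)))); [|ring].
  apply holo_at_scal.
  apply (holo_at_comp (fun x => x - z) cexp).
  - apply holo_at_minus; [apply holo_at_id | apply holo_at_const].
  - replace (z - z) with (RtoC 0) by ring. apply holo_at_cexp_0.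
Qed.

(* the principal branch; junk for [fst z <= 0] *)
Definition Clog (z : C) : C := (ln (Cmod z), atan (snd z / fst z)).

Lemma rhp_neq_0 (z : C) : (0 < fst z)%R -> z <> 0.
Proof. intros H ->. simpl in H. lra. Qed.

Lemma cexp_Clog (z : C) : (0 < fst z)%R -> cexp (Clog z) = z.
Proof.
  intros Hz. pose proof (proj1 (Cmod_gt_0 z) (rhp_neq_0 z Hz)) as Hm.
  unfold cexp, Clog; simpl. rewrite exp_ln by exact Hm. rewrite cos_atan, sin_atan.
  destruct z as [x y]; simpl in *.
  assert (Hs : (Cmod (x, y) = x * sqrt (1 + (y / x)²))%R).
  { unfold Cmod; simpl. rewrite <- (sqrt_Rsqr x) at 3 by lra. rewrite <- sqrt_mult.
    f_equal. unfold Rsqr. field. lra. apply Rle_0_sqr.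
    pose proof (Rle_0_sqr (y / x)). lra. }
  assert (Hp : (0 < sqrt (1 + (y / x)²))%R).
  { apply sqrt_lt_R0. pose proof (Rle_0_sqr (y / x)). lra. }
  rewrite Hs. f_equal; field; lra.
Qed.

Lemma Clog_cont (z : C) : (0 < fst z)%R -> cont_at Clog z.
Proof.
  intros Hz eps He. pose proof (proj1 (Cmod_gt_0 z) (rhp_neq_0 z Hz)) as Hm.
  assert (Cl : continuous ln (Cmod z)).
  { apply continuity_pt_filterlim, derivable_continuous_pt. exists (/ Cmod z)%R.
    apply derivable_pt_lim_ln. exact Hm. }
  assert (Ca : continuous atan (snd z / fst z)%R) by apply continuous_atan.
  assert (He2 : (0 < eps / 2)%R) by lra.
  destruct (proj1 (filterlim_locally _ _) Cl (mkposreal _ He2)) as [d1 H1].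
  destruct (proj1 (filterlim_locally _ _) Ca (mkposreal _ He2)) as [d2 H2].
  set (p := fst z) in *. set (q := snd z) in *. set (m := Cmod z) in *.
  (* With [fst x >= p/2] the common denominator of the two slopes is at least [p^2/2]; the last
     entry makes the numerator smaller than [d2 p^2 / 2]. *)
  set (d := Rmin (Rmin d1 (p / 2)) (d2 * (p * p / 2) / (p + m + 1))).
  pose proof (cond_pos d1) as P1. pose proof (cond_pos d2) as P2.
  assert (Hpp : (0 < p * p)%R) by nra.
  assert (Hd : (0 < d)%R).
  { repeat apply Rmin_pos; try lra. apply Rdiv_lt_0_compat; nra. }
  assert (HdM : (d <= d1 /\ d <= p / 2 /\ d <= d2 * (p * p / 2) / (p + m + 1))%R).
  { unfold d. repeat split; try apply Rmin_r; (eapply Rle_trans; [apply Rmin_l|]); [apply Rmin_l|apply Rmin_r]. }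
  clearbody d. exists d. split; [exact Hd|]. intros x Hx.
  pose proof (Cmod_fst (x - z)) as Fx. pose proof (Cmod_snd (x - z)) as Fy.
  assert (Ex : fst (x - z) = (fst x - p)%R) by reflexivity.
  assert (Ey : snd (x - z) = (snd x - q)%R) by reflexivity.
  rewrite Ex in Fx. rewrite Ey in Fy.
  assert (Hxp : (p / 2 <= fst x)%R) by (apply Rabs_le_between in Fx; lra).
  eapply Rle_lt_trans; [apply Cmod_le_add|].
  replace eps with (eps / 2 + eps / 2)%R by field.
  apply Rplus_lt_compat.
  - apply H1. unfold ball; simpl. unfold AbsRing_ball, abs, minus, plus, opp; simpl.
    pose proof (Cmod_ge_sub x z) as A1. pose proof (Cmod_ge_sub z x) as A2.
    rewrite (Cmod_sub_sym z x) in A2. fold m in A1, A2.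
    apply Rabs_def1; lra.
  - apply H2. unfold ball; simpl. unfold AbsRing_ball, abs, minus, plus, opp; simpl. fold p q.
    replace (snd x / fst x + - (q / p))%R
      with (((snd x - q) * p + q * - (fst x - p)) / (fst x * p))%R by (field; lra).
    unfold Rdiv. rewrite Rabs_mult, Rabs_inv.
    rewrite (Rabs_right (fst x * p)) by nra.
    assert (Hn : (Rabs ((snd x - q) * p + q * - (fst x - p)) < (p * p / 2) * d2)%R).
    { eapply Rle_lt_trans; [apply Rabs_triang|]. rewrite !Rabs_mult, Rabs_Ropp.
      rewrite (Rabs_right p) by lra.
      assert (Hq : (Rabs q <= m)%R) by apply Cmod_snd.
      apply Rle_lt_trans with (Cmod (x - z) * (p + m + 1))%R.
      - pose proof (Rmult_le_compat _ _ _ _ (Rabs_pos _) (Rabs_pos _) Hq Fx).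
        pose proof (Cmod_ge_0 (x - z)). nra.
      - apply Rlt_le_trans with (d2 * (p * p / 2) / (p + m + 1) * (p + m + 1))%R.
        + apply Rmult_lt_compat_r; lra.
        + right. field. lra. }
    apply Rlt_le_trans with ((p * p / 2 * d2) * / (fst x * p))%R.
    + apply Rmult_lt_compat_r; [|exact Hn]. apply Rinv_0_lt_compat. nra.
    + apply Rmult_le_reg_r with (fst x * p)%R; [nra|].
      rewrite Rmult_assoc, Rinv_l by nra.
      pose proof (Rmult_le_compat_l (d2 * p) _ _ ltac:(nra) Hxp). nra.
Qed.

(** The logarithm is differentiated as an inverse function. For [h = Clog x - Clog z] one has
    [x - z = z (exp h - 1)]; continuity makes [h] small, and the expansion of [exp] at 0 does the
    rest. *)
Lemma holo_at_Clog (z : C) : (0 < fst z)%R -> holo_at Clog z (/ z).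
Proof.
  intros Hz eps He. pose proof (rhp_neq_0 z Hz) as Hz0. pose proof (proj1 (Cmod_gt_0 z) Hz0) as Hm.
  (* The cap [1/2] yields [|z| |h| <= 2 |x - z|], which turns an error relative to [|h|] into one
     relative to [|x - z|]. *)
  set (e := Rmin (1 / 2) (eps * Cmod z / 2)).
  assert (He' : (0 < e)%R) by (apply Rmin_pos; nra).
  pose proof (Rmin_l (1 / 2) (eps * Cmod z / 2)) as E1.
  pose proof (Rmin_r (1 / 2) (eps * Cmod z / 2)) as E2. fold e in E1, E2.
  destruct (holo_at_cexp_0 e He') as [d1 [Hd1 H1]].
  destruct (Clog_cont z Hz d1 Hd1) as [d2 [Hd2 H2]].
  exists (Rmin d2 (fst z)). split; [apply Rmin_pos; lra|]. intros x y -> Hx _.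
  pose proof (Rmin_l d2 (fst z)). pose proof (Rmin_r d2 (fst z)).
  specialize (H2 x ltac:(lra)).
  assert (Hxp : (0 < fst x)%R).
  { pose proof (Cmod_fst (x - z)) as F. assert (E : fst (x - z) = (fst x - fst z)%R) by reflexivity.
    rewrite E in F. apply Rabs_le_between in F. lra. }
  set (h := Clog x - Clog z) in *.
  assert (Hh : x - z = z * (cexp h - 1)).
  { unfold h. rewrite cexp_minus, !cexp_Clog by assumption. field. exact Hz0. }
  specialize (H1 h 0 eq_refl).
  replace (h - 0) with h in H1 by ring.
  specialize (H1 H2 ltac:(rewrite Cmod_self_sub; lra)). rewrite cexp_0 in H1.
  replace (cexp h - 1 - 1 * h - 0 * Cconj h) with (cexp h - 1 - h) in H1 by ring.
  assert (Hr : h - / z * (x - z) - 0 * Cconj (x - z) = - (cexp h - 1 - h)).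
  { rewrite Hh. field. exact Hz0. }
  rewrite Hr, Cmod_opp. eapply Rle_trans; [exact H1|].
  assert (Hb : (Cmod z * Cmod h <= 2 * Cmod (x - z))%R).
  { rewrite Hh.
    pose proof (Cmod_triangle (z * (cexp h - 1)) (- (z * (cexp h - 1 - h)))) as T.
    replace (z * (cexp h - 1) + - (z * (cexp h - 1 - h))) with (z * h) in T by ring.
    rewrite Cmod_opp, (Cmod_mult z (cexp h - 1 - h)), (Cmod_mult z h) in T.
    assert (A : (Cmod z * Cmod (cexp h - 1 - h) <= Cmod z * (/ 2 * Cmod h))%R).
    { apply Rmult_le_compat_l; [lra|]. pose proof (Cmod_ge_0 h). nra. }
    lra. }
  pose proof (Cmod_ge_0 h). pose proof (Cmod_ge_0 (x - z)).
  apply Rle_trans with (eps * Cmod z / 2 * Cmod h)%R; [apply Rmult_le_compat_r; assumption|].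
  nra.
Qed.

(** * Derivatives along curves and the mean value inequality *)

(** The real parameter is regarded as a point of the real axis, so that the rules for [pair_diff]
    also serve curves. There [conj (x - y) = x - y], and the second coefficient can be taken to be
    0. *)
Definition curve_rel (t : R) (x y : C) : Prop := snd x = 0%R /\ y = RtoC t.

Definition curve_deriv (W : R -> C) (t : R) (l : C) : Prop :=
  pair_diff (curve_rel t) (fun x => W (fst x)) t l 0.

Lemma curve_rel_based (t : R) : based (curve_rel t) t.
Proof. intros x y [Hx ->]. repeat split; assumption. Qed.

Lemma curve_deriv_eps (W : R -> C) (t : R) (l : C) :
  curve_deriv W t l <-> (forall eps, (0 < eps)%R -> exists d, (0 < d)%R /\ forall s,
    (Rabs (s - t) < d)%R -> (Cmod (W s - W t - l * RtoC (s - t)) <= eps * Rabs (s - t))%R).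
Proof.
  split; intros H eps He; destruct (H eps He) as [d [Hd H1]]; exists d; (split; [exact Hd|]).
  - intros s Hs. specialize (H1 s t (conj eq_refl eq_refl)).
    rewrite <- !RtoC_minus, !Cmod_R in H1. specialize (H1 Hs ltac:(rewrite Rminus_eq_0, Rabs_R0; exact Hd)).
    simpl in H1. rewrite Cmult_0_l in H1. unfold Cminus in H1 at 1. rewrite Copp_0, Cplus_0_r in H1. exact H1.
  - intros x y [Hx ->] Hxd _. destruct x as [s s2]. simpl in Hx. subst s2.
    change (s, 0%R) with (RtoC s) in *. rewrite <- !RtoC_minus, !Cmod_R in *. simpl.
    rewrite Cmult_0_l. unfold Cminus at 1. rewrite Copp_0, Cplus_0_r. apply H1. exact Hxd.
Qed.

Lemma curve_deriv_iff (W : R -> C) (t : R) (l : C) : curve_deriv W t l <-> R_is_derive W t l.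
Proof.
  rewrite curve_deriv_eps. unfold R_is_derive. rewrite is_derive_eps.
  assert (E : forall s, norm (K := R_AbsRing) (V := C_R_NormedModule)
     (minus (minus (W s) (W t)) (scal (minus (s : R_AbsRing) t) l)) = Cmod (W s - W t - l * RtoC (s - t))).
  { intros s. rewrite <- Cmod_norm. f_equal. destruct (W s) as [a b], (W t) as [a' b'], l as [l1 l2].
    unfold Cminus, Cplus, Copp, Cmult, RtoC; simpl.
    unfold minus, plus, opp, scal; simpl. unfold prod_plus, prod_opp, prod_scal; simpl.
    unfold scal, plus, opp; simpl. unfold mult; simpl. unfold Cplus, Copp; simpl. f_equal; ring. }
  split; intros H eps He; destruct (H eps He) as [d [Hd H1]]; exists d; (split; [exact Hd|]).
  - intros s Hs. eapply Rle_trans; [right; apply E | exact (H1 s Hs)].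
  - intros s Hs. eapply Rle_trans; [right; symmetry; apply E | exact (H1 s Hs)].
Qed.

Lemma curve_deriv_fst (W : R -> C) (t : R) (l : C) :
  curve_deriv W t l -> is_derive (fun s => fst (W s)) t (fst l).
Proof.
  rewrite curve_deriv_eps, is_derive_eps. intros H eps He.
  destruct (H eps He) as [d [Hd H1]]. exists d. split; [exact Hd|].
  intros s Hs. eapply Rle_trans; [|exact (H1 s Hs)].
  eapply Rle_trans; [|apply Cmod_fst].
  right. unfold norm, minus, plus, opp, scal, mult; simpl. unfold abs, mult; simpl. f_equal. ring.
Qed.

Lemma curve_deriv_snd (W : R -> C) (t : R) (l : C) :
  curve_deriv W t l -> is_derive (fun s => snd (W s)) t (snd l).
Proof.
  rewrite curve_deriv_eps, is_derive_eps. intros H eps He.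
  destruct (H eps He) as [d [Hd H1]]. exists d. split; [exact Hd|].
  intros s Hs. eapply Rle_trans; [|exact (H1 s Hs)].
  eapply Rle_trans; [|apply Cmod_snd].
  right. unfold norm, minus, plus, opp, scal, mult; simpl. unfold abs, mult; simpl. f_equal. ring.
Qed.

Lemma curve_deriv_pair (W : R -> C) (t l1 l2 : R) :
  is_derive (fun s => fst (W s)) t l1 -> is_derive (fun s => snd (W s)) t l2 ->
  curve_deriv W t (l1, l2).
Proof.
  rewrite curve_deriv_eps, !is_derive_eps. intros Ha Hb eps He.
  destruct (Ha (eps / 2)%R ltac:(lra)) as [d [Hd H1]].
  destruct (Hb (eps / 2)%R ltac:(lra)) as [d' [Hd' H2]].
  exists (Rmin d d'). split; [apply Rmin_pos; assumption|].
  intros s Hs. pose proof (Rmin_l d d'). pose proof (Rmin_r d d').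
  assert (H1' : (Rabs ((fst (W s) + - fst (W t)) + - ((s + - t) * l1)) <= eps / 2 * Rabs (s + - t))%R)
    by (apply H1; exact (Rlt_le_trans _ _ _ Hs H)).
  assert (H2' : (Rabs ((snd (W s) + - snd (W t)) + - ((s + - t) * l2)) <= eps / 2 * Rabs (s + - t))%R)
    by (apply H2; exact (Rlt_le_trans _ _ _ Hs H0)).
  eapply Rle_trans; [apply Cmod_le_add|]. unfold Cminus, Cplus, Copp, Cmult, RtoC; simpl.
  replace (fst (W s) + - fst (W t) + - (l1 * (s - t) - l2 * 0))%R
    with ((fst (W s) + - fst (W t)) + - ((s + - t) * l1))%R by ring.
  replace (snd (W s) + - snd (W t) + - (l1 * 0 + l2 * (s - t)))%R
    with ((snd (W s) + - snd (W t)) + - ((s + - t) * l2))%R by ring.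
  unfold Rminus. lra.
Qed.

Lemma curve_deriv_eq (W : R -> C) (t : R) (l l' : C) :
  curve_deriv W t l -> l = l' -> curve_deriv W t l'.
Proof. intros H <-. exact H. Qed.

Lemma curve_deriv_const (a : C) (t : R) : curve_deriv (fun _ => a) t 0.
Proof. apply pair_diff_const. Qed.

Lemma curve_deriv_plus (V W : R -> C) (t : R) (a b : C) :
  curve_deriv V t a -> curve_deriv W t b -> curve_deriv (fun s => V s + W s) t (a + b).
Proof.
  intros Hf Hg. pose proof (pair_diff_plus _ _ _ _ _ _ _ _ Hf Hg) as H.
  replace (RtoC 0 + RtoC 0) with (RtoC 0) in H by ring. exact H.
Qed.

Lemma curve_deriv_scal (m : C) (W : R -> C) (t : R) (a : C) :
  curve_deriv W t a -> curve_deriv (fun s => m * W s) t (m * a).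
Proof.
  intros Hf. pose proof (pair_diff_scal _ _ _ _ _ m Hf) as H.
  replace (m * RtoC 0) with (RtoC 0) in H by ring. exact H.
Qed.

Lemma curve_deriv_mult (V W : R -> C) (t : R) (a b : C) :
  curve_deriv V t a -> curve_deriv W t b -> curve_deriv (fun s => V s * W s) t (a * W t + V t * b).
Proof.
  intros Hf Hg. pose proof (pair_diff_mult _ _ (curve_rel_based t) _ _ _ _ _ _ Hf Hg) as H.
  simpl in H. replace (RtoC 0 * W t + V t * RtoC 0) with (RtoC 0) in H by ring. exact H.
Qed.

Lemma curve_deriv_holo (F : C -> C) (W : R -> C) (t : R) (a l : C) :
  holo_at F (W t) a -> curve_deriv W t l -> curve_deriv (fun s => F (W s)) t (a * l).
Proof.
  intros HF HW.
  assert (Hr : ev_pair (curve_rel t) t (fun x y => W (fst y) = W t)).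
  { exists 1%R. split; [lra|]. intros x y [_ ->] _ _. reflexivity. }
  pose proof (pair_diff_comp _ _ (curve_rel_based t) _ _ _ _ _ _ _ HW HF Hr) as H.
  apply (pair_diff_eq _ _ _ _ _ _ _ _ H).
  - exists 1%R. split; [lra|]. intros; split; reflexivity.
  - ring.
  - ring.
Qed.

Lemma curve_deriv_id (t : R) : curve_deriv RtoC t 1.
Proof.
  apply curve_deriv_eps. intros eps He. exists 1%R. split; [lra|]. intros s _.
  replace (RtoC s - RtoC t - 1 * RtoC (s - t)) with (RtoC 0) by (rewrite RtoC_minus; ring).
  rewrite Cmod_0. pose proof (Rabs_pos (s - t)). nra.
Qed.

Lemma curve_deriv_segment (a b : C) (t : R) : curve_deriv (fun s => a + RtoC s * b) t b.
Proof.
  apply (curve_deriv_eq _ _ (0 + (1 * b + RtoC t * 0))); [|ring].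
  apply curve_deriv_plus; [apply curve_deriv_const|].
  apply (curve_deriv_mult RtoC (fun _ => b)); [apply curve_deriv_id | apply curve_deriv_const].
Qed.

Lemma real_mvt_le (phi dphi : R -> R) :
  (forall t, (0 <= t <= 1)%R -> is_derive phi t (dphi t)) ->
  (forall t, (0 <= t <= 1)%R -> (dphi t <= 0)%R) -> (phi 1 <= phi 0)%R.
Proof.
  intros H1 H2. destruct (MVT_gen phi 0 1 dphi) as [c [Hc E]].
  - intros x Hx. rewrite Rmin_left, Rmax_right in Hx by lra. apply H1. lra.
  - intros x Hx. rewrite Rmin_left, Rmax_right in Hx by lra.
    apply derivable_continuous_pt. exists (dphi x). apply is_derive_Reals, H1. lra.
  - rewrite Rmin_left, Rmax_right in Hc by lra. specialize (H2 c Hc). lra.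
Qed.

Lemma Cmod_sqr_re (z : C) : (fst (Cconj z * z)%C = Cmod z * Cmod z)%R.
Proof.
  unfold Cmod. rewrite sqrt_sqrt; [|pose proof (pow2_ge_0 (fst z)); pose proof (pow2_ge_0 (snd z)); lra].
  unfold Cconj, Cmult; simpl. ring.
Qed.

(* Project the increment [D = W 1 - W 0] onto its own direction and apply the real mean value theorem. *)
Lemma curve_mvt (W w : R -> C) (b db : R -> R) :
  (forall t, (0 <= t <= 1)%R -> curve_deriv W t (w t)) ->
  (forall t, (0 <= t <= 1)%R -> is_derive b t (db t)) ->
  (forall t, (0 <= t <= 1)%R -> (Cmod (w t) <= db t)%R) ->
  (Cmod (W 1%R - W 0%R) <= b 1 - b 0)%R.
Proof.
  intros HW Hb Hle. set (D := W 1%R - W 0%R).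
  destruct (Req_dec (Cmod D) 0) as [E|E].
  - rewrite E.
    assert (H : (- b 1 <= - b 0)%R).
    { apply (real_mvt_le (fun t => - b t)%R (fun t => - db t)%R).
      - intros t Ht. apply (is_derive_opp b). apply Hb. exact Ht.
      - intros t Ht. specialize (Hle t Ht). pose proof (Cmod_ge_0 (w t)). lra. }
    lra.
  - assert (HD : (0 < Cmod D)%R) by (pose proof (Cmod_ge_0 D); lra).
    assert (H : (fst (Cconj D * W 1%R)%C - Cmod D * b 1 <= fst (Cconj D * W 0%R)%C - Cmod D * b 0)%R).
    { apply (real_mvt_le (fun t => fst (Cconj D * W t)%C - Cmod D * b t)%R
        (fun t => fst (Cconj D * w t)%C - Cmod D * db t)%R).
      - intros t Ht. apply (is_derive_minus (fun t => fst (Cconj D * W t)%C) (fun t => Cmod D * b t)%R).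
        + apply (curve_deriv_fst (fun t => Cconj D * W t)). apply curve_deriv_scal, HW, Ht.
        + apply (is_derive_scal b t (Cmod D)), Hb, Ht.
      - intros t Ht. specialize (Hle t Ht).
        pose proof (Cmod_fst (Cconj D * w t)%C) as F. rewrite Cmod_mult, Cmod_conj in F.
        apply Rabs_le_between in F. nra. }
    pose proof (Cmod_sqr_re D) as S.
    assert (S2 : (fst (Cconj D * D)%C = fst (Cconj D * W 1%R)%C - fst (Cconj D * W 0%R)%C)%R).
    { unfold D at 2. unfold Cminus, Cmult, Cplus, Copp; simpl. ring. }
    apply Rmult_le_reg_l with (Cmod D); [exact HD|]. lra.
Qed.

(** The mean value inequality for [f - m id] along a segment. The choice [m = 0] gives Lipschitz
    bounds, [m = f' z] gives strict differentiability. *)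
Lemma segment_mvt (f f' : C -> C) (x y m : C) (K : R) :
  (forall t, (0 <= t <= 1)%R -> holo_at f (y + RtoC t * (x - y)) (f' (y + RtoC t * (x - y)))) ->
  (forall t, (0 <= t <= 1)%R -> Cmod (f' (y + RtoC t * (x - y)) - m) <= K) ->
  (Cmod (f x - f y - m * (x - y)) <= K * Cmod (x - y))%R.
Proof.
  intros H1 H2.
  pose proof (curve_mvt (fun t => f (y + RtoC t * (x - y)) + - m * (y + RtoC t * (x - y)))
     (fun t => (f' (y + RtoC t * (x - y)) - m) * (x - y))
     (fun t => K * Cmod (x - y) * t)%R (fun _ => K * Cmod (x - y))%R) as H.
  cbv beta in H.
  replace (f x - f y - m * (x - y)) with
    (f (y + RtoC 1 * (x - y)) + - m * (y + RtoC 1 * (x - y)) -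
     (f (y + RtoC 0 * (x - y)) + - m * (y + RtoC 0 * (x - y)))).
  2:{ replace (y + RtoC 1 * (x - y)) with x by ring. replace (y + RtoC 0 * (x - y)) with y by ring. ring. }
  eapply Rle_trans; [apply H|].
  - intros t Ht. apply (curve_deriv_eq _ _ (f' (y + RtoC t * (x - y)) * (x - y) + - m * (x - y))); [|ring].
    apply curve_deriv_plus.
    + apply (curve_deriv_holo f (fun s => y + RtoC s * (x - y))); [apply H1, Ht | apply curve_deriv_segment].
    + apply curve_deriv_scal, curve_deriv_segment.
  - intros t Ht. auto_derive; [exact I | ring].
  - intros t Ht. rewrite Cmod_mult. apply Rmult_le_compat_r; [apply Cmod_ge_0 | apply H2, Ht].
  - lra.
Qed.

Lemma ball_convex (z x y : C) (r t : R) : (Cmod (x - z) < r)%R -> (Cmod (y - z) < r)%R ->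
  (0 <= t <= 1)%R -> (Cmod (y + RtoC t * (x - y) - z) < r)%R.
Proof.
  intros Hx Hy Ht.
  replace (y + RtoC t * (x - y) - z) with (RtoC (1 - t) * (y - z) + RtoC t * (x - z))
    by (rewrite RtoC_minus; ring).
  eapply Rle_lt_trans; [apply Cmod_triangle|]. rewrite !Cmod_mult, !Cmod_R, !Rabs_right by lra.
  destruct (Rle_lt_dec t 0); [replace t with 0%R by lra; lra|]. nra.
Qed.

(** On a ball where [f'] stays within [eps] of [f' z], the mean value inequality for [f - f' z id]
    treats all pairs at once; balls are convex, so segments stay inside. Hence [rel] is
    arbitrary. *)
Lemma holo_strict (rel : C -> C -> Prop) (f f' : C -> C) (z : C) (r : R) : (0 < r)%R ->
  (forall x, (Cmod (x - z) < r)%R -> holo_at f x (f' x)) -> cont_at f' z ->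
  pair_diff rel f z (f' z) 0.
Proof.
  intros Hr Hf Hc eps He. destruct (Hc eps He) as [d [Hd H]].
  exists (Rmin r d). split; [apply Rmin_pos; assumption|].
  intros x y _ Hx Hy. rewrite Cmult_0_l. unfold Cminus at 1. rewrite Copp_0, Cplus_0_r.
  pose proof (Rmin_l r d). pose proof (Rmin_r r d).
  apply segment_mvt with f'.
  - intros t Ht. apply Hf. apply ball_convex; lra.
  - intros t Ht. left. apply H. apply ball_convex; lra.
Qed.

(** * Goursat's theorem and the Cauchy formula *)

Definition curve_cont (u : R -> C) (t : R) : Prop :=
  forall eps, 0 < eps -> exists d, 0 < d /\ forall s, Rabs (s - t) < d -> Cmod (u s - u t) < eps.

Definition CI (u : R -> C) (a b : R) : C :=
  (RInt (fun t => fst (u t)) a b, RInt (fun t => snd (u t)) a b).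

Lemma curve_cont_fst (u : R -> C) (t : R) : curve_cont u t -> continuous (fun s => fst (u s)) t.
Proof.
  intros H. apply filterlim_locally. intros eps. destruct (H eps (cond_pos eps)) as [d [Hd H1]].
  exists (mkposreal d Hd). intros s Hs. specialize (H1 s Hs).
  eapply Rle_lt_trans; [|exact H1]. apply (Cmod_fst (u s - u t)).
Qed.

Lemma curve_cont_snd (u : R -> C) (t : R) : curve_cont u t -> continuous (fun s => snd (u s)) t.
Proof.
  intros H. apply filterlim_locally. intros eps. destruct (H eps (cond_pos eps)) as [d [Hd H1]].
  exists (mkposreal d Hd). intros s Hs. specialize (H1 s Hs).
  eapply Rle_lt_trans; [|exact H1]. apply (Cmod_snd (u s - u t)).
Qed.

Lemma curve_deriv_cont (W : R -> C) (t : R) (l : C) : curve_deriv W t l -> curve_cont W t.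
Proof.
  intros H eps He.
  destruct (pair_diff_lim _ _ (curve_rel_based t) _ _ _ H (eps / 2)%R ltac:(lra)) as [d [Hd H1]].
  exists d. split; [exact Hd|]. intros s Hs.
  destruct (H1 (RtoC s) (RtoC t) (conj eq_refl eq_refl)) as [A _].
  - rewrite <- RtoC_minus, Cmod_R. exact Hs.
  - rewrite Cmod_self_sub. exact Hd.
  - simpl in A. lra.
Qed.

Lemma cont_curve_comp (u : C -> C) (W : R -> C) (t : R) :
  cont_at u (W t) -> curve_cont W t -> curve_cont (fun s => u (W s)) t.
Proof.
  intros Hu HW eps He. destruct (Hu eps He) as [d [Hd H1]]. destruct (HW d Hd) as [d' [Hd' H2]].
  exists d'. split; [exact Hd'|]. intros s Hs. apply H1, H2, Hs.
Qed.

Lemma curve_cont_mult (u v : R -> C) (t : R) :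
  curve_cont u t -> curve_cont v t -> curve_cont (fun s => u s * v s) t.
Proof.
  intros Hu Hv eps He.
  pose proof (Cmod_ge_0 (u t)) as Pu. pose proof (Cmod_ge_0 (v t)) as Pv.
  set (N := (Cmod (u t) + Cmod (v t) + 2)%R).
  set (e := Rmin 1 (eps / N)).
  assert (He' : 0 < e) by (apply Rmin_pos; [lra | apply Rdiv_lt_0_compat; unfold N; lra]).
  assert (E1 : e <= 1) by apply Rmin_l.
  assert (E2 : e * N <= eps).
  { apply Rle_trans with (eps / N * N)%R.
    - apply Rmult_le_compat_r; [unfold N; lra | apply Rmin_r].
    - right. field. unfold N. lra. }
  destruct (Hu e He') as [d [Hd H1]]. destruct (Hv e He') as [d' [Hd' H2]].
  exists (Rmin d d'). split; [apply Rmin_pos; assumption|]. intros s Hs.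
  pose proof (Rmin_l d d'). pose proof (Rmin_r d d').
  specialize (H1 s ltac:(lra)). specialize (H2 s ltac:(lra)).
  replace (u s * v s - u t * v t) with ((u s - u t) * (v s - v t) + ((u s - u t) * v t + u t * (v s - v t))) by ring.
  eapply Rle_lt_trans; [apply Cmod_triangle|].
  eapply Rle_lt_trans; [apply Rplus_le_compat_l, Cmod_triangle|]. rewrite !Cmod_mult.
  pose proof (Cmod_ge_0 (u s - u t)). pose proof (Cmod_ge_0 (v s - v t)).
  unfold N in E2. nra.
Qed.

Lemma curve_cont_const (a : C) (t : R) : curve_cont (fun _ => a) t.
Proof. apply (curve_deriv_cont _ _ 0), curve_deriv_const. Qed.

Lemma curve_cont_minus (u v : R -> C) (t : R) :
  curve_cont u t -> curve_cont v t -> curve_cont (fun s => u s - v s) t.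
Proof.
  intros Hu Hv eps He.
  destruct (Hu (eps / 2)%R ltac:(lra)) as [d [Hd H1]]. destruct (Hv (eps / 2)%R ltac:(lra)) as [d' [Hd' H2]].
  exists (Rmin d d'). split; [apply Rmin_pos; assumption|]. intros s Hs.
  pose proof (Rmin_l d d'). pose proof (Rmin_r d d').
  specialize (H1 s ltac:(lra)). specialize (H2 s ltac:(lra)).
  replace (u s - v s - (u t - v t)) with ((u s - u t) + - (v s - v t)) by ring.
  eapply Rle_lt_trans; [apply Cmod_triangle|]. rewrite Cmod_opp. lra.
Qed.

Definition cont_on (u : R -> C) (a b : R) : Prop := forall t, Rmin a b <= t <= Rmax a b -> curve_cont u t.

Lemma cont_on_ex (u : R -> C) (a b : R) : cont_on u a b ->
  ex_RInt (fun t => fst (u t)) a b /\ ex_RInt (fun t => snd (u t)) a b.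
Proof.
  intros H. split; apply (ex_RInt_continuous (V := R_CompleteNormedModule)); intros t Ht.
  - apply curve_cont_fst, H, Ht.
  - apply curve_cont_snd, H, Ht.
Qed.

Lemma CI_ext (u v : R -> C) (a b : R) :
  (forall t, Rmin a b < t < Rmax a b -> u t = v t) -> CI u a b = CI v a b.
Proof.
  intros H. unfold CI. f_equal; apply RInt_ext; intros t Ht; rewrite (H t Ht); reflexivity.
Qed.

Lemma CI_scal (m : C) (u : R -> C) (a b : R) : cont_on u a b -> CI (fun t => m * u t) a b = m * CI u a b.
Proof.
  intros H. destruct (cont_on_ex u a b H) as [E1 E2].
  apply (RInt_correct (V := R_CompleteNormedModule)) in E1.
  apply (RInt_correct (V := R_CompleteNormedModule)) in E2.
  unfold CI, Cmult; simpl. f_equal; apply is_RInt_unique.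
  - exact (is_RInt_minus _ _ _ _ _ _ (is_RInt_scal _ _ _ (fst m) _ E1) (is_RInt_scal _ _ _ (snd m) _ E2)).
  - exact (is_RInt_plus _ _ _ _ _ _ (is_RInt_scal _ _ _ (fst m) _ E2) (is_RInt_scal _ _ _ (snd m) _ E1)).
Qed.

Lemma CI_minus (u v : R -> C) (a b : R) : cont_on u a b -> cont_on v a b ->
  CI (fun t => u t - v t) a b = CI u a b - CI v a b.
Proof.
  intros Hu Hv. destruct (cont_on_ex u a b Hu) as [E1 E2]. destruct (cont_on_ex v a b Hv) as [E3 E4].
  apply (RInt_correct (V := R_CompleteNormedModule)) in E1.
  apply (RInt_correct (V := R_CompleteNormedModule)) in E2.
  apply (RInt_correct (V := R_CompleteNormedModule)) in E3.
  apply (RInt_correct (V := R_CompleteNormedModule)) in E4.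
  unfold CI, Cminus, Cplus, Copp; simpl. f_equal; apply is_RInt_unique.
  - exact (is_RInt_minus _ _ _ _ _ _ E1 E3).
  - exact (is_RInt_minus _ _ _ _ _ _ E2 E4).
Qed.

Lemma CI_Chasles (u : R -> C) (a b c : R) : cont_on u a b -> cont_on u b c ->
  CI u a b + CI u b c = CI u a c.
Proof.
  intros Hu Hv. destruct (cont_on_ex _ _ _ Hu) as [E1 E2]. destruct (cont_on_ex _ _ _ Hv) as [E3 E4].
  unfold CI, Cplus; simpl. f_equal; apply (RInt_Chasles (V := R_CompleteNormedModule)); assumption.
Qed.

Lemma CI_swap (u : R -> C) (a b : R) : cont_on u a b -> CI u b a = - CI u a b.
Proof.
  intros H. destruct (cont_on_ex u a b H) as [E1 E2]. unfold CI, Copp; simpl.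
  f_equal; symmetry; apply (opp_RInt_swap (V := R_CompleteNormedModule)); assumption.
Qed.

Lemma CI_comp_lin (u : R -> C) (p q : R) : cont_on u q (p + q) -> cont_on (fun t => u (p * t + q)%R) 0 1 ->
  RtoC p * CI (fun t => u (p * t + q)%R) 0 1 = CI u q (p + q).
Proof.
  intros H H'. destruct (cont_on_ex _ _ _ H) as [E1 E2]. rewrite <- CI_scal by exact H'.
  replace (CI u q (p + q)) with (CI u (p * 0 + q) (p * 1 + q)) by (f_equal; ring).
  replace (p + q)%R with (p * 1 + q)%R in E1, E2 by ring.
  assert (Eq : q = (p * 0 + q)%R) by ring. rewrite Eq in E1 at 1. rewrite Eq in E2 at 1. unfold CI.
  f_equal.
  - rewrite (RInt_ext _ (fun t => scal p (fst (u (p * t + q)%R)))).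
    + rewrite (RInt_comp_lin (V := R_CompleteNormedModule) (fun t => fst (u t))) by assumption. reflexivity.
    + intros t _. unfold Cmult, RtoC, scal; simpl. unfold mult; simpl. ring.
  - rewrite (RInt_ext _ (fun t => scal p (snd (u (p * t + q)%R)))).
    + rewrite (RInt_comp_lin (V := R_CompleteNormedModule) (fun t => snd (u t))) by assumption. reflexivity.
    + intros t _. unfold Cmult, RtoC, scal; simpl. unfold mult; simpl. ring.
Qed.

Lemma CI_FTC (W w : R -> C) (a b : R) : a <= b ->
  (forall t, a <= t <= b -> curve_deriv W t (w t)) -> (forall t, a <= t <= b -> curve_cont w t) ->
  CI w a b = W b - W a.
Proof.
  intros Hab H1 H2. unfold CI, Cminus, Cplus, Copp; simpl.
  f_equal; apply is_RInt_unique.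
  - apply (is_RInt_derive (V := R_CompleteNormedModule) (fun t => fst (W t)) (fun t => fst (w t)));
      rewrite Rmin_left, Rmax_right by exact Hab; intros t Ht.
    + apply curve_deriv_fst, H1, Ht.
    + apply curve_cont_fst, H2, Ht.
  - apply (is_RInt_derive (V := R_CompleteNormedModule) (fun t => snd (W t)) (fun t => snd (w t)));
      rewrite Rmin_left, Rmax_right by exact Hab; intros t Ht.
    + apply curve_deriv_snd, H1, Ht.
    + apply curve_cont_snd, H2, Ht.
Qed.

(* The factor 2 comes from estimating the two components separately. *)
Lemma CI_bound (u : R -> C) (a b M : R) : a <= b -> (forall t, a <= t <= b -> curve_cont u t) ->
  (forall t, a <= t <= b -> Cmod (u t) <= M) -> Cmod (CI u a b) <= 2 * (b - a) * M.
Proof.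
  intros Hab Hc HM.
  assert (H : cont_on u a b) by (intros t; rewrite Rmin_left, Rmax_right by exact Hab; apply Hc).
  destruct (cont_on_ex _ _ _ H) as [E1 E2].
  eapply Rle_trans; [apply Cmod_le_add|]. unfold CI; simpl.
  assert (A1 : Rabs (RInt (fun t => fst (u t)) a b) <= (b - a) * M).
  { apply abs_RInt_le_const; try assumption. intros t Ht.
    eapply Rle_trans; [apply Cmod_fst | apply HM, Ht]. }
  assert (A2 : Rabs (RInt (fun t => snd (u t)) a b) <= (b - a) * M).
  { apply abs_RInt_le_const; try assumption. intros t Ht.
    eapply Rle_trans; [apply Cmod_snd | apply HM, Ht]. }
  lra.
Qed.

(** The contour integral of [u] along the oriented segment from [a] to [b]. *)
Definition seg (u : C -> C) (a b : C) : C := (b - a) * CI (fun t => u (a + RtoC t * (b - a))) 0 1.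

Definition seg_cont (u : C -> C) (a b : C) : Prop :=
  forall t : R, 0 <= t <= 1 -> cont_at u (a + RtoC t * (b - a)).

Lemma seg_curve_cont (u : C -> C) (a b : C) (t : R) : seg_cont u a b -> 0 <= t <= 1 ->
  curve_cont (fun t => u (a + RtoC t * (b - a))) t.
Proof.
  intros H Ht. apply (cont_curve_comp u (fun t => a + RtoC t * (b - a))); [apply H, Ht|].
  apply (curve_deriv_cont _ _ (b - a)), curve_deriv_segment.
Qed.

Lemma seg_bound (u : C -> C) (a b : C) (M : R) : seg_cont u a b ->
  (forall t, 0 <= t <= 1 -> Cmod (u (a + RtoC t * (b - a))) <= M) -> Cmod (seg u a b) <= 2 * M * Cmod (b - a).
Proof.
  intros H HM. unfold seg. rewrite Cmod_mult.
  pose proof (CI_bound (fun t => u (a + RtoC t * (b - a))) 0 1 M ltac:(lra)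
    (fun t Ht => seg_curve_cont u a b t H Ht) HM). pose proof (Cmod_ge_0 (b - a)). nra.
Qed.

Lemma seg_minus (u v : C -> C) (a b : C) : seg_cont u a b -> seg_cont v a b ->
  seg (fun z => u z - v z) a b = seg u a b - seg v a b.
Proof.
  intros Hu Hv. unfold seg. rewrite CI_minus. ring.
  all: intros t; rewrite Rmin_left, Rmax_right by lra; intros Ht; apply seg_curve_cont; assumption.
Qed.

Lemma seg_split (u : C -> C) (a b : C) (s : R) : seg_cont u a b -> 0 <= s <= 1 ->
  seg u a b = seg u a (a + RtoC s * (b - a)) + seg u (a + RtoC s * (b - a)) b.
Proof.
  intros H Hs. set (g := fun t : R => u (a + RtoC t * (b - a))).
  assert (Hg : forall t, 0 <= t <= 1 -> curve_cont g t) by (intros; apply seg_curve_cont; assumption).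
  assert (Hcc : forall p q, (forall t, 0 <= t <= 1 -> 0 <= p * t + q <= 1) -> cont_on (fun t => g (p * t + q)%R) 0 1).
  { intros p q Hpq t. rewrite Rmin_left, Rmax_right by lra. intros Ht.
    unfold g. apply (cont_curve_comp u (fun t => a + RtoC (p * t + q) * (b - a))).
    - apply H, Hpq, Ht.
    - apply (curve_deriv_cont _ _ (RtoC p * (b - a))).
      pose proof (curve_deriv_segment (a + RtoC q * (b - a)) (RtoC p * (b - a)) t) as D.
      apply (pair_diff_eq _ _ _ _ _ _ _ _ D); try reflexivity.
      exists 1%R. split; [lra|]. intros x y _ _ _. rewrite !RtoC_plus, !RtoC_mult. split; ring. }
  assert (C1 : cont_on g 0 s) by (intros t; rewrite Rmin_left, Rmax_right by lra; intros; apply Hg; lra).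
  assert (C2 : cont_on g s 1) by (intros t; rewrite Rmin_left, Rmax_right by lra; intros; apply Hg; lra).
  unfold seg. fold g. rewrite <- (CI_Chasles g 0 s 1) by assumption.
  pose proof (CI_comp_lin g s 0) as L1. rewrite Rplus_0_r in L1. specialize (L1 C1 (Hcc s 0%R ltac:(intros; nra))).
  pose proof (CI_comp_lin g (1 - s) s) as L2. replace (1 - s + s)%R with 1%R in L2 by ring.
  specialize (L2 C2 (Hcc (1 - s)%R s ltac:(intros; nra))).
  rewrite <- L1, <- L2.
  rewrite (CI_ext (fun t => u (a + RtoC t * (a + RtoC s * (b - a) - a))) (fun t => g (s * t + 0)%R)).
  2:{ intros t _. unfold g. f_equal. rewrite RtoC_plus, RtoC_mult. ring. }
  rewrite (CI_ext (fun t => u (a + RtoC s * (b - a) + RtoC t * (b - (a + RtoC s * (b - a))))) (fun t => g ((1 - s) * t + s)%R)).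
  2:{ intros t _. unfold g. f_equal. rewrite RtoC_plus, RtoC_mult, RtoC_minus. ring. }
  rewrite RtoC_minus. ring.
Qed.

Lemma RtoC_m1 : RtoC (-1) = - (1).
Proof. unfold RtoC, Copp; simpl. f_equal; ring. Qed.

Lemma seg_swap (u : C -> C) (a b : C) : seg_cont u a b -> seg u b a = - seg u a b.
Proof.
  intros H. set (g := fun t : R => u (a + RtoC t * (b - a))).
  assert (Hg : forall t, 0 <= t <= 1 -> curve_cont g t) by (intros; apply seg_curve_cont; assumption).
  assert (C1 : cont_on g 1 0) by (intros t; rewrite Rmin_right, Rmax_left by lra; intros; apply Hg; lra).
  assert (C2 : cont_on (fun t => g (-1 * t + 1)%R) 0 1).
  { intros t. rewrite Rmin_left, Rmax_right by lra. intros Ht.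
    unfold g. apply (cont_curve_comp u (fun t => a + RtoC (-1 * t + 1) * (b - a))).
    - apply H. lra.
    - apply (curve_deriv_cont _ _ (- (b - a))).
      pose proof (curve_deriv_segment b (- (b - a)) t) as D.
      apply (pair_diff_eq _ _ _ _ _ _ _ _ D); try reflexivity.
      exists 1%R. split; [lra|]. intros x y _ _ _. rewrite !RtoC_plus, !RtoC_mult, !RtoC_m1. split; ring. }
  pose proof (CI_comp_lin g (-1) 1) as L. replace (-1 + 1)%R with 0%R in L by ring. specialize (L C1 C2).
  unfold seg. fold g.
  rewrite (CI_ext (fun t => u (b + RtoC t * (a - b))) (fun t => g (-1 * t + 1)%R)).
  2:{ intros t _. unfold g. f_equal. rewrite RtoC_plus, RtoC_mult, RtoC_m1. ring. }
  assert (C3 : cont_on g 0 1) by (intros t; rewrite Rmin_left, Rmax_right by lra; apply Hg).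
  rewrite (CI_swap g 0 1 C3), RtoC_m1 in L.
  replace ((a - b) * CI (fun t => g (-1 * t + 1)%R) 0 1) with ((b - a) * (- (1) * CI (fun t => g (-1 * t + 1)%R) 0 1)) by ring.
  rewrite L. ring.
Qed.

Lemma seg_affine (p q a b : C) :
  seg (fun z => p + q * z) a b = p * (b - a) + q * (b * b - a * a) / 2.
Proof.
  unfold seg.
  rewrite (CI_FTC (fun t => (p + q * a) * RtoC t + q * (b - a) / 2 * (RtoC t * RtoC t))
     (fun t => p + q * (a + RtoC t * (b - a))) 0 1).
  - field.
  - lra.
  - intros t _.
    apply (curve_deriv_eq _ _ ((p + q * a) * 1 + q * (b - a) / 2 * (1 * RtoC t + RtoC t * 1))); [|field].
    apply curve_deriv_plus; apply curve_deriv_scal; [apply curve_deriv_id|].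
    apply (curve_deriv_mult RtoC RtoC); apply curve_deriv_id.
  - intros t _. apply (curve_deriv_cont _ _ (0 + q * (b - a))).
    apply curve_deriv_plus; [apply curve_deriv_const|]. apply curve_deriv_scal, curve_deriv_segment.
Qed.

Definition tri (u : C -> C) (a b c : C) : C := seg u a b + seg u b c + seg u c a.

Definition perimeter (a b c : C) : R := (Cmod (b - a) + Cmod (c - b) + Cmod (a - c))%R.

Section Goursat.

Variables (K : C -> Prop) (u : C -> C).
Hypothesis K_convex : forall a b (t : R), K a -> K b -> 0 <= t <= 1 -> K (a + RtoC t * (b - a)).
Hypothesis K_closed : forall p, (forall eps, 0 < eps -> exists x, K x /\ Cmod (x - p) < eps) -> K p.
Hypothesis u_holo : forall z, K z -> exists l, holo_at u z l.

Lemma holo_seg_cont (a b : C) : K a -> K b -> seg_cont u a b.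
Proof.
  intros Ha Hb t Ht. destruct (u_holo _ (K_convex a b t Ha Hb Ht)) as [l Hl]. exact (holo_at_cont _ _ _ Hl).
Qed.

Let mid (a b : C) : C := a + RtoC (/ 2) * (b - a).

Lemma midpoint_in (a b : C) : K a -> K b -> K (mid a b).
Proof. intros; apply K_convex; try assumption; lra. Qed.

Definition triangle_in (T : C * C * C) : Prop := let '(a, b, c) := T in K a /\ K b /\ K c.

Definition tri_triple (T : C * C * C) : C := let '(a, b, c) := T in tri u a b c.
Definition perimeter_triple (T : C * C * C) : R := let '(a, b, c) := T in perimeter a b c.
Definition apex (T : C * C * C) : C := fst (fst T).

Lemma RtoC_half : RtoC (/ 2) = / 2.
Proof. rewrite RtoC_inv by lra. reflexivity. Qed.

Lemma Cmod_half (x : C) : Cmod (/ 2 * x) = (Cmod x / 2)%R.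
Proof. rewrite <- RtoC_half, Cmod_mult, Cmod_R, Rabs_right by lra. field. Qed.

(** The edges of the medial triangle are traversed twice in opposite directions, so the four small
    integrals add up to the large one and one of them carries at least a quarter of it. The bound on
    the apex makes the apices of iterated steps a Cauchy sequence. *)
Lemma bisect_step (T : C * C * C) : triangle_in T -> exists T', triangle_in T' /\
  Cmod (tri_triple T) <= 4 * Cmod (tri_triple T') /\ perimeter_triple T' = (perimeter_triple T / 2)%R /\ Cmod (apex T' - apex T) <= perimeter_triple T.
Proof.
  destruct T as [[a b] c]. intros [Ha [Hb Hc]].
  set (x := mid a b). set (y := mid b c). set (z := mid c a).
  assert (Hx : K x) by (apply midpoint_in; assumption). assert (Hy : K y) by (apply midpoint_in; assumption).
  assert (Hz : K z) by (apply midpoint_in; assumption).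
  assert (E : tri u a b c = (tri u a x z + tri u x b y) + (tri u z y c + tri u x y z)).
  { unfold tri.
    rewrite (seg_split u a b (/ 2)), (seg_split u b c (/ 2)), (seg_split u c a (/ 2))
      by (try apply holo_seg_cont; try assumption; lra).
    fold (mid a b) (mid b c) (mid c a). fold x y z.
    rewrite (seg_swap u y z), (seg_swap u x y), (seg_swap u z x) by (apply holo_seg_cont; assumption). ring. }
  assert (Hm : Cmod (tri u a b c) <= 4 * Cmod (tri u a x z) \/ Cmod (tri u a b c) <= 4 * Cmod (tri u x b y)
     \/ Cmod (tri u a b c) <= 4 * Cmod (tri u z y c) \/ Cmod (tri u a b c) <= 4 * Cmod (tri u x y z)).
  { pose proof (Cmod_triangle (tri u a x z + tri u x b y) (tri u z y c + tri u x y z)) as T1. rewrite <- E in T1.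
    pose proof (Cmod_triangle (tri u a x z) (tri u x b y)). pose proof (Cmod_triangle (tri u z y c) (tri u x y z)).
    destruct (Rle_dec (Cmod (tri u a b c)) (4 * Cmod (tri u a x z))); [auto|].
    destruct (Rle_dec (Cmod (tri u a b c)) (4 * Cmod (tri u x b y))); [auto|].
    destruct (Rle_dec (Cmod (tri u a b c)) (4 * Cmod (tri u z y c))); [auto|].
    right; right; right. lra. }
  assert (Hper : perimeter a x z = (perimeter a b c / 2)%R /\ perimeter x b y = (perimeter a b c / 2)%R /\
     perimeter z y c = (perimeter a b c / 2)%R /\ perimeter x y z = (perimeter a b c / 2)%R).
  { unfold perimeter, x, y, z, mid. rewrite RtoC_half.
    (* The corner triangles have sides parallel to the original ones; the sides of the medial
       triangle are reversed and permuted, which is the second alternative. *)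
    repeat split;
    match goal with |- (Cmod ?A + Cmod ?B + Cmod ?D)%R = _ =>
      first
      [ replace A with (/ 2 * (b - a)) by field; replace B with (/ 2 * (c - b)) by field;
        replace D with (/ 2 * (a - c)) by field
      | replace A with (- (/ 2 * (a - c))) by field; replace B with (- (/ 2 * (b - a))) by field;
        replace D with (- (/ 2 * (c - b))) by field ] end;
    rewrite ?Cmod_opp, !Cmod_half; field. }
  destruct Hper as [P1 [P2 [P3 P4]]].
  assert (Hd : Cmod (x - a) <= perimeter a b c /\ Cmod (z - a) <= perimeter a b c).
  { pose proof (Cmod_ge_0 (b - a)). pose proof (Cmod_ge_0 (c - b)). pose proof (Cmod_ge_0 (a - c)).
    unfold perimeter, x, z, mid. rewrite RtoC_half. split.
    - replace (a + / 2 * (b - a) - a) with (/ 2 * (b - a)) by ring. rewrite Cmod_half. lra.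
    - replace (c + / 2 * (a - c) - a) with (- (/ 2 * (a - c))) by field. rewrite Cmod_opp, Cmod_half. lra. }
  assert (Hd0 : Cmod (a - a) <= perimeter a b c).
  { rewrite Cmod_self_sub. unfold perimeter. pose proof (Cmod_ge_0 (b - a)). pose proof (Cmod_ge_0 (c - b)). pose proof (Cmod_ge_0 (a - c)). lra. }
  destruct Hd as [Hd1 Hd2].
  destruct Hm as [Hm|[Hm|[Hm|Hm]]].
  - exists (a, x, z). unfold triangle_in, tri_triple, perimeter_triple, apex; simpl. auto.
  - exists (x, b, y). unfold triangle_in, tri_triple, perimeter_triple, apex; simpl. auto.
  - exists (z, y, c). unfold triangle_in, tri_triple, perimeter_triple, apex; simpl. auto.
  - exists (x, y, z). unfold triangle_in, tri_triple, perimeter_triple, apex; simpl. auto.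
Qed.

End Goursat.

Lemma C_complete (u : nat -> C) :
  (forall eps, 0 < eps -> exists N, forall n m, (N <= n)%nat -> (N <= m)%nat -> Cmod (u n - u m) < eps) ->
  exists l, forall eps, 0 < eps -> exists N, forall n, (N <= n)%nat -> Cmod (u n - l) < eps.
Proof.
  intros H.
  assert (H1 : Cauchy_crit (fun n => fst (u n))).
  { intros eps He. destruct (H eps He) as [N HN]. exists N. intros n m Hn Hm.
    eapply Rle_lt_trans; [|exact (HN n m Hn Hm)]. apply (Cmod_fst (u n - u m)). }
  assert (H2 : Cauchy_crit (fun n => snd (u n))).
  { intros eps He. destruct (H eps He) as [N HN]. exists N. intros n m Hn Hm.
    eapply Rle_lt_trans; [|exact (HN n m Hn Hm)]. apply (Cmod_snd (u n - u m)). }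
  destruct (Rcomplete.R_complete _ H1) as [l1 L1]. destruct (Rcomplete.R_complete _ H2) as [l2 L2].
  exists (l1, l2). intros eps He.
  destruct (L1 (eps / 2)%R ltac:(lra)) as [N1 E1]. destruct (L2 (eps / 2)%R ltac:(lra)) as [N2 E2].
  exists (Nat.max N1 N2). intros n Hn.
  specialize (E1 n ltac:(lia)). specialize (E2 n ltac:(lia)). unfold Rdist in E1, E2.
  eapply Rle_lt_trans; [apply Cmod_le_add|].
  change (Rabs (fst (u n) - l1) + Rabs (snd (u n) - l2) < eps). lra.
Qed.

Section GoursatTheorem.

Variables (K : C -> Prop) (u : C -> C).
Hypothesis K_convex : forall a b (t : R), K a -> K b -> 0 <= t <= 1 -> K (a + RtoC t * (b - a)).
Hypothesis K_closed : forall p, (forall eps, 0 < eps -> exists x, K x /\ Cmod (x - p) < eps) -> K p.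
Hypothesis u_holo : forall z, K z -> exists l, holo_at u z l.

Lemma tri_affine (p q a b c : C) : tri (fun z => p + q * z) a b c = 0.
Proof. unfold tri. rewrite !seg_affine. field. Qed.

(** An affine function has a primitive and integrates to 0 around the triangle, so only the
    deviation of [u] from its affine approximation counts. *)
Lemma tri_near (p l a b c : C) (e : R) : K a -> K b -> K c ->
  (forall x, Cmod (x - a) <= perimeter a b c -> Cmod (u x - u p - l * (x - p)) <= e) ->
  Cmod (tri u a b c) <= 2 * e * perimeter a b c.
Proof.
  intros Ha Hb Hc He.
  set (v := fun z => u p - l * p + l * z).
  assert (Hv : forall a b, seg_cont v a b).
  { intros a' b' t _. apply (holo_at_cont _ _ (0 + l * 1)). apply holo_at_plus; [apply holo_at_const|].
    apply holo_at_scal, holo_at_id. }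
  assert (Hu : forall a b, K a -> K b -> seg_cont u a b) by (intros; apply (holo_seg_cont K); assumption).
  pose proof (Cmod_ge_0 (b - a)) as P1. pose proof (Cmod_ge_0 (c - b)) as P2. pose proof (Cmod_ge_0 (a - c)) as P3.
  assert (Hs : forall a' b', K a' -> K b' -> Cmod (a' - a) <= perimeter a b c -> Cmod (b' - a) <= perimeter a b c ->
     Cmod (seg (fun z => u z - v z) a' b') <= 2 * e * Cmod (b' - a')).
  { intros a' b' Ka Kb Da Db. apply seg_bound.
    - intros t Ht.
      destruct (u_holo _ (K_convex a' b' t Ka Kb Ht)) as [l' Hl'].
      apply (holo_at_cont _ _ (l' - (0 + l * 1))).
      apply holo_at_minus; [exact Hl'|]. apply holo_at_plus; [apply holo_at_const|].
      apply holo_at_scal, holo_at_id.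
    - intros t Ht. unfold v.
      replace (u (a' + RtoC t * (b' - a')) - (u p - l * p + l * (a' + RtoC t * (b' - a'))))
        with (u (a' + RtoC t * (b' - a')) - u p - l * (a' + RtoC t * (b' - a') - p)) by ring.
      apply He.
      replace (a' + RtoC t * (b' - a') - a) with (RtoC (1 - t) * (a' - a) + RtoC t * (b' - a))
        by (rewrite RtoC_minus; ring).
      eapply Rle_trans; [apply Cmod_triangle|]. rewrite !Cmod_mult, !Cmod_R, !Rabs_right by lra. nra. }
  assert (E : tri u a b c = seg (fun z => u z - v z) a b + seg (fun z => u z - v z) b c + seg (fun z => u z - v z) c a).
  { rewrite !seg_minus by auto.
    replace (tri u a b c) with (tri u a b c - tri v a b c) by (unfold v; rewrite tri_affine; ring).
    unfold tri. ring. }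
  rewrite E.
  assert (D0 : Cmod (a - a) <= perimeter a b c) by (rewrite Cmod_self_sub; unfold perimeter; lra).
  assert (D1 : Cmod (b - a) <= perimeter a b c) by (unfold perimeter; lra).
  assert (D2 : Cmod (c - a) <= perimeter a b c) by (rewrite Cmod_sub_sym; unfold perimeter; lra).
  pose proof (Hs a b Ha Hb D0 D1) as S1. pose proof (Hs b c Hb Hc D1 D2) as S2. pose proof (Hs c a Hc Ha D2 D0) as S3.
  eapply Rle_trans; [apply Cmod_triangle|].
  eapply Rle_trans; [apply Rplus_le_compat_r, Cmod_triangle|]. unfold perimeter. lra.
Qed.

(** After [n] bisections the integral has lost at most a factor [4^n]. Complex differentiability at
    the common limit point bounds the small integral by [e] times the squared perimeter, that is by
    a multiple of [e p0^2 / 4^n], and [e] is arbitrary. *)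
Lemma goursat (a b c : C) : K a -> K b -> K c -> tri u a b c = 0.
Proof.
  intros Ha Hb Hc.
  set (step := fun T : {T | triangle_in K T} =>
    let (T', H) := constructive_indefinite_description _ (bisect_step K u K_convex u_holo (proj1_sig T) (proj2_sig T)) in
    exist (triangle_in K) T' (proj1 H)).
  assert (Hstep : forall T, Cmod (tri_triple u (proj1_sig T)) <= 4 * Cmod (tri_triple u (proj1_sig (step T))) /\
     perimeter_triple (proj1_sig (step T)) = (perimeter_triple (proj1_sig T) / 2)%R /\
     Cmod (apex (proj1_sig (step T)) - apex (proj1_sig T)) <= perimeter_triple (proj1_sig T)).
  { intros T. unfold step. destruct (constructive_indefinite_description _ _) as [T' H]. simpl. exact (proj2 H). }
  clearbody step.
  set (T0 := exist (triangle_in K) (a, b, c) (conj Ha (conj Hb Hc))).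
  set (S := fun n => proj1_sig (Nat.iter n step T0)).
  set (p0 := perimeter a b c).
  assert (Hp0 : 0 <= p0).
  { unfold p0, perimeter. pose proof (Cmod_ge_0 (b - a)). pose proof (Cmod_ge_0 (c - b)). pose proof (Cmod_ge_0 (a - c)). lra. }
  assert (HK : forall n, triangle_in K (S n)) by (intros n; exact (proj2_sig (Nat.iter n step T0))).
  assert (Hper : forall n, perimeter_triple (S n) = (p0 / 2 ^ n)%R).
  { induction n. - unfold S, p0; simpl. field.
    - destruct (Hstep (Nat.iter n step T0)) as [_ [E _]]. change (perimeter_triple (proj1_sig (step (Nat.iter n step T0))) = p0 / 2 ^ (Datatypes.S n))%R.
      rewrite E. change (perimeter_triple (S n) / 2 = p0 / 2 ^ Datatypes.S n)%R. rewrite IHn. simpl pow. field. apply pow_nonzero. lra. }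
  assert (Htri : forall n, Cmod (tri u a b c) <= 4 ^ n * Cmod (tri_triple u (S n))).
  { induction n. - unfold S; simpl. lra.
    - destruct (Hstep (Nat.iter n step T0)) as [E _]. change (Cmod (tri_triple u (S n)) <= 4 * Cmod (tri_triple u (S (Datatypes.S n)))) in E.
      eapply Rle_trans; [exact IHn|]. pose proof (pow_lt 4 n ltac:(lra)).
      simpl pow. rewrite (Rmult_comm 4), Rmult_assoc. apply Rmult_le_compat_l; [lra | exact E]. }
  (* Perimeters are halved, so [2 p_n - 2 p_(n+j)] is exactly the sum of the perimeters from step
     [n] to step [n+j-1]. *)
  assert (Hap : forall n j, Cmod (apex (S (n + j)%nat) - apex (S n)) <= 2 * perimeter_triple (S n) - 2 * perimeter_triple (S (n + j)%nat)).
  { intros n. induction j.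
    - rewrite Nat.add_0_r, Cmod_self_sub. lra.
    - destruct (Hstep (Nat.iter (n + j) step T0)) as [_ [E1 E2]].
      rewrite Nat.add_succ_r.
      change (perimeter_triple (S (Datatypes.S (n + j))) = perimeter_triple (S (n + j)%nat) / 2)%R in E1.
      change (Cmod (apex (S (Datatypes.S (n + j))) - apex (S (n + j)%nat)) <= perimeter_triple (S (n + j)%nat)) in E2.
      rewrite E1.
      eapply Rle_trans; [apply Cmod_tri_sub with (y := apex (S (n + j)%nat))|]. lra. }
  assert (Hpos : forall n, 0 <= perimeter_triple (S n)).
  { intros n. rewrite Hper. apply Rmult_le_pos; [exact Hp0|]. left. apply Rinv_0_lt_compat, pow_lt. lra. }
  assert (Hsmall : forall eps, 0 < eps -> exists N, forall n, (N <= n)%nat -> perimeter_triple (S n) < eps).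
  { intros eps He. destruct (pow_lt_1_zero (/ 2) ltac:(rewrite Rabs_right; lra) (eps / (p0 + 1))
      ltac:(apply Rdiv_lt_0_compat; lra)) as [N HN].
    exists N. intros n Hn. rewrite Hper. specialize (HN n Hn).
    rewrite Rabs_right in HN by (apply Rle_ge, pow_le; lra). rewrite pow_inv in HN.
    pose proof (Rinv_0_lt_compat _ (pow_lt 2 n ltac:(lra))).
    apply Rle_lt_trans with ((p0 + 1) * / 2 ^ n)%R; [unfold Rdiv; nra|].
    apply (Rmult_lt_compat_l (p0 + 1)) in HN; [|lra].
    replace ((p0 + 1) * (eps / (p0 + 1)))%R with eps in HN by (field; lra). exact HN. }
  destruct (C_complete (fun n => apex (S n))) as [p Hp].
  { intros eps He. destruct (Hsmall (eps / 4)%R ltac:(lra)) as [N HN]. exists N.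
    intros n m Hn Hm. specialize (HN N (Nat.le_refl N)).
    pose proof (Hap N (n - N)%nat) as A1. pose proof (Hap N (m - N)%nat) as A2.
    replace (N + (n - N))%nat with n in A1 by lia. replace (N + (m - N))%nat with m in A2 by lia.
    pose proof (Hpos n). pose proof (Hpos m).
    eapply Rle_lt_trans; [apply Cmod_tri_sub with (y := apex (S N))|].
    rewrite (Cmod_sub_sym (apex (S N))). lra. }
  assert (Kp : K p).
  { apply K_closed. intros eps He. destruct (Hp eps He) as [N HN]. exists (apex (S N)).
    split; [|apply HN; lia]. pose proof (HK N) as HKN. destruct (S N) as [[x y] z]. exact (proj1 HKN). }
  assert (Hpd : forall n, Cmod (apex (S n) - p) <= 2 * perimeter_triple (S n)).
  { intros n. apply Rnot_lt_le. intros Hlt.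
    destruct (Hp _ (proj2 (Rlt_0_minus _ _) Hlt)) as [N HN]. specialize (HN (n + N)%nat ltac:(lia)).
    pose proof (Hap n N) as A. pose proof (Hpos (n + N)%nat).
    pose proof (Cmod_tri_sub (apex (S n)) (apex (S (n + N)%nat)) p) as T.
    rewrite (Cmod_sub_sym (apex (S n)) (apex (S (n + N)%nat))) in T. lra. }
  destruct (u_holo p Kp) as [l Hl].
  apply Cmod_eq_0. apply Rle_antisym; [|apply Cmod_ge_0].
  apply Rle_plus_epsilon. intros eps He. rewrite Rplus_0_l.
  (* Points of the small triangle lie within three perimeters of the limit: one to reach the apex,
     two from the apex to [p]. With the factor 2 of [tri_near] this gives [6 e p0^2]. *)
  set (e := (eps / (6 * (p0 * p0) + 1))%R).
  assert (He' : 0 < e) by (apply Rdiv_lt_0_compat; nra).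
  destruct (Hl e He') as [d [Hd H1]].
  destruct (Hsmall (d / 3)%R ltac:(lra)) as [N HN]. specialize (HN N (Nat.le_refl N)).
  specialize (Htri N). specialize (HK N). pose proof (Hpd N) as HpdN. pose proof (Hper N) as HperN. pose proof (Hpos N) as HposN.
  destruct (S N) as [[x y] z] eqn:ES. simpl in *. unfold apex in HpdN; simpl in HpdN.
  destruct HK as [Kx [Ky Kz]].
  assert (B : Cmod (tri u x y z) <= 2 * (e * (3 * perimeter x y z)) * perimeter x y z).
  { apply tri_near with p l; try assumption. intros q Hq.
    assert (Hqp : Cmod (q - p) <= 3 * perimeter x y z).
    { eapply Rle_trans; [apply Cmod_tri_sub with (y := x)|]. lra. }
    specialize (H1 q p eq_refl ltac:(lra) ltac:(rewrite Cmod_self_sub; lra)).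
    rewrite Cmult_0_l in H1. unfold Cminus in H1 at 1. rewrite Copp_0, Cplus_0_r in H1.
    eapply Rle_trans; [exact H1|]. apply Rmult_le_compat_l; lra. }
  eapply Rle_trans; [exact Htri|].
  apply Rle_trans with (4 ^ N * (2 * (e * (3 * perimeter x y z)) * perimeter x y z))%R.
  { apply Rmult_le_compat_l; [|exact B]. apply pow_le. lra. }
  rewrite HperN.
  assert (E4 : (4 ^ N = 2 ^ N * 2 ^ N)%R) by (rewrite <- Rpow_mult_distr; f_equal; ring).
  rewrite E4. pose proof (pow_lt 2 N ltac:(lra)).
  replace (2 ^ N * 2 ^ N * (2 * (e * (3 * (p0 / 2 ^ N))) * (p0 / 2 ^ N)))%R with (e * (6 * (p0 * p0)))%R by (field; lra).
  apply Rle_trans with (e * (6 * (p0 * p0) + 1))%R; [nra|].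
  right. unfold e. field. nra.
Qed.

End GoursatTheorem.

Lemma convex_ball_closed (a b : C) (t r : R) : Cmod a <= r -> Cmod b <= r -> 0 <= t <= 1 ->
  Cmod (a + RtoC t * (b - a)) <= r.
Proof.
  intros Ha Hb Ht.
  replace (a + RtoC t * (b - a)) with (RtoC (1 - t) * a + RtoC t * b) by (rewrite RtoC_minus; ring).
  eapply Rle_trans; [apply Cmod_triangle|]. rewrite !Cmod_mult, !Cmod_R, !Rabs_right by lra. nra.
Qed.

Lemma seg_refl (u : C -> C) (a : C) : seg u a a = 0.
Proof. unfold seg. ring. Qed.

Section Primitive.

(* Continuity suffices at the exceptional point [w]: triangles with vertex [w] are
   exhausted by triangles avoiding it. *)
Variables (u : C -> C) (w : C).
Hypothesis Hw : disk w.
Hypothesis u_cont : forall z, disk z -> cont_at u z.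
Hypothesis u_holo : forall z, disk z -> z <> w -> exists l, holo_at u z l.

Lemma disk_seg_cont (a b : C) : disk a -> disk b -> seg_cont u a b.
Proof.
  intros Ha Hb t Ht. apply u_cont. unfold disk in *.
  replace (a + RtoC t * (b - a)) with (a + RtoC t * (b - a) - 0) by ring.
  apply ball_convex; [| |exact Ht].
  - replace (b - 0) with b by ring. exact Hb.
  - replace (a - 0) with a by ring. exact Ha.
Qed.

Lemma re_conj_linear (x d : C) : (Rabs (fst (x * Cconj d)%C) <= Cmod x * Cmod d)%R.
Proof. eapply Rle_trans; [apply Cmod_fst|]. rewrite Cmod_mult, Cmod_conj. lra. Qed.

(** Shrinking the triangle towards [w] by a factor [s] cuts off a quadrilateral on which Goursat
    applies, and the small triangle contributes at most a constant times [s]. The condition on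
    [z' - z] keeps [z] and [z'] on the same side of a line through [w] orthogonal to [z - w], so
    that the quadrilateral avoids [w]. *)
Lemma vertex_triangle (z z' : C) : disk z -> disk z' -> Cmod (z' - z) <= Cmod (z - w) / 2 ->
  tri u w z z' = 0.
Proof.
  intros Hz Hz' Hd.
  destruct (Ceq_dec z w) as [->|Hzw].
  { assert (E : z' = w).
    { rewrite Cmod_self_sub in Hd. pose proof (Cmod_ge_0 (z' - w)).
      assert (E : z' - w = 0) by (apply Cmod_eq_0; lra).
      replace z' with (z' - w + w) by ring. rewrite E. ring. }
    subst z'. unfold tri. rewrite !seg_refl. ring. }
  set (d := z - w) in *.
  assert (Hd0 : 0 < Cmod d).
  { apply Cmod_gt_0. intros E. apply Hzw. replace z with (d + w) by (unfold d; ring). rewrite E. ring. }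
  set (rho := Rmax (Cmod w) (Rmax (Cmod z) (Cmod z'))).
  assert (Hrho : rho < 1) by (unfold rho; repeat apply Rmax_lub_lt; assumption).
  assert (Rw : Cmod w <= rho) by apply Rmax_l.
  assert (Rz : Cmod z <= rho) by (eapply Rle_trans; [apply Rmax_l | apply Rmax_r]).
  assert (Rz' : Cmod z' <= rho) by (eapply Rle_trans; [apply Rmax_r | apply Rmax_r]).
  assert (Nd : fst (d * Cconj d)%C = (Cmod d * Cmod d)%R) by (rewrite Cmult_comm; apply Cmod_sqr_re).
  assert (Nz' : fst ((z' - w) * Cconj d)%C >= Cmod d * Cmod d / 2).
  { replace ((z' - w) * Cconj d) with (d * Cconj d + (z' - z) * Cconj d) by (unfold d; ring).
    change (fst (d * Cconj d)%C + fst ((z' - z) * Cconj d)%C >= Cmod d * Cmod d / 2).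
    pose proof (re_conj_linear (z' - z) d) as B. apply Rabs_le_between in B. nra. }
  assert (Hs : forall s, 0 < s <= 1 ->
     tri u w z z' = tri u w (w + RtoC s * (z - w)) (w + RtoC s * (z' - w))).
  { intros s Hs. set (zs := w + RtoC s * (z - w)). set (zs' := w + RtoC s * (z' - w)).
    assert (Rs : Cmod zs <= rho) by (apply convex_ball_closed; try assumption; lra).
    assert (Rs' : Cmod zs' <= rho) by (apply convex_ball_closed; try assumption; lra).
    (* A closed disk cut by a closed half-plane whose boundary line is orthogonal to [d] and misses
       [w]; it contains all four corners. *)
    set (K := fun x : C => Cmod x <= rho /\ fst ((x - w) * Cconj d)%C >= s * (Cmod d * Cmod d / 2)).
    assert (K1 : forall a b (t : R), K a -> K b -> 0 <= t <= 1 -> K (a + RtoC t * (b - a))).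
    { intros a b t [A1 A2] [B1 B2] Ht. split; [apply convex_ball_closed; assumption|].
      replace ((a + RtoC t * (b - a) - w) * Cconj d) with
        (RtoC (1 - t) * ((a - w) * Cconj d) + RtoC t * ((b - w) * Cconj d)) by (rewrite RtoC_minus; ring).
      set (p := (a - w) * Cconj d) in *. set (q := (b - w) * Cconj d) in *.
      replace (fst (RtoC (1 - t) * p + RtoC t * q)) with ((1 - t) * fst p + t * fst q)%R
        by (unfold Cplus, Cmult, RtoC; simpl; ring).
      pose proof (Rmult_le_compat_l (1 - t) _ _ ltac:(lra) (Rge_le _ _ A2)).
      pose proof (Rmult_le_compat_l t _ _ ltac:(lra) (Rge_le _ _ B2)). lra. }
    assert (K2 : forall p, (forall eps, 0 < eps -> exists x, K x /\ Cmod (x - p) < eps) -> K p).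
    { intros p Hp. split.
      - apply Rle_plus_epsilon. intros eps He. destruct (Hp eps He) as [x [[X1 _] X2]].
        pose proof (Cmod_ge_sub p x) as T. rewrite Cmod_sub_sym in T. lra.
      - apply Rle_ge, Rle_plus_epsilon. intros eps He.
        destruct (Hp (eps / Cmod d)%R ltac:(apply Rdiv_lt_0_compat; lra)) as [x [[_ X1] X2]].
        pose proof (re_conj_linear (x - p) d) as T. apply Rabs_le_between in T.
        assert (T2 : Cmod (x - p) * Cmod d < eps).
        { apply (Rmult_lt_compat_r (Cmod d)) in X2; [|lra].
          replace (eps / Cmod d * Cmod d)%R with eps in X2 by (field; lra). exact X2. }
        replace ((p - w) * Cconj d) with ((x - w) * Cconj d - (x - p) * Cconj d) by ring.
        change (s * (Cmod d * Cmod d / 2) <= fst ((x - w) * Cconj d)%C - fst ((x - p) * Cconj d)%C + eps). lra. }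
    assert (K3 : forall x, K x -> exists l, holo_at u x l).
    { intros x [X1 X2]. apply u_holo; [unfold disk; lra|]. intros ->.
      replace ((w - w) * Cconj d) with (RtoC 0) in X2 by ring. simpl in X2.
      assert (0 < s * (Cmod d * Cmod d / 2)) by (apply Rmult_lt_0_compat; nra). lra. }
    assert (Dd : 0 < Cmod d * Cmod d / 2) by nra.
    assert (Kz : K z) by (split; [exact Rz | fold d; rewrite Nd; nra]).
    assert (Kz' : K z') by (split; [exact Rz' | nra]).
    assert (Kzs : K zs).
    { split; [exact Rs|]. replace ((zs - w) * Cconj d) with (RtoC s * (d * Cconj d)) by (unfold zs, d; ring).
      replace (fst (RtoC s * (d * Cconj d))) with (s * fst (d * Cconj d)%C)%R by (unfold Cmult, RtoC; simpl; ring).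
      rewrite Nd. nra. }
    assert (Kzs' : K zs').
    { split; [exact Rs'|]. replace ((zs' - w) * Cconj d) with (RtoC s * ((z' - w) * Cconj d)) by (unfold zs'; ring).
      set (q := (z' - w) * Cconj d) in *.
      replace (fst (RtoC s * q)) with (s * fst q)%R by (unfold Cmult, RtoC; simpl; ring). nra. }
    (* The quadrilateral is divided by the diagonal from [zs] to [z']. *)
    pose proof (goursat K u K1 K2 K3 zs z z' Kzs Kz Kz') as G1.
    pose proof (goursat K u K1 K2 K3 zs z' zs' Kzs Kz' Kzs') as G2.
    assert (Dx : forall x, Cmod x <= rho -> disk x) by (intros x Hx; unfold disk; lra).
    unfold tri in *.
    rewrite (seg_split u w z s), (seg_swap u w z') by (try apply disk_seg_cont; auto; lra).
    rewrite (seg_split u w z' s) by (try apply disk_seg_cont; auto; lra). fold zs zs'.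
    rewrite (seg_swap u w zs') by (apply disk_seg_cont; auto).
    rewrite (seg_swap u zs zs') in G2 by (apply disk_seg_cont; auto).
    rewrite (seg_swap u zs z') in G1 by (apply disk_seg_cont; auto).
    rewrite (seg_swap u zs' z') in G2 by (apply disk_seg_cont; auto).
    transitivity (seg u w zs + seg u zs zs' - seg u w zs' + (seg u zs z + seg u z z' + - seg u zs z')
       + (seg u zs z' + - seg u zs' z' + - seg u zs zs')); [ring | rewrite G1, G2; ring]. }
  apply Cmod_eq_0. apply Rle_antisym; [|apply Cmod_ge_0].
  apply Rle_plus_epsilon. intros eps He. rewrite Rplus_0_l.
  destruct (u_cont w Hw 1%R ltac:(lra)) as [r [Hr Hb]].
  set (M := (Cmod (u w) + 1)%R). pose proof (Cmod_ge_0 (u w)) as PM.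
  set (L := (perimeter w z z' + 1)%R).
  pose proof (Cmod_ge_0 (z - w)) as Q1. pose proof (Cmod_ge_0 (z' - z)) as Q2. pose proof (Cmod_ge_0 (w - z')) as Q3.
  assert (HL : 1 <= L) by (unfold L, perimeter; lra).
  (* The second entry puts the shrunk triangle where [|u| <= M], the third makes the bound [2 M s L]
     at most [eps]. *)
  set (s := Rmin 1 (Rmin (r / (2 * L)) (eps / (2 * M * L)))).
  assert (Hs0 : 0 < s).
  { repeat apply Rmin_pos; try lra; apply Rdiv_lt_0_compat; unfold M; nra. }
  assert (Hs1 : s <= 1) by apply Rmin_l.
  assert (Hs2 : s * L <= r / 2).
  { apply Rle_trans with (r / (2 * L) * L)%R.
    - apply Rmult_le_compat_r; [lra|]. eapply Rle_trans; [apply Rmin_r | apply Rmin_l].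
    - right. field. lra. }
  assert (Hs3 : 2 * M * (s * L) <= eps).
  { apply Rle_trans with (2 * M * (eps / (2 * M * L) * L))%R.
    - apply Rmult_le_compat_l; [unfold M; lra|]. apply Rmult_le_compat_r; [lra|].
      eapply Rle_trans; [apply Rmin_r | apply Rmin_r].
    - right. field. unfold M. lra. }
  clearbody s. rewrite (Hs s ltac:(lra)).
  set (zs := w + RtoC s * (z - w)). set (zs' := w + RtoC s * (z' - w)).
  assert (B1 : Cmod (zs - w) = (s * Cmod (z - w))%R).
  { replace (zs - w) with (RtoC s * (z - w)) by (unfold zs; ring). rewrite Cmod_mult, Cmod_R, Rabs_right by lra. reflexivity. }
  assert (B2 : Cmod (zs' - zs) = (s * Cmod (z' - z))%R).
  { replace (zs' - zs) with (RtoC s * (z' - z)) by (unfold zs, zs'; ring). rewrite Cmod_mult, Cmod_R, Rabs_right by lra. reflexivity. }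
  assert (B3 : Cmod (w - zs') = (s * Cmod (w - z'))%R).
  { replace (w - zs') with (RtoC s * (w - z')) by (unfold zs'; ring). rewrite Cmod_mult, Cmod_R, Rabs_right by lra. reflexivity. }
  assert (Ds : disk zs) by (unfold disk; eapply Rle_lt_trans; [apply convex_ball_closed with (r := rho); try assumption; lra | exact Hrho]).
  assert (Ds' : disk zs') by (unfold disk; eapply Rle_lt_trans; [apply convex_ball_closed with (r := rho); try assumption; lra | exact Hrho]).
  assert (Hnear : forall x y, Cmod (x - w) < r -> Cmod (y - w) < r -> disk x -> disk y ->
     Cmod (seg u x y) <= 2 * M * Cmod (y - x)).
  { intros x y Hx Hy Dx Dy. apply seg_bound; [apply disk_seg_cont; assumption|].
    intros t Ht. pose proof (ball_convex w y x r t Hy Hx Ht) as HB. specialize (Hb _ HB).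
    pose proof (Cmod_ge_sub (u (x + RtoC t * (y - x))) (u w)). unfold M. lra. }
  assert (L1 : s * Cmod (z - w) <= s * L) by (apply Rmult_le_compat_l; unfold L, perimeter; lra).
  assert (L3 : s * Cmod (w - z') <= s * L) by (apply Rmult_le_compat_l; unfold L, perimeter; lra).
  assert (Dw : Cmod (w - w) < r) by (rewrite Cmod_self_sub; exact Hr).
  assert (Dzs : Cmod (zs - w) < r) by (rewrite B1; lra).
  assert (Dzs' : Cmod (zs' - w) < r) by (rewrite Cmod_sub_sym, B3; lra).
  pose proof (Hnear w zs Dw Dzs Hw Ds) as S1. pose proof (Hnear zs zs' Dzs Dzs' Ds Ds') as S2.
  pose proof (Hnear zs' w Dzs' Dw Ds' Hw) as S3. rewrite B1 in S1. rewrite B2 in S2. rewrite B3 in S3.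
  unfold tri. eapply Rle_trans; [apply Cmod_triangle|].
  eapply Rle_trans; [apply Rplus_le_compat_r, Cmod_triangle|].
  apply Rle_trans with (2 * M * (s * L))%R; [|exact Hs3].
  assert (E : (s * L = s * Cmod (z - w) + s * Cmod (z' - z) + s * Cmod (w - z') + s)%R) by (unfold L, perimeter; ring).
  rewrite E. assert (0 <= 2 * M * s) by (apply Rmult_le_pos; unfold M; lra). lra.
Qed.

Lemma disk_open (z : C) : disk z -> exists r, 0 < r /\ forall x, Cmod (x - z) < r -> disk x.
Proof.
  intros Hz. exists (1 - Cmod z)%R. unfold disk in *. split; [lra|]. intros x Hx.
  pose proof (Cmod_ge_sub x z). lra.
Qed.

Lemma primitive_exists : exists H, forall z, disk z -> holo_at H z (u z).
Proof.
  exists (seg u w). intros z Hz eps He.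
  destruct (u_cont z Hz (eps / 2)%R ltac:(lra)) as [d [Hd Hc]].
  destruct (disk_open z Hz) as [r [Hr Ho]].
  (* Within [q] of [z] the condition of [vertex_triangle] holds. For [z = w] no triangle arises and
     any positive radius would do. *)
  set (q := if Ceq_dec z w then 1%R else (Cmod (z - w) / 2)%R).
  assert (Hq : 0 < q).
  { unfold q. destruct (Ceq_dec z w) as [|n]; [lra|].
    assert (0 < Cmod (z - w)); [|lra]. apply Cmod_gt_0. intros E. apply n.
    replace z with (z - w + w) by ring. rewrite E. ring. }
  assert (T : forall x, disk x -> Cmod (x - z) < q -> seg u w x - seg u w z = seg u z x).
  { intros x Hx Hxq. unfold q in Hxq. destruct (Ceq_dec z w) as [->|n].
    - rewrite seg_refl. ring.
    - pose proof (vertex_triangle z x Hz Hx ltac:(lra)) as V. unfold tri in V.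
      rewrite (seg_swap u w x) in V by (apply disk_seg_cont; assumption).
      replace (seg u w x - seg u w z) with (seg u z x - (seg u w z + seg u z x + - seg u w x)) by ring.
      rewrite V. ring. }
  exists (Rmin d (Rmin r q)). split; [repeat apply Rmin_pos; assumption|].
  intros x y -> Hx _.
  pose proof (Rmin_l d (Rmin r q)). pose proof (Rmin_r d (Rmin r q)).
  pose proof (Rmin_l r q). pose proof (Rmin_r r q).
  assert (Dx : disk x) by (apply Ho; lra).
  rewrite (T x Dx ltac:(lra)), Cmult_0_l. unfold Cminus at 1. rewrite Copp_0, Cplus_0_r.
  assert (Hcst : seg_cont (fun _ => u z + 0 * 0) z x).
  { intros t _. apply (holo_at_cont _ _ 0), holo_at_const. }
  assert (E : seg (fun v => u v - (u z + 0 * 0)) z x = seg u z x - u z * (x - z)).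
  { rewrite seg_minus; [|apply disk_seg_cont; assumption | exact Hcst]. f_equal.
    pose proof (seg_affine (u z) 0 z x) as A.
    replace (u z * (x - z)) with (u z * (x - z) + 0 * (x * x - z * z) / 2) by field. rewrite <- A.
    unfold seg. f_equal. apply CI_ext. intros t _. ring. }
  rewrite <- E. replace (eps * Cmod (x - z))%R with (2 * (eps / 2) * Cmod (x - z))%R by field.
  apply seg_bound.
  - intros t Ht e' He'. destruct (disk_seg_cont z x Hz Dx t Ht e' He') as [d' [Hd' H']].
    exists d'. split; [exact Hd'|]. intros v Hv. specialize (H' v Hv).
    replace (u v - (u z + 0 * 0) - (u (z + RtoC t * (x - z)) - (u z + 0 * 0)))
      with (u v - u (z + RtoC t * (x - z))) by ring. exact H'.
  - intros t Ht. left. replace (u (z + RtoC t * (x - z)) - (u z + 0 * 0)) with (u (z + RtoC t * (x - z)) - u z) by ring.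
    apply Hc. apply ball_convex; [lra | rewrite Cmod_self_sub; lra | exact Ht].
Qed.

End Primitive.

(** * Circle integrals and the Cauchy formula *)

Definition circ (r t : R) : C := RtoC r * cexp (Ci * RtoC t).

Lemma Cmod_circ (r t : R) : 0 <= r -> Cmod (circ r t) = r.
Proof.
  intros Hr. unfold circ. rewrite Cmod_mult, Cmod_R, Cmod_cexp, Rabs_right by lra.
  replace (fst (Ci * RtoC t)) with 0%R by (unfold Ci, Cmult, RtoC; simpl; ring).
  rewrite exp_0. ring.
Qed.

Lemma circ_deriv (r t : R) : curve_deriv (circ r) t (Ci * circ r t).
Proof.
  unfold circ.
  apply (curve_deriv_eq _ _ (RtoC r * (cexp (Ci * RtoC t) * (Ci * 1)))); [|ring].
  apply curve_deriv_scal. apply (curve_deriv_holo cexp (fun s => Ci * RtoC s)); [apply holo_at_cexp|].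
  apply curve_deriv_scal, curve_deriv_id.
Qed.

Lemma circ_closed (r : R) : circ r (2 * PI) = circ r 0.
Proof.
  unfold circ. f_equal. unfold cexp, Ci, Cmult, RtoC; simpl.
  replace (0 * (2 * PI) - 1 * 0)%R with (0 * 0 - 1 * 0)%R by ring.
  replace (0 * 0 + 1 * (2 * PI))%R with (2 * PI)%R by ring. replace (0 * 0 + 1 * 0)%R with 0%R by ring.
  rewrite cos_2PI, sin_2PI, cos_0, sin_0. reflexivity.
Qed.

Lemma circ_cont (r t : R) : curve_cont (circ r) t.
Proof. eapply curve_deriv_cont, circ_deriv. Qed.

Lemma circ_sub_neq (r t : R) (w : C) : Cmod w < r -> circ r t - w <> 0.
Proof.
  intros Hw E. pose proof (Cmod_ge_0 w). pose proof (Cmod_circ r t ltac:(lra)) as Hc.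
  replace (circ r t) with (circ r t - w + w) in Hc by ring. rewrite E, Cplus_0_l in Hc. lra.
Qed.

Lemma curve_cont_inv_circ (r : R) (w : C) (t : R) : Cmod w < r -> curve_cont (fun s => / (circ r s - w)) t.
Proof.
  intros Hw. apply (cont_curve_comp Cinv (fun s => circ r s - w)).
  - eapply holo_at_cont, holo_at_inv, circ_sub_neq, Hw.
  - apply curve_cont_minus; [apply circ_cont | apply curve_cont_const].
Qed.

Lemma cont_on_all (u : R -> C) (a b : R) : (forall t, curve_cont u t) -> cont_on u a b.
Proof. intros H t _. apply H. Qed.

Lemma two_PI_pos : 0 < 2 * PI.
Proof. pose proof PI_RGT_0. lra. Qed.

(** With [s = circ r t] the integrand is [ds / (i (s - w))]. A primitive is [t - i log (1 - w/s)]: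
    because [|w| < |s|], the argument of the logarithm stays in the right half-plane, so the
    principal branch closes up after one turn and only [t] contributes. *)
Lemma winding_kernel (r : R) (w : C) : Cmod w < r ->
  CI (fun t => circ r t * / (circ r t - w)) 0 (2 * PI) = RtoC (2 * PI).
Proof.
  intros Hw. pose proof (Cmod_ge_0 w) as Hw0.
  assert (Hc0 : forall t, circ r t <> 0).
  { intros t. replace (circ r t) with (circ r t - 0) by ring. apply circ_sub_neq. rewrite Cmod_0. lra. }
  assert (Hre : forall t, 0 < fst (1 - w / circ r t)).
  { intros t. assert (Cmod (w / circ r t) < 1).
    { rewrite Cmod_div, Cmod_circ by (auto; lra). apply Rmult_lt_reg_r with r; [lra|].
      unfold Rdiv. rewrite Rmult_assoc, Rinv_l by lra. lra. }
    pose proof (Cmod_fst (w / circ r t)) as F. apply Rabs_le_between in F.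
    change (0 < 1 - fst (w / circ r t)). lra. }
  assert (Ew : forall t, 1 + - w * / circ r t = 1 - w / circ r t) by (intros; unfold Cdiv; ring).
  rewrite (CI_FTC (fun t => RtoC t + - Ci * Clog (1 + - w * / circ r t))).
  - rewrite circ_closed. ring.
  - left. apply two_PI_pos.
  - intros t _.
    apply (curve_deriv_eq _ _ (1 + - Ci * (/ (1 - w / circ r t) * (0 + - w * (- / (circ r t * circ r t) * (Ci * circ r t)))))).
    + apply (curve_deriv_plus RtoC (fun s => - Ci * Clog (1 + - w * / circ r s))); [apply curve_deriv_id|].
      apply curve_deriv_scal.
      apply (curve_deriv_holo Clog (fun s => 1 + - w * / circ r s)).
      * rewrite Ew. apply holo_at_Clog, Hre.
      * apply curve_deriv_plus; [apply curve_deriv_const|]. apply curve_deriv_scal.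
        apply (curve_deriv_holo Cinv (circ r)); [apply holo_at_inv, Hc0 | apply circ_deriv].
    + assert (Ci * Ci = - (1)) by (unfold Ci, Cmult, Copp, RtoC; simpl; f_equal; ring).
      pose proof (circ_sub_neq r t w Hw).
      replace (1 - w / circ r t) with ((circ r t - w) / circ r t) by (field; auto).
      transitivity (1 - (Ci * Ci) * w / (circ r t - w)); [field; split; auto|]. rewrite H. field. exact H0.
  - intros t _. apply curve_cont_mult; [apply circ_cont | apply curve_cont_inv_circ, Hw].
Qed.

Lemma disk_circ (r t : R) : 0 <= r < 1 -> disk (circ r t).
Proof. intros Hr. unfold disk. rewrite Cmod_circ; lra. Qed.

Definition holo_disk (f f' : C -> C) : Prop := forall z, disk z -> holo_at f z (f' z).

Lemma holo_disk_curve (f f' : C -> C) (r t : R) : holo_disk f f' -> 0 <= r < 1 ->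
  curve_cont (fun s => f (circ r s)) t.
Proof.
  intros Hf Hr. apply (cont_curve_comp f (circ r)); [|apply circ_cont].
  eapply holo_at_cont, Hf, disk_circ, Hr.
Qed.

(** The difference quotient [g] of [f] at [w], completed by [f' w], is continuous at [w] and
    holomorphic elsewhere. It therefore has a primitive and its circle integral vanishes; what
    remains is [f w] times the winding kernel. *)
Lemma cauchy_formula (f f' : C -> C) (r : R) (w : C) : holo_disk f f' -> Cmod w < r -> r < 1 ->
  CI (fun t => f (circ r t) * circ r t * / (circ r t - w)) 0 (2 * PI) = RtoC (2 * PI) * f w.
Proof.
  intros Hf Hw Hr. pose proof (Cmod_ge_0 w) as Hw0.
  assert (Dw : disk w) by (unfold disk; lra).
  set (g := fun z => if Ceq_dec z w then f' w else (f z - f w) / (z - w)).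
  assert (Hsub : forall z, z <> w -> z - w <> 0).
  { intros z Hz E. apply Hz. replace z with (z - w + w) by ring. rewrite E. ring. }
  assert (Gh : forall z, disk z -> z <> w -> exists l, holo_at g z l).
  { intros z Dz Hz.
    exists ((f' z - 0) * / (z - w) + (f z - f w) * (- / ((z - w) * (z - w)) * (1 - 0))).
    assert (Hd : 0 < Cmod (z - w)) by (apply Cmod_gt_0, Hsub, Hz).
    apply (holo_at_local (fun x => (f x - f w) * / (x - w)) _ z _ (Cmod (z - w))); [exact Hd| |].
    - intros x Hx. unfold g. destruct (Ceq_dec x w) as [->|n]; [|reflexivity].
      rewrite Cmod_sub_sym in Hx. lra.
    - apply (holo_at_mult (fun x => f x - f w) (fun x => / (x - w))).
      + apply holo_at_minus; [apply Hf, Dz | apply holo_at_const].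
      + apply (holo_at_comp (fun x => x - w) Cinv).
        * apply holo_at_minus; [apply holo_at_id | apply holo_at_const].
        * apply holo_at_inv, Hsub, Hz. }
  assert (Gc : forall z, disk z -> cont_at g z).
  { intros z Dz. destruct (Ceq_dec z w) as [->|n].
    - intros eps He. destruct (Hf w Dw (eps / 2)%R ltac:(lra)) as [d [Hd H]].
      exists d. split; [exact Hd|]. intros x Hx. unfold g.
      destruct (Ceq_dec w w) as [_|n]; [|exfalso; apply n; reflexivity].
      destruct (Ceq_dec x w) as [->|n]; [rewrite Cmod_self_sub; exact He|].
      specialize (H x w eq_refl Hx ltac:(rewrite Cmod_self_sub; exact Hd)).
      rewrite Cmult_0_l in H. unfold Cminus in H at 1. rewrite Copp_0, Cplus_0_r in H.
      pose proof (Hsub x n) as Hxw. pose proof (proj1 (Cmod_gt_0 _) Hxw) as Hp.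
      replace ((f x - f w) / (x - w) - f' w) with ((f x - f w - f' w * (x - w)) / (x - w)) by (field; exact Hxw).
      rewrite Cmod_div by exact Hxw. apply Rle_lt_trans with (eps / 2)%R; [|lra].
      apply Rmult_le_reg_r with (Cmod (x - w)); [exact Hp|].
      unfold Rdiv at 1. rewrite Rmult_assoc, Rinv_l by lra. lra.
    - destruct (Gh z Dz n) as [l Hl]. exact (holo_at_cont _ _ _ Hl). }
  destruct (primitive_exists g w Dw Gc Gh) as [H HH].
  assert (Hgc : forall t, curve_cont (fun s => g (circ r s)) t).
  { intros t. apply (cont_curve_comp g (circ r)); [apply Gc, disk_circ; lra | apply circ_cont]. }
  assert (Hfc : forall t, curve_cont (fun s => f (circ r s)) t) by (intros t; apply (holo_disk_curve f f'); [exact Hf|lra]).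
  assert (Hk : forall t, curve_cont (fun s => circ r s * / (circ r s - w)) t).
  { intros t. apply curve_cont_mult; [apply circ_cont | apply curve_cont_inv_circ, Hw]. }
  assert (I0 : CI (fun t => g (circ r t) * (Ci * circ r t)) 0 (2 * PI) = 0).
  { rewrite (CI_FTC (fun t => H (circ r t))).
    - rewrite circ_closed. ring.
    - left. apply two_PI_pos.
    - intros t _. apply (curve_deriv_holo H (circ r)); [apply HH, disk_circ; lra | apply circ_deriv].
    - intros t _. apply curve_cont_mult; [apply Hgc|].
      apply curve_cont_mult; [apply curve_cont_const | apply circ_cont]. }
  assert (HCi : Ci <> 0) by (intros E; apply (f_equal snd) in E; simpl in E; lra).
  assert (I1 : CI (fun t => f (circ r t) * circ r t * / (circ r t - w) - f w * (circ r t * / (circ r t - w))) 0 (2 * PI) = 0).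
  { replace (RtoC 0) with (/ Ci * RtoC 0) by ring. rewrite <- I0, <- CI_scal.
    - apply CI_ext. intros t _. pose proof (circ_sub_neq r t w Hw). unfold g.
      destruct (Ceq_dec (circ r t) w) as [E|_]; [exfalso; apply H0; rewrite E; ring|]. field. split; assumption.
    - apply cont_on_all. intros t. apply curve_cont_mult; [apply Hgc|].
      apply curve_cont_mult; [apply curve_cont_const | apply circ_cont]. }
  rewrite CI_minus, CI_scal, winding_kernel in I1.
  - replace (RtoC (2 * PI) * f w) with (0 + f w * RtoC (2 * PI)) by ring. rewrite <- I1. ring.
  - exact Hw.
  - apply cont_on_all, Hk.
  - apply cont_on_all. intros t. apply curve_cont_mult; [|apply curve_cont_inv_circ, Hw].
    apply curve_cont_mult; [apply Hfc | apply circ_cont].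
  - apply cont_on_all. intros t. apply curve_cont_mult; [apply curve_cont_const | apply Hk].
Qed.

(** Differentiation under the integral sign, with a second-order Taylor remainder that is uniform in
    the parameter of integration. *)
Lemma CI_param (k : C -> R -> C) (k1 : R -> C) (w : C) (a b d M : R) : a <= b -> 0 < d ->
  (forall x t, Cmod (x - w) < d -> curve_cont (k x) t) -> (forall t, curve_cont k1 t) ->
  (forall x t, Cmod (x - w) < d -> a <= t <= b -> Cmod (k x t - k w t - (x - w) * k1 t) <= M * (Cmod (x - w) * Cmod (x - w))) ->
  holo_at (fun x => CI (k x) a b) w (CI k1 a b).
Proof.
  intros Hab Hd Hk Hk1 HM eps He.
  set (N := (2 * (b - a) * Rabs M + 1)%R).
  pose proof (Rabs_pos M) as PM. pose proof (Rle_abs M) as PM2.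
  assert (HN : 1 <= N) by (unfold N; assert (0 <= (b - a) * Rabs M) by (apply Rmult_le_pos; lra); lra).
  exists (Rmin d (eps / N)). split; [apply Rmin_pos; [exact Hd | apply Rdiv_lt_0_compat; lra]|].
  intros x y -> Hx _. pose proof (Rmin_l d (eps / N)). pose proof (Rmin_r d (eps / N)).
  assert (Hw0 : Cmod (w - w) < d) by (rewrite Cmod_self_sub; exact Hd).
  assert (Hx0 : Cmod (x - w) < d) by lra.
  assert (E : CI (fun t => k x t - k w t - (x - w) * k1 t) a b = CI (k x) a b - CI (k w) a b - (x - w) * CI k1 a b).
  { rewrite <- CI_scal by (apply cont_on_all, Hk1). rewrite <- CI_minus by (apply cont_on_all; intros t; apply Hk; assumption).
    rewrite <- CI_minus.
    - reflexivity.
    - apply cont_on_all. intros t. apply curve_cont_minus; apply Hk; assumption.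
    - apply cont_on_all. intros t. apply curve_cont_mult; [apply curve_cont_const | apply Hk1]. }
  replace (CI (k x) a b - CI (k w) a b - CI k1 a b * (x - w) - 0 * Cconj (x - w))
    with (CI (fun t => k x t - k w t - (x - w) * k1 t) a b) by (rewrite E; ring).
  set (m := Cmod (x - w)) in *. assert (Pm : 0 <= m) by apply Cmod_ge_0.
  eapply Rle_trans; [apply CI_bound with (M := (M * (m * m))%R); [exact Hab | | intros t Ht; apply HM; assumption]|].
  - intros t _. apply curve_cont_minus; [apply curve_cont_minus; apply Hk; assumption|].
    apply curve_cont_mult; [apply curve_cont_const | apply Hk1].
  - assert (B : m * N <= eps).
    { apply Rle_trans with (eps / N * N)%R; [apply Rmult_le_compat_r; lra | right; field; lra]. }
    apply Rle_trans with (m * N * m)%R; [|nra].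
    unfold N. assert (0 <= (b - a) * (Rabs M - M) * (m * m)).
    { apply Rmult_le_pos; [apply Rmult_le_pos; lra | nra]. }
    nra.
Qed.

Section CauchyType.

Variables (u : R -> C) (r : R) (w : C).
Hypothesis u_cont : forall t, curve_cont u t.
Hypothesis u_bound : exists M, forall t, 0 <= t <= 2 * PI -> Cmod (u t) <= M.
Hypothesis Hw : Cmod w < r.

Let d := ((r - Cmod w) / 2)%R.

Lemma cauchy_gap (x : C) (t : R) : Cmod (x - w) < d -> Cmod x < r /\ d <= Cmod (circ r t - x).
Proof.
  intros Hx. pose proof (Cmod_ge_sub x w) as T. pose proof (Cmod_ge_0 w).
  pose proof (Cmod_ge_sub (circ r t) x) as T2. rewrite Cmod_circ in T2 by lra. unfold d in *. lra.
Qed.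

Lemma inv_bound (x : C) (t : R) : Cmod (x - w) < d -> circ r t - x <> 0 /\ Cmod (/ (circ r t - x)) <= / d.
Proof.
  intros Hx. destruct (cauchy_gap x t Hx) as [H1 H2]. pose proof (circ_sub_neq r t x H1) as H3.
  split; [exact H3|]. rewrite Cmod_inv by exact H3. apply Rinv_le_contravar; [unfold d; lra | exact H2].
Qed.

(** The Taylor remainder of [1 / (s - x)] at [x = w] is [(x - w)^2 / ((s - w)^2 (s - x))], and all
    denominators stay at least [d] away from 0. *)
Lemma cauchy_type_1 :
  holo_at (fun x => CI (fun t => u t * / (circ r t - x)) 0 (2 * PI)) w
    (CI (fun t => u t * / (circ r t - w) * / (circ r t - w)) 0 (2 * PI)).
Proof.
  destruct u_bound as [M HM]. assert (Hd : 0 < d) by (unfold d; lra).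
  assert (Hw0 : Cmod (w - w) < d) by (rewrite Cmod_self_sub; exact Hd).
  apply (CI_param (fun x t => u t * / (circ r t - x)) (fun t => u t * / (circ r t - w) * / (circ r t - w)) w 0 (2 * PI) d
    (M * (/ d * / d * / d))); [left; apply two_PI_pos | exact Hd | | |].
  - intros x t Hx. apply curve_cont_mult; [apply u_cont | apply curve_cont_inv_circ, (cauchy_gap x t Hx)].
  - intros t. repeat apply curve_cont_mult; try apply u_cont; apply curve_cont_inv_circ, Hw.
  - intros x t Hx Ht. destruct (inv_bound x t Hx) as [X1 X2]. destruct (inv_bound w t Hw0) as [W1 W2].
    replace (u t * / (circ r t - x) - u t * / (circ r t - w) - (x - w) * (u t * / (circ r t - w) * / (circ r t - w)))
      with (u t * (/ (circ r t - w) * / (circ r t - w) * / (circ r t - x)) * ((x - w) * (x - w))) by (field; split; assumption).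
    rewrite !Cmod_mult. pose proof (Cmod_ge_0 (x - w)). pose proof (Cmod_ge_0 (u t)).
    apply Rmult_le_compat_r; [nra|].
    repeat (apply Rmult_le_compat; repeat apply Rmult_le_pos; try apply Cmod_ge_0; try assumption). apply HM, Ht.
Qed.

(** The remainder of [1 / (s - x)^2] divided by [(x - w)^2] is one term plus twice another, each
    bounded by [d^(-4)]; hence the constant 3. *)
Lemma cauchy_type_2 :
  holo_at (fun x => CI (fun t => u t * / (circ r t - x) * / (circ r t - x)) 0 (2 * PI)) w
    (CI (fun t => 2 * (u t * / (circ r t - w) * / (circ r t - w) * / (circ r t - w))) 0 (2 * PI)).
Proof.
  destruct u_bound as [M HM]. assert (Hd : 0 < d) by (unfold d; lra).
  assert (Hw0 : Cmod (w - w) < d) by (rewrite Cmod_self_sub; exact Hd).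
  set (q := (/ d * / d * / d * / d)%R).
  apply (CI_param (fun x t => u t * / (circ r t - x) * / (circ r t - x))
    (fun t => 2 * (u t * / (circ r t - w) * / (circ r t - w) * / (circ r t - w))) w 0 (2 * PI) d
    (3 * (M * q))); [left; apply two_PI_pos | exact Hd | | |].
  - intros x t Hx. repeat apply curve_cont_mult; try apply u_cont; apply curve_cont_inv_circ, (cauchy_gap x t Hx).
  - intros t. repeat apply curve_cont_mult; try apply u_cont; try apply curve_cont_const; apply curve_cont_inv_circ, Hw.
  - intros x t Hx Ht. destruct (inv_bound x t Hx) as [X1 X2]. destruct (inv_bound w t Hw0) as [W1 W2].
    replace (u t * / (circ r t - x) * / (circ r t - x) - u t * / (circ r t - w) * / (circ r t - w)
        - (x - w) * (2 * (u t * / (circ r t - w) * / (circ r t - w) * / (circ r t - w))))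
      with ((u t * (/ (circ r t - w) * / (circ r t - w) * / (circ r t - x) * / (circ r t - x))
         + 2 * (u t * (/ (circ r t - w) * / (circ r t - w) * / (circ r t - w) * / (circ r t - x)))) * ((x - w) * (x - w)))
      by (field; split; assumption).
    rewrite (Cmod_mult _ ((x - w) * (x - w))), (Cmod_mult (x - w)).
    apply Rmult_le_compat_r; [pose proof (Cmod_ge_0 (x - w)); nra|].
    eapply Rle_trans; [apply Cmod_triangle|]. rewrite (Cmod_mult 2), Cmod_R, (Rabs_right 2) by lra.
    assert (B1 : Cmod (u t * (/ (circ r t - w) * / (circ r t - w) * / (circ r t - x) * / (circ r t - x))) <= M * q).
    { rewrite !Cmod_mult. unfold q.
      repeat (apply Rmult_le_compat; repeat apply Rmult_le_pos; try apply Cmod_ge_0; try assumption). apply HM, Ht. }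
    assert (B2 : Cmod (u t * (/ (circ r t - w) * / (circ r t - w) * / (circ r t - w) * / (circ r t - x))) <= M * q).
    { rewrite !Cmod_mult. unfold q.
      repeat (apply Rmult_le_compat; repeat apply Rmult_le_pos; try apply Cmod_ge_0; try assumption). apply HM, Ht. }
    lra.
Qed.

End CauchyType.

Lemma curve_bounded (u : R -> C) (a b : R) : a <= b -> (forall t, curve_cont u t) ->
  exists M, forall t, a <= t <= b -> Cmod (u t) <= M.
Proof.
  intros Hab Hc.
  destruct (continuity_ab_maj (fun t => Cmod (u t)) a b Hab) as [m [Hm _]].
  - intros t _. apply continuity_pt_filterlim, filterlim_locally. intros eps.
    destruct (Hc t eps (cond_pos eps)) as [d [Hd H]]. exists (mkposreal d Hd). intros s Hs.
    specialize (H s Hs). change (Rabs (Cmod (u s) - Cmod (u t)) < eps).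
    pose proof (Cmod_ge_sub (u s) (u t)). pose proof (Cmod_ge_sub (u t) (u s)) as H1.
    rewrite Cmod_sub_sym in H1. apply Rabs_def1; lra.
  - exists (Cmod (u m)). intros t Ht. apply Hm, Ht.
Qed.

Lemma holo_disk_intro (f : C -> C) : (forall z, disk z -> exists l, holo_at f z l) -> holo_disk f (C_derive f).
Proof.
  intros H z Hz. destruct (H z Hz) as [l Hl].
  pose proof (proj1 (holo_at_iff _ _ _) Hl) as Hl'. apply is_C_derive_unique in Hl'. rewrite Hl'. exact Hl.
Qed.

Lemma RtoC_2PI_neq_0 : RtoC (2 * PI) <> 0.
Proof. intros E. apply (f_equal fst) in E. simpl in E. pose proof PI_RGT_0. lra. Qed.

Lemma disk_radius (z : C) : disk z -> exists r, Cmod z < r /\ r < 1 /\ 0 < r.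
Proof. intros Hz. exists ((1 + Cmod z) / 2)%R. unfold disk in Hz. pose proof (Cmod_ge_0 z). lra. Qed.

(** Differentiating the Cauchy integral once identifies [f'] with an integral of the same type, and
    that integral can be differentiated again. *)
Lemma holo_disk_deriv (f f' : C -> C) : holo_disk f f' -> holo_disk f' (C_derive f').
Proof.
  intros Hf. apply holo_disk_intro. intros z Hz. destruct (disk_radius z Hz) as [r [H1 [H2 H3]]].
  set (u := fun t => f (circ r t) * circ r t).
  assert (Hu : forall t, curve_cont u t).
  { intros t. apply curve_cont_mult; [apply (holo_disk_curve f f'); [exact Hf | lra] | apply circ_cont]. }
  assert (Hb : exists M, forall t, 0 <= t <= 2 * PI -> Cmod (u t) <= M).
  { apply curve_bounded; [left; apply two_PI_pos | exact Hu]. }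
  assert (Hf' : forall x, Cmod x < r -> f' x = / RtoC (2 * PI) * CI (fun t => u t * / (circ r t - x) * / (circ r t - x)) 0 (2 * PI)).
  { intros x Hx. apply (holo_at_unique f x); [apply Hf; unfold disk; lra|].
    apply (holo_at_local (fun x => / RtoC (2 * PI) * CI (fun t => u t * / (circ r t - x)) 0 (2 * PI)) _ x _ (r - Cmod x)); [lra| |].
    - intros y Hy. pose proof (Cmod_ge_sub y x). unfold u. rewrite (cauchy_formula f f' r y Hf ltac:(lra) H2).
      field. apply RtoC_2PI_neq_0.
    - apply holo_at_scal. apply cauchy_type_1; assumption. }
  eexists.
  apply (holo_at_local (fun x => / RtoC (2 * PI) * CI (fun t => u t * / (circ r t - x) * / (circ r t - x)) 0 (2 * PI)) _ z _ (r - Cmod z)); [lra| |].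
  - intros x Hx. pose proof (Cmod_ge_sub x z). symmetry. apply Hf'. lra.
  - apply holo_at_scal. apply cauchy_type_2; assumption.
Qed.

Lemma disk_0 : disk 0.
Proof. unfold disk. rewrite Cmod_0. lra. Qed.

(** Removing the singularity of [f(z)/z] at 0. The Cauchy formulas at [x] and at 0, subtracted, give
    [f x = x T x] with a Cauchy type integral [T], which is holomorphic at 0 as well; [T 0 = f' 0]
    by uniqueness of the derivative. *)
Lemma holo_disk_div_id (f f' : C -> C) : holo_disk f f' -> f 0 = 0 ->
  exists q q', holo_disk q q' /\ q 0 = f' 0 /\ forall z, disk z -> f z = z * q z.
Proof.
  intros Hf Hf0. set (q := fun z => if Ceq_dec z 0 then f' 0 else f z / z).
  exists q, (C_derive q).
  split; [|split].
  - apply holo_disk_intro. intros z Hz. destruct (disk_radius z Hz) as [r [H1 [H2 H3]]].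
    set (u := fun t => f (circ r t)).
    assert (Hu : forall t, curve_cont u t) by (intros t; apply (holo_disk_curve f f'); [exact Hf | lra]).
    assert (Hb : exists M, forall t, 0 <= t <= 2 * PI -> Cmod (u t) <= M).
    { apply curve_bounded; [left; apply two_PI_pos | exact Hu]. }
    set (T := fun x => / RtoC (2 * PI) * CI (fun t => u t * / (circ r t - x)) 0 (2 * PI)).
    assert (HT : forall x, Cmod x < r -> exists l, holo_at T x l).
    { intros x Hx. eexists. apply holo_at_scal. apply cauchy_type_1; assumption. }
    assert (Hc : forall x, Cmod x < r -> f x = x * T x).
    { intros x Hx. unfold T.
      pose proof (cauchy_formula f f' r x Hf Hx H2) as A.
      pose proof (cauchy_formula f f' r 0 Hf ltac:(rewrite Cmod_0; exact H3) H2) as A0.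
      rewrite Hf0 in A0.
      assert (Hk : forall y, Cmod y < r -> cont_on (fun t => f (circ r t) * circ r t * / (circ r t - y)) 0 (2 * PI)).
      { intros y Hy. apply cont_on_all. intros t. apply curve_cont_mult; [|apply curve_cont_inv_circ, Hy].
        apply curve_cont_mult; [apply Hu | apply circ_cont]. }
      assert (B : CI (fun t => x * (u t * / (circ r t - x))) 0 (2 * PI) = RtoC (2 * PI) * f x).
      { rewrite (CI_ext _ (fun t => f (circ r t) * circ r t * / (circ r t - x) - f (circ r t) * circ r t * / (circ r t - 0))).
        - rewrite CI_minus, A, A0; [ring | apply Hk, Hx | apply Hk; rewrite Cmod_0; exact H3].
        - intros t _. pose proof (circ_sub_neq r t x Hx).
          pose proof (circ_sub_neq r t 0 ltac:(rewrite Cmod_0; exact H3)) as H0'. unfold u.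
          replace (circ r t - 0) with (circ r t) in * by ring. field. split; assumption. }
      rewrite CI_scal in B.
      - transitivity (/ RtoC (2 * PI) * (RtoC (2 * PI) * f x)); [field; apply RtoC_2PI_neq_0 | rewrite <- B; ring].
      - apply cont_on_all. intros t. apply curve_cont_mult; [apply Hu | apply curve_cont_inv_circ, Hx]. }
    assert (HT0 : T 0 = f' 0).
    { assert (R0 : Cmod 0 < r) by (rewrite Cmod_0; exact H3).
      destruct (HT 0 R0) as [l Hl]. symmetry. apply (holo_at_unique f 0); [apply Hf, disk_0|].
      apply (holo_at_local (fun x => x * T x) _ 0 _ r); [exact H3| |].
      - intros x Hx. symmetry. apply Hc. replace (x - 0) with x in Hx by ring. exact Hx.
      - apply (holo_at_eq _ _ (1 * T 0 + 0 * l)); [|ring]. apply (holo_at_mult (fun x => x) T); [apply holo_at_id | exact Hl]. }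
    destruct (HT z H1) as [l Hl]. exists l.
    apply (holo_at_local T _ z _ (r - Cmod z)); [lra | | exact Hl].
    intros x Hx. pose proof (Cmod_ge_sub x z). unfold q. destruct (Ceq_dec x 0) as [->|n]; [exact HT0|].
    rewrite (Hc x) by lra. field. exact n.
  - unfold q. destruct (Ceq_dec 0 0) as [_|n]; [reflexivity | exfalso; apply n; reflexivity].
  - intros z Hz. unfold q. destruct (Ceq_dec z 0) as [->|n]; [rewrite Hf0; ring | field; exact n].
Qed.

(** * The maximum principle and the Schwarz lemma *)

Lemma holo_at_pow (f : C -> C) (z a : C) (n : nat) : holo_at f z a -> exists b, holo_at (fun x => f x ^ n) z b.
Proof.
  intros Hf. induction n as [|n [b Hb]].
  - exists 0. exact (holo_at_const 1 z).
  - eexists. apply (holo_at_mult f (fun x => f x ^ n)); eassumption.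
Qed.

(* The Cauchy formula for [v ^ n] bounds [|v w| ^ n] by a constant times [m ^ n]; let [n] grow. *)
Lemma max_modulus (v v' : C -> C) (r m : R) (w : C) : holo_disk v v' -> Cmod w < r -> r < 1 -> 0 < m ->
  (forall z, Cmod z = r -> Cmod (v z) <= m) -> Cmod (v w) <= m.
Proof.
  intros Hv Hw Hr Hm Hb. pose proof (Cmod_ge_0 w) as Hw0.
  (* The quotient bounds the kernel [s / (s - w)] on the circle; the 2 is the one lost in
     [CI_bound]. *)
  set (D := (2 * (r / (r - Cmod w)))%R).
  assert (HD : 0 <= D).
  { unfold D. assert (0 < r / (r - Cmod w)) by (apply Rdiv_lt_0_compat; lra). lra. }
  assert (Hn : forall n, Cmod (v w) ^ n <= D * m ^ n).
  { intros n.
    assert (Hh : holo_disk (fun x => v x ^ n) (C_derive (fun x => v x ^ n))).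
    { apply holo_disk_intro. intros z Hz. apply (holo_at_pow v z (v' z)), Hv, Hz. }
    pose proof (cauchy_formula _ _ r w Hh Hw Hr) as E.
    assert (B : Cmod (CI (fun t => v (circ r t) ^ n * circ r t * / (circ r t - w)) 0 (2 * PI))
       <= 2 * (2 * PI - 0) * (m ^ n * r * / (r - Cmod w))).
    { apply CI_bound; [left; apply two_PI_pos | |].
      - intros t _. apply curve_cont_mult; [|apply curve_cont_inv_circ, Hw].
        apply curve_cont_mult; [apply (holo_disk_curve _ _ r t Hh); lra | apply circ_cont].
      - intros t _. rewrite !Cmod_mult, Cmod_pow, Cmod_circ by lra.
        pose proof (circ_sub_neq r t w Hw) as N. rewrite Cmod_inv by exact N.
        pose proof (Cmod_ge_0 (v (circ r t))).
        apply Rmult_le_compat; [apply Rmult_le_pos; [apply pow_le; lra | lra] | | |].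
        + left. apply Rinv_0_lt_compat, Cmod_gt_0, N.
        + apply Rmult_le_compat_r; [lra|]. apply pow_incr. split; [lra|]. apply Hb, Cmod_circ. lra.
        + apply Rinv_le_contravar; [lra|]. pose proof (Cmod_ge_sub (circ r t) w) as T. rewrite Cmod_circ in T; lra. }
    rewrite E, Cmod_mult, Cmod_pow, Cmod_R, Rabs_right in B by (left; apply two_PI_pos).
    apply Rmult_le_reg_l with (2 * PI)%R; [apply two_PI_pos|].
    eapply Rle_trans; [exact B|]. right. unfold D. field. lra. }
  apply Rnot_lt_le. intros Hlt.
  set (q := (Cmod (v w) / m)%R).
  assert (Hq : 1 < q).
  { unfold q. apply Rmult_lt_reg_r with m; [exact Hm|]. unfold Rdiv. rewrite Rmult_assoc, Rinv_l; lra. }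
  destruct (Pow_x_infinity q ltac:(rewrite Rabs_right; lra) (D + 1)%R) as [N HN].
  specialize (HN N (Nat.le_refl N)). specialize (Hn N).
  rewrite Rabs_right in HN by (apply Rle_ge, pow_le; lra).
  replace (Cmod (v w)) with (q * m)%R in Hn by (unfold q; field; lra).
  rewrite Rpow_mult_distr in Hn. pose proof (pow_lt m N Hm). nra.
Qed.

Lemma schwarz (v v' : C -> C) (w : C) : holo_disk v v' -> v 0 = 0 ->
  (forall z, disk z -> Cmod (v z) <= 1) -> disk w -> Cmod (v w) <= Cmod w.
Proof.
  intros Hv Hv0 Hb Hw. destruct (holo_disk_div_id v v' Hv Hv0) as [q [q' [Hq [_ E]]]].
  assert (Hq1 : Cmod (q w) <= 1).
  { apply Rle_plus_epsilon. intros eps He.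
    (* On the circle of radius [r] the quotient [q] is at most [1/r]. The radius must exceed [|w|],
       stay below 1 and satisfy [1/r <= 1 + eps]. *)
    set (r := Rmax ((1 + Cmod w) / 2) (/ (1 + eps))).
    pose proof (Cmod_ge_0 w). unfold disk in Hw.
    assert (R1 : Cmod w < r) by (eapply Rlt_le_trans; [|apply Rmax_l]; lra).
    assert (R2 : r < 1).
    { apply Rmax_lub_lt; [lra|]. rewrite <- Rinv_1. apply Rinv_lt_contravar; lra. }
    assert (R3 : / r <= 1 + eps).
    { rewrite <- (Rinv_inv (1 + eps)). apply Rinv_le_contravar; [apply Rinv_0_lt_compat; lra | apply Rmax_r]. }
    eapply Rle_trans; [|exact R3].
    apply (max_modulus q q' r); try assumption; [apply Rinv_0_lt_compat; lra|].
    intros z Hz. assert (Dz : disk z) by (unfold disk; lra). specialize (Hb z Dz).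
    rewrite (E z Dz), Cmod_mult, Hz in Hb.
    apply Rmult_le_reg_l with r; [lra|]. rewrite Rinv_r by lra. exact Hb. }
  rewrite (E w Hw), Cmod_mult. pose proof (Cmod_ge_0 w). nra.
Qed.

(** * The Briot-Bouquet differential subordination *)

Definition seq_lim (u : nat -> C) (l : C) : Prop :=
  forall eps, 0 < eps -> exists N, forall n, (N <= n)%nat -> Cmod (u n - l) < eps.

(** Of a subsequence only [n <= phi n] is recorded, which suffices for passing to limits; the
    explicit rate lets two extractions be combined. *)
Lemma real_bolzano (u : nat -> R) (b : R) : (forall n, Rabs (u n) <= b) ->
  exists (phi : nat -> nat) (l : R), forall n, (n <= phi n)%nat /\ Rabs (u (phi n) - l) < / INR (S n).
Proof.
  intros Hb.
  destruct (Bolzano_Weierstrass u (fun c => - b <= c <= b) (compact_P3 (- b) b)) as [l Hl].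
  { intros n. apply Rabs_le_between, Hb. }
  assert (H : forall n, exists p, (n <= p)%nat /\ Rabs (u p - l) < / INR (S n)).
  { intros n. assert (P : 0 < / INR (S n)) by (apply Rinv_0_lt_compat, lt_0_INR; lia).
    destruct (Hl (disc l (mkposreal _ P)) n) as [p [Hp1 Hp2]].
    - exists (mkposreal _ P). intros x Hx. exact Hx.
    - exists p. split; [exact Hp1 | exact Hp2]. }
  exists (fun n => proj1_sig (constructive_indefinite_description _ (H n))), l.
  intros n. exact (proj2_sig (constructive_indefinite_description _ (H n))).
Qed.

Lemma inv_INR_small (eps : R) : 0 < eps -> exists N, forall n, (N <= n)%nat -> / INR (S n) < eps.
Proof.
  intros He. destruct (archimed_cor1 eps He) as [N [H1 H2]]. exists N. intros n Hn.
  eapply Rle_lt_trans; [|exact H1]. apply Rinv_le_contravar; [apply lt_0_INR, H2 | apply le_INR; lia].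
Qed.

Lemma C_bolzano (u : nat -> C) (b : R) : (forall n, Cmod (u n) <= b) ->
  exists (phi : nat -> nat) (l : C), (forall n, (n <= phi n)%nat) /\ seq_lim (fun n => u (phi n)) l.
Proof.
  intros Hb.
  destruct (real_bolzano (fun n => fst (u n)) b) as [p1 [l1 H1]].
  { intros n. eapply Rle_trans; [apply Cmod_fst | apply Hb]. }
  destruct (real_bolzano (fun n => snd (u (p1 n))) b) as [p2 [l2 H2]].
  { intros n. eapply Rle_trans; [apply Cmod_snd | apply Hb]. }
  exists (fun n => p1 (p2 n)), (l1, l2). split.
  - intros n. destruct (H1 (p2 n)). destruct (H2 n). lia.
  - intros eps He. destruct (inv_INR_small (eps / 2)%R ltac:(lra)) as [N HN]. exists N. intros n Hn.
    eapply Rle_lt_trans; [apply Cmod_le_add|].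
    change (Rabs (fst (u (p1 (p2 n))) - l1) + Rabs (snd (u (p1 (p2 n))) - l2) < eps).
    destruct (H2 n) as [A1 A2]. destruct (H1 (p2 n)) as [_ A3].
    pose proof (HN n Hn). pose proof (HN (p2 n) ltac:(lia)). lra.
Qed.

Definition rcont_at (g : C -> R) (z : C) : Prop :=
  forall eps, 0 < eps -> exists d, 0 < d /\ forall x, Cmod (x - z) < d -> Rabs (g x - g z) < eps.

Lemma rcont_Cmod (f : C -> C) (z : C) : cont_at f z -> rcont_at (fun x => Cmod (f x)) z.
Proof.
  intros H eps He. destruct (H eps He) as [d [Hd H1]]. exists d. split; [exact Hd|].
  intros x Hx. specialize (H1 x Hx). pose proof (Cmod_ge_sub (f x) (f z)).
  pose proof (Cmod_ge_sub (f z) (f x)) as H2. rewrite Cmod_sub_sym in H2. apply Rabs_def1; lra.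
Qed.

(** Sequential form of the extreme value theorem for closed bounded sets. Applied to negated
    functions it also supplies minimisers. *)
Lemma compact_max (g : C -> R) (S : C -> Prop) (b : R) (x0 : C) : S x0 -> (forall x, S x -> Cmod x <= b) ->
  (forall p, (forall eps, 0 < eps -> exists x, S x /\ Cmod (x - p) < eps) -> S p) ->
  (forall z, S z -> rcont_at g z) -> exists z, S z /\ forall x, S x -> g x <= g z.
Proof.
  intros Hx0 Hb Hcl Hg.
  assert (Hlim : forall u : nat -> C, (forall n, S (u n)) -> exists phi l, (forall n, (n <= phi n)%nat) /\
     seq_lim (fun n => u (phi n)) l /\ S l).
  { intros u Hu. destruct (C_bolzano u b (fun n => Hb _ (Hu n))) as [phi [l [H1 H2]]].
    exists phi, l. split; [exact H1|]. split; [exact H2|]. apply Hcl. intros eps He.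
    destruct (H2 eps He) as [N HN]. exists (u (phi N)). split; [apply Hu | apply HN; lia]. }
  assert (Hbd : exists B, forall x, S x -> g x <= B).
  { apply NNPP. intros Hn.
    assert (H : forall n : nat, exists x, S x /\ INR n < g x).
    { intros n. apply NNPP. intros H. apply Hn. exists (INR n). intros x Hx. apply Rnot_lt_le. intros Hlt.
      apply H. exists x. split; assumption. }
    set (u := fun n => proj1_sig (constructive_indefinite_description _ (H n))).
    assert (Hu : forall n, S (u n) /\ INR n < g (u n)).
    { intros n. exact (proj2_sig (constructive_indefinite_description _ (H n))). }
    destruct (Hlim u (fun n => proj1 (Hu n))) as [phi [l [H1 [H2 H3]]]].
    destruct (Hg l H3 1 ltac:(lra)) as [d [Hd Hdd]]. destruct (H2 d Hd) as [N HN].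
    destruct (INR_unbounded (g l + 1)) as [m Hm].
    specialize (HN (Nat.max N m) ltac:(lia)). specialize (Hdd _ HN).
    destruct (Hu (phi (Nat.max N m))) as [_ A]. specialize (H1 (Nat.max N m)).
    assert (B : INR m <= INR (phi (Nat.max N m))) by (apply le_INR; lia).
    apply Rabs_lt_between in Hdd. lra. }
  destruct Hbd as [B HB].
  destruct (completeness (fun y => exists x, S x /\ y = g x)) as [m [Hm1 Hm2]].
  { exists B. intros y [x [Hx ->]]. apply HB, Hx. }
  { exists (g x0), x0. split; [exact Hx0 | reflexivity]. }
  assert (H : forall n : nat, exists x, S x /\ m - / INR (Datatypes.S n) < g x).
  { intros n. apply NNPP. intros H.
    assert (P : 0 < / INR (Datatypes.S n)) by (apply Rinv_0_lt_compat, lt_0_INR; lia).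
    assert (A : m <= m - / INR (Datatypes.S n)); [|lra].
    apply Hm2. intros y [x [Hx ->]]. apply Rnot_lt_le. intros Hlt. apply H. exists x. split; assumption. }
  set (u := fun n => proj1_sig (constructive_indefinite_description _ (H n))).
  assert (Hu : forall n, S (u n) /\ m - / INR (Datatypes.S n) < g (u n)).
  { intros n. exact (proj2_sig (constructive_indefinite_description _ (H n))). }
  destruct (Hlim u (fun n => proj1 (Hu n))) as [phi [l [H1 [H2 H3]]]].
  exists l. split; [exact H3|]. intros x Hx.
  apply Rle_trans with m; [apply Hm1; exists x; split; [exact Hx | reflexivity]|].
  apply Rle_plus_epsilon. intros eps He.
  destruct (Hg l H3 (eps / 2)%R ltac:(lra)) as [d [Hd Hdd]]. destruct (H2 d Hd) as [N HN].
  destruct (inv_INR_small (eps / 2)%R ltac:(lra)) as [N' HN'].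
  specialize (HN (Nat.max N N') ltac:(lia)). specialize (Hdd _ HN).
  destruct (Hu (phi (Nat.max N N'))) as [_ A]. specialize (H1 (Nat.max N N')).
  specialize (HN' (phi (Nat.max N N')) ltac:(lia)). apply Rabs_lt_between in Hdd. lra.
Qed.

Lemma deriv_nonpos (g : R -> R) (d : R) : is_derive g 0 d -> (forall t, 0 <= t -> g t <= g 0) -> d <= 0.
Proof.
  intros H Hle. apply is_derive_Reals in H. apply Rnot_lt_le. intros Hd.
  destruct (H (d / 2)%R ltac:(lra)) as [e He]. pose proof (cond_pos e) as Pe.
  specialize (He (e / 2)%R ltac:(lra) ltac:(rewrite Rabs_right; lra)).
  rewrite Rplus_0_l in He. specialize (Hle (e / 2)%R ltac:(lra)).
  apply Rabs_lt_between in He.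
  assert (Hi : 0 < / (e / 2)) by (apply Rinv_0_lt_compat; lra).
  unfold Rdiv at 2 in He. nra.
Qed.

Lemma closed_disk_closed (r : R) (p : C) :
  (forall eps, 0 < eps -> exists x, Cmod x <= r /\ Cmod (x - p) < eps) -> Cmod p <= r.
Proof.
  intros H. apply Rle_plus_epsilon. intros eps He. destruct (H eps He) as [x [H1 H2]].
  pose proof (Cmod_ge_sub p x) as T. rewrite Cmod_sub_sym in T. lra.
Qed.

Section BriotBouquet.

Variables (Q Q' : C -> C) (a M : R).
Hypothesis Q_holo : holo_disk Q Q'.
Hypothesis Q_neq_0 : forall z, disk z -> Q z <> 0.
Hypothesis M_lt_a : 0 <= M < a.
Hypothesis P_bound : forall z, disk z -> Cmod (Q z + z * Q' z / Q z - RtoC a) <= M.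

(* Where |Q - a| is maximal over |z| <= |z0|, z Q' is a nonnegative multiple of Q - a. *)
Lemma jack_point (z0 : C) : disk z0 -> Cmod (Q z0 - RtoC a) < a ->
  (forall z, Cmod z <= Cmod z0 -> Cmod (Q z - RtoC a) <= Cmod (Q z0 - RtoC a)) ->
  Cmod (Q z0 - RtoC a) <= M.
Proof.
  intros Hz0 Ha Hmax. set (D := Q z0 - RtoC a) in *.
  destruct (Ceq_dec D 0) as [E|HD]; [rewrite E, Cmod_0; lra|].
  pose proof (proj1 (Cmod_gt_0 D) HD) as HD'.
  (* For [Re s <= 0] the path [z0 exp (t s)] stays in [|z| <= |z0|], so [Re (conj D (Q - a))], which
     is at most [|D|^2], is largest at [t = 0]. *)
  assert (Hdir : forall s, fst s <= 0 -> fst (Cconj D * (Q' z0 * (z0 * s)))%C <= 0).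
  { intros s Hs.
    apply (deriv_nonpos (fun t => fst (Cconj D * (Q (z0 * cexp (RtoC t * s)) - RtoC a))%C)).
    - apply (curve_deriv_fst (fun t => Cconj D * (Q (z0 * cexp (RtoC t * s)) - RtoC a))
        0 (Cconj D * (Q' z0 * (z0 * s)))).
      apply curve_deriv_scal.
      apply (curve_deriv_eq _ _ (Q' z0 * (z0 * (cexp 0 * s)) + 0)); [|rewrite cexp_0; ring].
      apply (curve_deriv_plus (fun t => Q (z0 * cexp (RtoC t * s))) (fun _ => - RtoC a)); [|apply curve_deriv_const].
      assert (E0 : z0 * cexp (RtoC 0 * s) = z0) by (rewrite Cmult_0_l, cexp_0; ring).
      apply (curve_deriv_holo Q (fun t => z0 * cexp (RtoC t * s))).
      + rewrite E0. apply Q_holo, Hz0.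
      + apply curve_deriv_scal. apply (curve_deriv_holo cexp (fun t => RtoC t * s)).
        * rewrite Cmult_0_l. apply holo_at_cexp.
        * apply (curve_deriv_eq _ _ (1 * s + RtoC 0 * 0)); [|ring].
          apply (curve_deriv_mult RtoC (fun _ => s)); [apply curve_deriv_id | apply curve_deriv_const].
    - intros t Ht.
      assert (E0 : z0 * cexp (RtoC 0 * s) = z0) by (rewrite Cmult_0_l, cexp_0; ring).
      rewrite E0. fold D. rewrite Cmod_sqr_re.
      set (w := Q (z0 * cexp (RtoC t * s)) - RtoC a).
      assert (Hw : Cmod w <= Cmod D).
      { apply Hmax. rewrite Cmod_mult, Cmod_cexp.
        assert (exp (fst (RtoC t * s)) <= 1).
        { rewrite <- exp_0. replace (fst (RtoC t * s)) with (t * fst s)%R by (unfold Cmult, RtoC; simpl; ring).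
          destruct (Rle_lt_or_eq_dec (t * fst s) 0 ltac:(nra)) as [Hl|Hl]; [|rewrite Hl; lra].
          left. apply exp_increasing, Hl. }
        pose proof (Cmod_ge_0 z0). nra. }
      pose proof (Cmod_fst (Cconj D * w)) as F. rewrite Cmod_mult, Cmod_conj in F.
      apply Rabs_le_between in F. nra. }
  set (X := Cconj D * (Q' z0 * z0)).
  assert (HX : forall s, fst s <= 0 -> fst (X * s)%C <= 0).
  { intros s Hs. replace (X * s) with (Cconj D * (Q' z0 * (z0 * s))) by (unfold X; ring). apply Hdir, Hs. }
  assert (DX : X = Cconj D * (Q' z0 * z0)) by reflexivity. clearbody X.
  (* The directions [i] and [-i] force [X] to be real, and the direction [-1] forces it to be
     nonnegative. *)
  pose proof (HX (0, 1)%R ltac:(simpl; lra)) as X1. pose proof (HX (0, -1)%R ltac:(simpl; lra)) as X2.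
  pose proof (HX (-1, 0)%R ltac:(simpl; lra)) as X3. unfold Cmult in X1, X2, X3; simpl in X1, X2, X3.

  assert (EX : X = RtoC (fst X)).
  { clear DX. destruct X as [p q]. simpl in *. unfold RtoC. f_equal. lra. }
  set (m := (fst X / (Cmod D * Cmod D))%R).
  assert (X0 : 0 <= fst X) by lra.
  assert (Hm : 0 <= m) by (unfold m; apply Rmult_le_pos; [exact X0 | left; apply Rinv_0_lt_compat; nra]).
  assert (Ez : z0 * Q' z0 = RtoC m * D).
  { assert (Ec : Cconj D * D = RtoC (Cmod D * Cmod D)).
    { rewrite Cmult_comm, <- Cmod2_conj. f_equal. ring. }
    assert (Hcn : Cconj D <> 0).
    { intros E. apply HD. rewrite <- (Cconj_conj D), E. apply Cconj_RtoC. }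
    assert (Hdd : RtoC (Cmod D * Cmod D) <> 0).
    { intros E. apply (f_equal fst) in E. simpl in E. nra. }
    replace (z0 * Q' z0) with (/ Cconj D * X) by (rewrite DX; field; exact Hcn).
    rewrite EX. replace (fst X) with (m * (Cmod D * Cmod D))%R by (unfold m; field; lra).
    rewrite RtoC_mult, <- Ec. field. exact Hcn. }
  pose proof (P_bound z0 Hz0) as HP. pose proof (Q_neq_0 z0 Hz0) as HQ.
  (* At [z0] one has [P - a = D (Q + m) / Q]. Since [Re Q > 0] and [m >= 0], the factor after [D]
     has modulus at least 1, whence [|D| <= |P - a| <= M]. *)
  replace (Q z0 + z0 * Q' z0 / Q z0 - RtoC a) with (D * ((Q z0 + RtoC m) / Q z0)) in HP.
  2:{ rewrite Ez. unfold D. field. exact HQ. }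
  rewrite Cmod_mult, Cmod_div in HP by exact HQ.
  assert (HRe : 0 < fst (Q z0)).
  { pose proof (Cmod_fst D) as F. unfold D in F at 1. change (Rabs (fst (Q z0) - a) <= Cmod D) in F.
    apply Rabs_le_between in F. lra. }
  assert (Hge : Cmod (Q z0) <= Cmod (Q z0 + RtoC m)).
  { unfold Cmod. apply sqrt_le_1_alt. unfold Cplus, RtoC; simpl. nra. }
  pose proof (proj1 (Cmod_gt_0 _) HQ) as HQ'.
  assert (1 <= Cmod (Q z0 + RtoC m) / Cmod (Q z0)).
  { apply Rmult_le_reg_r with (Cmod (Q z0)); [exact HQ'|]. unfold Rdiv. rewrite Rmult_assoc, Rinv_l; lra. }
  nra.
Qed.

(** If [|Q - a|] exceeded [M] somewhere, some level strictly between [M] and [a] would be attained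
    at a point of least modulus. Jack's lemma at that point brings the level down to [M], a
    contradiction. *)
Lemma briot_bouquet (z : C) : disk z -> Cmod (Q z - RtoC a) <= M.
Proof.
  intros Hz. apply Rnot_lt_le. intros Hlt.
  (* A level above [M], reached inside [|x| <= |z|], and below [a], so that [Re Q > 0] at the
     critical point. *)
  set (v := Rmin ((M + a) / 2) (Cmod (Q z - RtoC a))).
  assert (Hv1 : M < v) by (apply Rmin_glb_lt; lra).
  assert (Hv2 : v < a) by (eapply Rle_lt_trans; [apply Rmin_l|]; lra).
  assert (Hv3 : v <= Cmod (Q z - RtoC a)) by apply Rmin_r.
  assert (Hc : forall x, disk x -> rcont_at (fun y => Cmod (Q y - RtoC a)) x).
  { intros x Hx. apply (rcont_Cmod (fun y => Q y - RtoC a)).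
    apply (holo_at_cont _ _ (Q' x - 0)), holo_at_minus; [apply Q_holo, Hx | apply holo_at_const]. }
  destruct (compact_max (fun x => - Cmod x)%R (fun x => Cmod x <= Cmod z /\ v <= Cmod (Q x - RtoC a)) (Cmod z) z)
    as [z1 [[H1 H2] H3]].
  - split; [lra | exact Hv3].
  - intros x [Hx _]. exact Hx.
  - intros p Hp.
    assert (Hp1 : Cmod p <= Cmod z).
    { apply closed_disk_closed. intros eps He. destruct (Hp eps He) as [x [[X1 _] X2]]. exists x. split; assumption. }
    split; [exact Hp1|]. apply Rle_plus_epsilon. intros eps He.
    destruct (Hc p ltac:(unfold disk in *; lra) eps He) as [d [Hd Hdd]].
    destruct (Hp d Hd) as [x [[_ X1] X2]]. specialize (Hdd x X2). apply Rabs_lt_between in Hdd. lra.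
  - intros x _ eps He. exists eps. split; [exact He|]. intros y Hy.
    pose proof (Cmod_ge_sub y x). pose proof (Cmod_ge_sub x y) as T. rewrite Cmod_sub_sym in T. apply Rabs_def1; lra.
  - assert (Dz1 : disk z1) by (unfold disk in *; lra).
    assert (Hin : forall x, Cmod x < Cmod z1 -> Cmod (Q x - RtoC a) < v).
    { intros x Hx. apply Rnot_le_lt. intros Hle.
      assert (Hx' : Cmod x <= Cmod z) by lra. pose proof (H3 x (conj Hx' Hle)) as H4. cbv beta in H4. lra. }
    assert (Hall : forall x, Cmod x <= Cmod z1 -> Cmod (Q x - RtoC a) <= v).
    { intros x Hx. destruct (Rle_lt_or_eq_dec _ _ Hx) as [Hx'|Hx']; [left; apply Hin, Hx'|].
      destruct (Req_dec (Cmod x) 0) as [E0|E0].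
      { assert (Ex : x = z1).
        { rewrite (Cmod_eq_0 x E0). rewrite E0 in Hx'. symmetry. apply Cmod_eq_0. lra. }
        apply Rnot_lt_le. intros Hgt.
        (* z1 = 0, where P = Q *)
        pose proof (P_bound 0 disk_0) as P0. rewrite (Cmod_eq_0 x E0) in Hgt.
        replace (Q 0 + 0 * Q' 0 / Q 0 - RtoC a) with (Q 0 - RtoC a) in P0 by (field; apply Q_neq_0, disk_0). lra. }
      apply Rle_plus_epsilon. intros eps He.
      assert (Dx : disk x) by (unfold disk in *; lra).
      destruct (Hc x Dx eps He) as [d [Hd Hdd]].
      pose proof (Cmod_ge_0 x) as Px. set (m := Cmod x) in *.
      set (t := (Rmin (1 / 2) (d / (2 * m)))%R).
      assert (Ht : 0 < t) by (apply Rmin_pos; [lra | apply Rdiv_lt_0_compat; lra]).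
      assert (Ht1 : t <= 1 / 2) by apply Rmin_l.
      assert (Ht2 : t * m <= d / 2).
      { apply Rle_trans with (d / (2 * m) * m)%R; [apply Rmult_le_compat_r; [lra | apply Rmin_r] | right; field; lra]. }
      assert (Y1 : Cmod (RtoC (1 - t) * x - x) < d).
      { replace (RtoC (1 - t) * x - x) with (- (RtoC t * x)) by (rewrite RtoC_minus; ring).
        rewrite Cmod_opp, Cmod_mult, Cmod_R, Rabs_right by lra. fold m. lra. }
      assert (Y2 : Cmod (RtoC (1 - t) * x) < Cmod z1).
      { rewrite Cmod_mult, Cmod_R, Rabs_right by lra. fold m. nra. }
      specialize (Hdd _ Y1). specialize (Hin _ Y2). apply Rabs_lt_between in Hdd. lra. }
    assert (E1 : Cmod (Q z1 - RtoC a) = v) by (apply Rle_antisym; [apply Hall; lra | exact H2]).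
    pose proof (jack_point z1 Dz1 ltac:(lra)) as J. rewrite E1 in J. specialize (J Hall). lra.
Qed.

End BriotBouquet.

(** * The logarithm of f(z)/z and the functions derived from it *)

Lemma disk_const (g g' : C -> C) : holo_disk g g' -> (forall z, disk z -> g' z = 0) ->
  forall z, disk z -> g z = g 0.
Proof.
  intros Hg H0 z Hz.
  assert (E : g z - g 0 - 0 * (z - 0) = 0).
  { apply Cmod_eq_0, Rle_antisym; [|apply Cmod_ge_0].
    apply Rle_trans with (0 * Cmod (z - 0))%R; [|right; ring].
    assert (Hd : forall t, 0 <= t <= 1 -> disk (0 + RtoC t * (z - 0))).
    { intros t Ht. unfold disk. replace (0 + RtoC t * (z - 0)) with (RtoC t * z) by ring.
      rewrite Cmod_mult, Cmod_R, Rabs_right by lra. unfold disk in Hz. pose proof (Cmod_ge_0 z). nra. }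
    apply segment_mvt with g'; intros t Ht.
    - apply Hg, Hd, Ht.
    - rewrite H0 by (apply Hd, Ht). rewrite Cmod_self_sub. lra. }
  replace (g z) with (g z - g 0 - 0 * (z - 0) + g 0) by ring. rewrite E. ring.
Qed.

(** A primitive [L] of [q'/q] is normalised by [L 0 = 0]; then [q exp (-L)] has derivative 0 and
    equals its value 1 at the origin. *)
Lemma holo_disk_log (q q' : C -> C) : holo_disk q q' -> q 0 = 1 -> (forall z, disk z -> q z <> 0) ->
  exists L, holo_disk L (fun z => q' z / q z) /\ L 0 = 0 /\ forall z, disk z -> q z = cexp (L z).
Proof.
  intros Hq H1 Hn.
  assert (Hd : forall z, disk z -> exists l, holo_at (fun z => q' z / q z) z l).
  { intros z Hz. eexists. apply (holo_at_mult q' (fun x => / q x)).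
    - apply (holo_disk_deriv _ _ Hq), Hz.
    - apply (holo_at_comp q Cinv); [apply Hq, Hz | apply holo_at_inv, Hn, Hz]. }
  destruct (primitive_exists (fun z => q' z / q z) 0 disk_0) as [H HH].
  { intros z Hz. destruct (Hd z Hz) as [l Hl]. exact (holo_at_cont _ _ _ Hl). }
  { intros z Hz _. apply Hd, Hz. }
  set (L := fun z => H z - H 0).
  assert (HL : holo_disk L (fun z => q' z / q z)).
  { intros z Hz. apply (holo_at_eq _ _ (q' z / q z - 0)); [|ring].
    apply holo_at_minus; [apply HH, Hz | apply holo_at_const]. }
  assert (HL0 : L 0 = 0) by (unfold L; ring).
  exists L. split; [exact HL|]. split; [exact HL0|].
  intros z Hz.
  assert (E : q z * cexp (- (1) * L z) = q 0 * cexp (- (1) * L 0)).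
  { apply (disk_const (fun z => q z * cexp (- (1) * L z))
      (fun z => q' z * cexp (- (1) * L z) + q z * (cexp (- (1) * L z) * (- (1) * (q' z / q z))))); [| |exact Hz].
    - intros x Hx. apply (holo_at_mult q (fun x => cexp (- (1) * L x))); [apply Hq, Hx|].
      apply (holo_at_comp (fun x => - (1) * L x) cexp); [apply holo_at_scal, HL, Hx | apply holo_at_cexp].
    - intros x Hx. field. apply Hn, Hx. }
  rewrite H1, HL0 in E. replace (- (1) * RtoC 0) with (RtoC 0) in E by ring. rewrite cexp_0 in E.
  replace (- (1) * L z) with (- L z) in E by ring. rewrite cexp_opp in E.
  pose proof (cexp_neq_0 (L z)).
  replace (q z) with (q z * / cexp (L z) * cexp (L z)) by (field; assumption). rewrite E. ring.
Qed.

(* [L] is the branch of log (f(z)/z) vanishing at 0, and [Q = c z f'/f]. *)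
Record log_data (f : C -> C) (c : C) (a M : R) (L L' Q Q' : C -> C) : Prop := {
  ld_L : holo_disk L L';
  ld_L0 : L 0 = 0;
  ld_f : forall z, disk z -> f z = z * cexp (L z);
  ld_f' : holo_disk f (fun z => cexp (L z) * (1 + z * L' z));
  ld_Q : holo_disk Q Q';
  ld_QL : forall z, Q z = c * (1 + z * L' z);
  ld_Qn : forall z, disk z -> Q z <> 0;
  ld_P : forall z, disk z -> Cmod (Q z + z * Q' z / Q z - RtoC a) <= M }.

Arguments ld_L {f c a M L L' Q Q'} _.
Arguments ld_L0 {f c a M L L' Q Q'} _.
Arguments ld_f {f c a M L L' Q Q'} _.
Arguments ld_f' {f c a M L L' Q Q'} _.
Arguments ld_Q {f c a M L L' Q Q'} _.
Arguments ld_QL {f c a M L L' Q Q'} _.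
Arguments ld_Qn {f c a M L L' Q Q'} _.
Arguments ld_P {f c a M L L' Q Q'} _.

(** Write [f = z q] with [q] free of zeros, [L = log q] and [p = z f'/f = 1 + z L']. Then
    [f' = q p], hence [1 + z f''/f' = p + z p'/p]. Adding [(c - 1) p] gives [c p + z p'/p], which is
    [Q + z Q'/Q] for [Q = c p]. *)
Lemma log_data_exists (f : C -> C) (alpha beta a M : R) :
  let c : C := (alpha, beta) in
  c <> 0 -> classA f ->
  (forall z, disk z -> C_derive f z <> 0) ->
  (forall z, disk z -> z <> 0 -> f z <> 0) ->
  (forall z, disk z ->
     Cmod (1 + z * C_derive (C_derive f) z / C_derive f z
              + (c - 1) * zfp_over_f f z - RtoC a) <= M) ->
  exists L L' Q Q', log_data f c a M L L' Q Q'.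
Proof.
  intros c Hc0 [Hf [Hf0 Hf1]] Hn1 Hn2 HP.
  assert (Hf' : holo_disk f (C_derive f)).
  { apply holo_disk_intro. intros z Hz. destruct (Hf z Hz) as [l Hl]. exists l. apply holo_at_iff, Hl. }
  pose proof (holo_disk_deriv _ _ Hf') as Hf''.
  destruct (holo_disk_div_id f _ Hf' Hf0) as [q [q' [Hq [Hq0 Eq]]]].
  rewrite (is_C_derive_unique f 0 1 Hf1) in Hq0.
  assert (Hqn : forall z, disk z -> q z <> 0).
  { intros z Hz E. destruct (Ceq_dec z 0) as [->|n].
    - rewrite Hq0 in E. apply (f_equal fst) in E. simpl in E. lra.
    - apply (Hn2 z Hz n). rewrite (Eq z Hz), E. ring. }
  destruct (holo_disk_log q q' Hq Hq0 Hqn) as [L [HL [HL0 EL]]].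
  set (L' := fun z => q' z / q z) in *.
  set (Q := fun z => c * (1 + z * L' z)).
  pose proof (holo_disk_deriv _ _ HL) as HL'.
  set (Q' := fun z => c * (0 + (1 * L' z + z * C_derive L' z))).
  assert (HQ : holo_disk Q Q').
  { intros z Hz. apply holo_at_scal, holo_at_plus; [apply holo_at_const|].
    apply (holo_at_mult (fun z => z) L'); [apply holo_at_id | apply HL', Hz]. }
  assert (Ef1 : forall z, disk z -> C_derive f z = q z * (1 + z * L' z)).
  { intros z Hz. apply (holo_at_unique f z); [apply Hf', Hz|].
    destruct (disk_open z Hz) as [r [Hr Ho]].
    apply (holo_at_local (fun x => x * q x) _ z _ r); [exact Hr | intros x Hx; symmetry; apply Eq, Ho, Hx|].
    apply (holo_at_eq _ _ (1 * q z + z * q' z)).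
    - apply (holo_at_mult (fun x => x) q); [apply holo_at_id | apply Hq, Hz].
    - unfold L'. field. apply Hqn, Hz. }
  assert (Ef2 : forall z, disk z -> C_derive (C_derive f) z = q' z * (1 + z * L' z) + q z * (Q' z / c)).
  { intros z Hz. apply (holo_at_unique (C_derive f) z); [apply Hf'', Hz|].
    destruct (disk_open z Hz) as [r [Hr Ho]].
    apply (holo_at_local (fun x => q x * (1 + x * L' x)) _ z _ r); [exact Hr | intros x Hx; symmetry; apply Ef1, Ho, Hx|].
    apply (holo_at_mult q (fun x => 1 + x * L' x)); [apply Hq, Hz|].
    apply (holo_at_eq _ _ (0 + (1 * L' z + z * C_derive L' z))); [|unfold Q'; field; exact Hc0].
    apply holo_at_plus; [apply holo_at_const|].
    apply (holo_at_mult (fun z => z) L'); [apply holo_at_id | apply HL', Hz]. }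
  assert (Hk : forall z, disk z -> 1 + z * L' z <> 0).
  { intros z Hz E. apply (Hn1 z Hz). rewrite Ef1, E by exact Hz. ring. }
  exists L, L', Q, Q'. constructor.
  - exact HL.
  - exact HL0.
  - intros z Hz. rewrite <- EL by exact Hz. apply Eq, Hz.
  - intros z Hz. rewrite <- EL, <- Ef1 by exact Hz. apply Hf', Hz.
  - exact HQ.
  - reflexivity.
  - intros z Hz. apply Cmult_neq_0; [exact Hc0 | apply Hk, Hz].
  - intros z Hz. specialize (HP z Hz).
    assert (Ez : zfp_over_f f z = 1 + z * L' z).
    { assert (E1 : z <> 0 -> z * C_derive f z / f z = 1 + z * L' z).
      { intros n. rewrite Ef1, Eq by exact Hz. field. split; [apply Hqn, Hz | exact n]. }
      unfold zfp_over_f.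
      destruct (Rdec_eq (fst z) 0) as [e1|n1]; [destruct (Rdec_eq (snd z) 0) as [e2|n2]|].
      - replace z with (RtoC 0) by (destruct z; simpl in *; unfold RtoC; f_equal; lra). ring.
      - apply E1. intros E. apply n2. rewrite E. reflexivity.
      - apply E1. intros E. apply n1. rewrite E. reflexivity. }
    rewrite Ez, Ef2, Ef1 in HP by exact Hz.
    replace (Q z + z * Q' z / Q z - RtoC a) with (1 + z * (q' z * (1 + z * L' z) + q z * (Q' z / c)) / (q z * (1 + z * L' z))
       + (c - 1) * (1 + z * L' z) - RtoC a); [exact HP|].
    assert (EL' : z * q' z = z * L' z * q z) by (unfold L'; field; apply Hqn, Hz).
    pose proof (Hk z Hz) as Hkz. pose proof (Hqn z Hz) as Hqz. unfold Q.
    replace (z * (q' z * (1 + z * L' z) + q z * (Q' z / c))) with ((z * q' z) * (1 + z * L' z) + z * q z * (Q' z / c)) by ring.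
    rewrite EL'. set (k := 1 + z * L' z) in *.
    replace (z * L' z) with (k - 1) by (unfold k; ring).
    field. repeat split; assumption.
Qed.

(** * The Schwarz-Pick estimate *)

Section SchwarzPick.

Variables (P P' : C -> C) (a k : R).
Hypothesis P_holo : holo_disk P P'.
Hypothesis Hk : 0 <= k < 1.
Hypothesis P_bound : forall z, disk z -> Cmod (P z - RtoC a) <= k.

(** Both claims rest on [|1 - conj kap u|^2 - |u - kap|^2 = (1 - |u|^2) (1 - |kap|^2)] and on
    [|conj kap u| < 1]. *)
Lemma pick_denominator (u kap : C) : Cmod u < 1 -> Cmod kap < 1 ->
  1 - Cconj kap * u <> 0 /\ Cmod (u - kap) <= Cmod (1 - Cconj kap * u).
Proof.
  intros Hu Hk'.
  pose proof (Cmod_ge_0 u). pose proof (Cmod_ge_0 kap).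
  split.
  - intros E. assert (Cmod (Cconj kap * u) < 1) by (rewrite Cmod_mult, Cmod_conj; nra).
    replace (Cconj kap * u) with (RtoC 1 - (1 - Cconj kap * u)) in H1 by ring. rewrite E in H1.
    replace (1 - RtoC 0) with (RtoC 1) in H1 by ring. rewrite Cmod_1 in H1. lra.
  - apply Rsqr_incr_0_var; [|apply Cmod_ge_0]. unfold Rsqr. rewrite <- !Cmod_sqr_re.
    pose proof (Cmod_sqr_re u) as Eu. pose proof (Cmod_sqr_re kap) as Ek.
    assert (0 <= (1 - Cmod u * Cmod u) * (1 - Cmod kap * Cmod kap)) by (apply Rmult_le_pos; nra).
    rewrite <- Eu, <- Ek in H1. destruct u as [u1 u2], kap as [k1 k2].
    unfold Cconj, Cminus, Cmult, Cplus, Copp, RtoC in *; simpl in *. nra.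
Qed.

(* Schwarz-Pick gives [t (1 - x^2) / (1 - x t)] with [t = |z|], [x = |P 0 - a| / k0];
   the maximum over [x] is at most [t (1 + t^2)]. *)
Lemma schwarz_pick (z : C) : disk z -> Cmod (P z - P 0) <= Cmod z * (1 + Cmod z * Cmod z).
Proof.
  intros Hz. set (k0 := ((1 + k) / 2)%R).
  assert (Hk0 : 0 < k0 < 1 /\ k < k0) by (unfold k0; lra).
  assert (Hk0c : RtoC k0 <> 0) by (intros E; apply (f_equal fst) in E; simpl in E; lra).
  set (u := fun z => / RtoC k0 * (P z - RtoC a)).
  assert (Hu : forall x, disk x -> Cmod (u x) < 1).
  { intros x Hx. unfold u. rewrite Cmod_mult, Cmod_inv, Cmod_R, Rabs_right by (try exact Hk0c; lra).
    specialize (P_bound x Hx). apply Rmult_lt_reg_l with k0; [lra|]. rewrite <- Rmult_assoc, Rinv_r by lra. lra. }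
  set (kap := u 0). pose proof (Hu 0 disk_0) as Hkap. fold kap in Hkap.
  set (om := fun x => (u x - kap) * / (1 - Cconj kap * u x)).
  assert (Hom : holo_disk om (C_derive om)).
  { apply holo_disk_intro. intros x Hx.
    assert (Hux : holo_at u x (/ RtoC k0 * (P' x - 0))).
    { apply holo_at_scal, holo_at_minus; [apply P_holo, Hx | apply holo_at_const]. }
    eexists. apply (holo_at_mult (fun x => u x - kap) (fun x => / (1 - Cconj kap * u x))).
    - apply holo_at_minus; [exact Hux | apply holo_at_const].
    - apply (holo_at_comp (fun x => 1 - Cconj kap * u x) Cinv).
      + apply holo_at_minus; [apply holo_at_const | apply holo_at_scal, Hux].
      + apply holo_at_inv, pick_denominator; [apply Hu, Hx | exact Hkap]. }
  assert (Hom0 : om 0 = 0) by (unfold om; fold kap; ring).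
  assert (Hom1 : forall x, disk x -> Cmod (om x) <= 1).
  { intros x Hx. destruct (pick_denominator (u x) kap (Hu x Hx) Hkap) as [A B]. unfold om.
    pose proof (proj1 (Cmod_gt_0 _) A). rewrite Cmod_mult, Cmod_inv by exact A.
    apply Rmult_le_reg_r with (Cmod (1 - Cconj kap * u x)); [assumption|]. rewrite Rmult_assoc, Rinv_l by lra. lra. }
  pose proof (schwarz om _ z Hom Hom0 Hom1 Hz) as S.
  destruct (pick_denominator (u z) kap (Hu z Hz) Hkap) as [A _].
  (* The Moebius transformation defining [om] is inverted; [|om| <= |z|] then controls
     [u z - kap]. *)
  assert (E : (u z - kap) * (1 + Cconj kap * om z) = om z * RtoC (1 - Cmod kap * Cmod kap)).
  { rewrite RtoC_minus. replace (RtoC (Cmod kap * Cmod kap)) with (kap * Cconj kap)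
      by (rewrite <- Cmod2_conj; f_equal; ring). unfold om. field. exact A. }
  apply (f_equal Cmod) in E. rewrite !Cmod_mult, Cmod_R in E.
  pose proof (Cmod_ge_0 kap) as Pk. set (x := Cmod kap) in *. set (t := Cmod z) in *.
  assert (Pt : 0 <= t < 1) by (split; [apply Cmod_ge_0 | exact Hz]).
  rewrite Rabs_right in E by nra.
  assert (D : 1 - x * t <= Cmod (1 + Cconj kap * om z)).
  { pose proof (Cmod_ge_sub 1 (- (Cconj kap * om z))) as T.
    rewrite Cmod_opp, Cmod_mult, Cmod_conj, Cmod_1 in T. fold x in T.
    replace (1 - - (Cconj kap * om z)) with (1 + Cconj kap * om z) in T by ring.
    pose proof (Cmod_ge_0 (om z)). nra. }
  pose proof (Cmod_ge_0 (u z - kap)) as Pu. set (y := Cmod (u z - kap)) in *.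
  assert (Y : y * (1 - x * t) <= t * (1 - x * x)).
  { apply Rle_trans with (y * Cmod (1 + Cconj kap * om z))%R; [apply Rmult_le_compat_l; lra|].
    rewrite E. apply Rmult_le_compat_r; nra. }
  (* Completing the square in [x]: the difference of the two sides is [(x - t (1 + t^2)/2)^2 + t^2
     (4 - (1 + t^2)^2)/4], and [t < 1]. *)
  assert (Hxt : 1 - x * x <= (1 + t * t) * (1 - x * t)).
  { assert (0 <= (x - t * (1 + t * t) / 2) * (x - t * (1 + t * t) / 2)) by apply Rle_0_sqr.
    assert (0 <= t * t * (4 - (1 + t * t) * (1 + t * t)) / 4).
    { assert (0 <= t * t <= 1) by nra. assert (0 <= 4 - (1 + t * t) * (1 + t * t)) by nra.
      assert (0 <= t * t * (4 - (1 + t * t) * (1 + t * t))) by (apply Rmult_le_pos; lra). lra. }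
    nra. }
  assert (Y2 : y <= t * (1 + t * t)).
  { apply Rmult_le_reg_r with (1 - x * t)%R; [nra|].
    eapply Rle_trans; [exact Y|]. rewrite Rmult_assoc. apply Rmult_le_compat_l; lra. }
  replace (P z - P 0) with (RtoC k0 * (u z - kap)) by (unfold u, kap, u; field; exact Hk0c).
  rewrite Cmod_mult, Cmod_R, Rabs_right by lra. fold y. nra.
Qed.

End SchwarzPick.

(** * The Bazilevic representation *)

Lemma curve_RInt (W w : R -> C) (a b : R) : a <= b ->
  (forall t, a <= t <= b -> curve_deriv W t (w t)) -> (forall t, a <= t <= b -> curve_cont w t) ->
  is_RInt (V := C_R_NormedModule) w a b (W b - W a).
Proof.
  intros Hab H1 H2.
  apply (is_RInt_fct_extend_pair (U := R_NormedModule) (V := R_NormedModule) w a b (fst (W b - W a)) (snd (W b - W a))).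
  - apply (is_RInt_derive (V := R_CompleteNormedModule) (fun t => fst (W t)) (fun t => fst (w t)));
      rewrite Rmin_left, Rmax_right by exact Hab; intros t Ht.
    + apply curve_deriv_fst, H1, Ht.
    + apply curve_cont_fst, H2, Ht.
  - apply (is_RInt_derive (V := R_CompleteNormedModule) (fun t => snd (W t)) (fun t => snd (w t)));
      rewrite Rmin_left, Rmax_right by exact Hab; intros t Ht.
    + apply curve_deriv_snd, H1, Ht.
    + apply curve_cont_snd, H2, Ht.
Qed.

Lemma cexp_ln (t : R) : 0 < t -> cexp (RtoC (ln t)) = RtoC t.
Proof.
  intros Ht. unfold cexp, RtoC; simpl. rewrite exp_ln, cos_0, sin_0 by exact Ht. f_equal; ring.
Qed.

Lemma rpowc_deriv (t : R) (w : C) : 0 < t -> curve_deriv (fun s => rpowc s w) t (w * rpowc t (w - 1)).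
Proof.
  intros Ht. unfold rpowc.
  assert (Hc : RtoC t <> 0) by (intros E; apply (f_equal fst) in E; simpl in E; lra).
  apply (curve_deriv_eq _ _ (cexp (RtoC (ln t) * w) * (RtoC (/ t) * w + RtoC (ln t) * 0))).
  - apply (curve_deriv_holo cexp (fun s => RtoC (ln s) * w)); [apply holo_at_cexp|].
    apply (curve_deriv_mult (fun s => RtoC (ln s)) (fun _ => w)); [|apply curve_deriv_const].
    apply (curve_deriv_pair (fun s => RtoC (ln s))); simpl.
    + apply is_derive_Reals, derivable_pt_lim_ln, Ht.
    + apply (is_derive_const (V := R_NormedModule) 0%R).
  - replace (RtoC (ln t) * (w - 1)) with (RtoC (ln t) * w - RtoC (ln t)) by ring.
    rewrite cexp_minus, cexp_ln, RtoC_inv by lra. field. exact Hc.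
Qed.

Section BazilevicPart.

Variables (f : C -> C) (alpha beta a M k : R) (L L' Q Q' : C -> C).
Let c : C := (alpha, beta).
Hypothesis Ha : 0 < alpha.
Hypothesis HM : 0 <= M <= k.
Hypothesis Hk : k < 1.
Hypothesis HMa : M < a.
Hypothesis D : log_data f c a M L L' Q Q'.

Let HQ := ld_Q D.

Lemma log_data_Q_re_pos (z : C) : disk z -> 0 < fst (Q z).
Proof.
  intros Hz.
  pose proof (briot_bouquet Q Q' a M HQ (ld_Qn D) (conj (proj1 HM) HMa) (ld_P D) z Hz) as B.
  pose proof (Cmod_fst (Q z - RtoC a)) as F. change (Rabs (fst (Q z) - a) <= Cmod (Q z - RtoC a)) in F.
  apply Rabs_le_between in F. lra.
Qed.

Lemma log_data_Q_0 : Q 0 = c.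
Proof. rewrite (ld_QL D). ring. Qed.

Lemma c_neq_0 : c <> 0.
Proof. apply rhp_neq_0. exact Ha. Qed.

(** The logarithm of [h = f' (f/z)^(c-1)], using [f' = exp L Q / c]. The principal branches are
    legitimate because [Q] and [c] lie in the right half-plane, and the last term normalises
    [h 0 = 1]. *)
Let l (z : C) : C := c * L z + Clog (Q z) - Clog c.
Let l' (z : C) : C := c * L' z + / Q z * Q' z.

Lemma log_h_holo : holo_disk l l'.
Proof.
  intros z Hz. apply (holo_at_eq _ _ (c * L' z + / Q z * Q' z - 0)); [|unfold l'; ring].
  apply (holo_at_minus (fun z => c * L z + Clog (Q z))); [|apply holo_at_const].
  apply holo_at_plus.
  - apply holo_at_scal, (ld_L D), Hz.
  - apply (holo_at_comp Q Clog); [apply HQ, Hz | apply holo_at_Clog, log_data_Q_re_pos, Hz].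
Qed.

Lemma log_h_0 : l 0 = 0.
Proof. unfold l. rewrite log_data_Q_0, (ld_L0 D). ring. Qed.

(** The identity [z l' = P - P 0] turns Schwarz-Pick, after division by [|z|], into the bound; the
    origin is reached as a limit along the positive real axis. *)
Lemma log_h_deriv_bound (z : C) : disk z -> Cmod (l' z) <= 1 + Cmod z * Cmod z.
Proof.
  set (P := fun z => Q z + z * (Q' z * / Q z)).
  assert (HP : holo_disk P (C_derive P)).
  { apply holo_disk_intro. intros x Hx. eexists. apply holo_at_plus; [apply HQ, Hx|].
    apply (holo_at_mult (fun x => x) (fun x => Q' x * / Q x)); [apply holo_at_id|].
    apply (holo_at_mult Q' (fun x => / Q x)); [apply (holo_disk_deriv _ _ HQ), Hx|].
    apply (holo_at_comp Q Cinv); [apply HQ, Hx | apply holo_at_inv, (ld_Qn D), Hx]. }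
  assert (PB : forall x, disk x -> Cmod (P x - RtoC a) <= k).
  { intros x Hx. eapply Rle_trans; [|exact (proj2 HM)].
    pose proof (ld_P D x Hx) as B. unfold P. unfold Cdiv in B. rewrite <- Cmult_assoc in B. exact B. }
  assert (Hn0 : forall x, disk x -> x <> 0 -> Cmod (l' x) <= 1 + Cmod x * Cmod x).
  { intros x Hx n. pose proof (schwarz_pick P _ a k HP ltac:(lra) PB x Hx) as S.
    pose proof (proj1 (Cmod_gt_0 x) n) as Px.
    assert (E : P x - P 0 = x * l' x).
    { unfold P, l'. rewrite log_data_Q_0. replace (Q x) with (c * (1 + x * L' x)) at 1
        by (symmetry; apply (ld_QL D)). ring. }
    rewrite E, Cmod_mult in S. apply Rmult_le_reg_l with (Cmod x); assumption. }
  intros Hz. destruct (Ceq_dec z 0) as [->|n]; [|apply Hn0; assumption].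
  rewrite Cmod_0. apply Rle_plus_epsilon. intros eps He.
  destruct (holo_at_cont _ _ _ (holo_disk_deriv _ _ log_h_holo 0 disk_0) (eps / 2)%R ltac:(lra)) as [d [Hd H]].
  set (s := Rmin (1 / 2) (Rmin (d / 2) (eps / 2))).
  assert (Hs : 0 < s) by (repeat apply Rmin_pos; lra).
  assert (Hs1 : s <= 1 / 2) by apply Rmin_l.
  assert (Hs2 : s <= d / 2) by (eapply Rle_trans; [apply Rmin_r | apply Rmin_l]).
  assert (Hs3 : s <= eps / 2) by (eapply Rle_trans; [apply Rmin_r | apply Rmin_r]).
  assert (Es : Cmod (RtoC s) = s) by (rewrite Cmod_R, Rabs_right; lra).
  specialize (H (RtoC s) ltac:(replace (RtoC s - 0) with (RtoC s) by ring; rewrite Es; lra)).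
  pose proof (Hn0 (RtoC s) ltac:(unfold disk; lra) ltac:(apply Cmod_gt_0; lra)) as B. rewrite Es in B.
  pose proof (Cmod_ge_sub (l' 0) (l' (RtoC s))) as T. rewrite Cmod_sub_sym in T. nra.
Qed.

(** The constant is the integral of [1 + t^2] over [[0, 1]], obtained along the radius to [z]. It
    lies below [3/2], hence below [pi/2]. *)
Lemma log_h_bound (z : C) : disk z -> Cmod (l z) <= 4 / 3.
Proof.
  intros Hz. pose proof (Cmod_ge_0 z) as Pz. unfold disk in Hz.
  pose proof (curve_mvt (fun t => l (0 + RtoC t * z)) (fun t => l' (0 + RtoC t * z) * z)
    (fun t => t + t * t * t / 3)%R (fun t => 1 + t * t)%R) as B. cbv beta in B.
  replace (0 + RtoC 1 * z) with z in B by ring. replace (0 + RtoC 0 * z) with (RtoC 0) in B by ring.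
  rewrite log_h_0 in B. replace (l z - 0) with (l z) in B by ring.
  assert (Hd : forall t, 0 <= t <= 1 -> Cmod (0 + RtoC t * z) = (t * Cmod z)%R).
  { intros t Ht. replace (0 + RtoC t * z) with (RtoC t * z) by ring. rewrite Cmod_mult, Cmod_R, Rabs_right; lra. }
  eapply Rle_trans; [apply B|].
  - intros t Ht. apply (curve_deriv_holo l (fun t => 0 + RtoC t * z)); [|apply curve_deriv_segment].
    apply log_h_holo. unfold disk. rewrite Hd by exact Ht. nra.
  - intros t Ht. auto_derive; [exact I | field].
  - intros t Ht. rewrite Cmod_mult.
    pose proof (log_h_deriv_bound (0 + RtoC t * z)) as B2. unfold disk in B2. rewrite Hd in B2 by exact Ht.
    specialize (B2 ltac:(nra)). pose proof (Cmod_ge_0 (l' (0 + RtoC t * z))).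
    assert (t * Cmod z * (t * Cmod z) <= t * t) by (assert (0 <= t * Cmod z <= t) by nra; nra). nra.
  - lra.
Qed.

Let h (z : C) : C := cexp (l z).

Lemma h_formula (z : C) : disk z -> h z = cexp (c * L z) * (1 + z * L' z).
Proof.
  intros Hz. unfold h, l. rewrite cexp_minus, cexp_plus, !cexp_Clog by (try apply log_data_Q_re_pos, Hz; exact Ha).
  rewrite (ld_QL D). field. exact c_neq_0.
Qed.

Lemma h_re_pos (z : C) : disk z -> 0 < fst (h z).
Proof.
  intros Hz. change (0 < exp (fst (l z)) * cos (snd (l z))). apply Rmult_lt_0_compat; [apply exp_pos|].
  pose proof (Cmod_snd (l z)) as F. pose proof (log_h_bound z Hz) as B. apply Rabs_le_between in F.
  pose proof PI2_3_2. apply cos_gt_0; lra.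
Qed.

(** With [g] the identity the integrand is [t^(c-1) h(t z)], and [W t = t^c exp (c L(t z)) / c] is a
    primitive on [(0, 1]]. It tends to 0 at the left end because [|t^c| = t^alpha]. *)
Lemma bazilevic_integral (z : C) : disk z ->
  is_RInt_gen (V := C_R_NormedModule)
    (fun t : R => rpowc t (c - 1) * cexp (RtoC alpha * 0) * h (RtoC t * z))
    (at_right 0) (at_point 1) (/ c * cexp (c * L z)).
Proof.
  intros Hz. pose proof (Cmod_ge_0 z) as Pz.
  set (W := fun t : R => / c * (rpowc t c * cexp (c * L (0 + RtoC t * z)))).
  set (w := fun t : R => rpowc t (c - 1) * cexp (RtoC alpha * 0) * h (RtoC t * z)).
  assert (Hd : forall t, 0 <= t <= 1 -> disk (0 + RtoC t * z)).
  { intros t Ht. unfold disk in *. replace (0 + RtoC t * z) with (RtoC t * z) by ring.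
    rewrite Cmod_mult, Cmod_R, Rabs_right by lra. nra. }
  assert (Hh : forall t, 0 <= t <= 1 -> curve_deriv (fun t => cexp (c * L (0 + RtoC t * z))) t
      (cexp (c * L (0 + RtoC t * z)) * (c * (L' (0 + RtoC t * z) * z)))).
  { intros t Ht. apply (curve_deriv_holo cexp (fun t => c * L (0 + RtoC t * z))); [apply holo_at_cexp|].
    apply curve_deriv_scal. apply (curve_deriv_holo L (fun t => 0 + RtoC t * z)); [|apply curve_deriv_segment].
    apply (ld_L D), Hd, Ht. }
  assert (HW : forall t, 0 < t <= 1 -> curve_deriv W t (w t)).
  { intros t Ht.
    apply (curve_deriv_eq _ _ (/ c * (c * rpowc t (c - 1) * cexp (c * L (0 + RtoC t * z))
      + rpowc t c * (cexp (c * L (0 + RtoC t * z)) * (c * (L' (0 + RtoC t * z) * z)))))).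
    - apply curve_deriv_scal. apply (curve_deriv_mult (fun t => rpowc t c)); [apply rpowc_deriv; lra | apply Hh; lra].
    - unfold w. replace (h (RtoC t * z)) with (h (0 + RtoC t * z)) by (f_equal; ring). rewrite h_formula by (apply Hd; lra).
      replace (RtoC alpha * 0) with (RtoC 0) by ring. rewrite cexp_0.
      assert (E : rpowc t c = RtoC t * rpowc t (c - 1)).
      { unfold rpowc. rewrite <- (cexp_ln t) by lra. rewrite <- cexp_plus. f_equal. ring. }
      rewrite E. field. exact c_neq_0. }
  assert (Hw : forall t, 0 < t <= 1 -> curve_cont w t).
  { intros t Ht. apply curve_cont_mult; [apply curve_cont_mult; [|apply curve_cont_const]|].
    - eapply curve_deriv_cont, rpowc_deriv. lra.
    - apply (cont_curve_comp h (fun t => RtoC t * z)).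
      + eapply holo_at_cont. apply (holo_at_comp l cexp); [apply log_h_holo | apply holo_at_cexp].
        replace (RtoC t * z) with (0 + RtoC t * z) by ring. apply Hd. lra.
      + eapply curve_deriv_cont. apply (curve_deriv_mult RtoC (fun _ => z)); [apply curve_deriv_id | apply curve_deriv_const]. }
  assert (W1 : W 1%R = / c * cexp (c * L z)).
  { unfold W, rpowc. rewrite ln_1. replace (RtoC 0 * c) with (RtoC 0) by ring. rewrite cexp_0.
    replace (0 + RtoC 1 * z) with z by ring. ring. }
  rewrite <- W1. apply filterlimi_locally. intros eps.
  set (u0 := cexp (c * L (0 + RtoC 0 * z))).
  destruct (curve_deriv_cont _ _ _ (Hh 0%R ltac:(lra)) 1%R ltac:(lra)) as [d [Hd0 Hdd]].
  set (K := (Cmod (/ c) * (Cmod u0 + 1) + 1)%R).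
  assert (HK : 1 <= K).
  { unfold K. pose proof (Cmod_ge_0 (/ c)). pose proof (Cmod_ge_0 u0). nra. }
  pose proof (cond_pos eps) as Pe.
  (* This is [(eps/K)^(1/alpha)]: below it [t^alpha < eps/K], while [K] dominates the remaining
     factors of [W] near 0. *)
  set (d2 := exp (ln (eps / K) / alpha)).
  set (d3 := Rmin (Rmin d 1) d2).
  assert (Hd3 : 0 < d3) by (unfold d3; repeat apply Rmin_pos; try lra; apply exp_pos).
  apply Filter_prod with (fun t => 0 < t < d3) (fun t => t = 1%R).
  - exists (mkposreal _ Hd3). intros t Ht Ht0. split; [exact Ht0|].
    change (Rabs (t - 0) < d3) in Ht. rewrite Rminus_0_r, Rabs_right in Ht by lra. exact Ht.
  - reflexivity.
  - intros t s [Ht0 Ht] ->.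
    assert (T1 : t < d /\ t < 1 /\ t < d2).
    { unfold d3 in Ht. pose proof (Rmin_l (Rmin d 1) d2). pose proof (Rmin_r (Rmin d 1) d2).
      pose proof (Rmin_l d 1). pose proof (Rmin_r d 1). lra. }
    exists (W 1%R - W t). split.
    + simpl. apply (curve_RInt W w); [lra | |]; intros s Hs; [apply HW | apply Hw]; lra.
    + apply C_NormedModule_mixin_compat1.
      change (Cmod (W 1%R - W t - W 1%R) < eps). replace (W 1%R - W t - W 1%R) with (- W t) by ring.
      rewrite Cmod_opp. unfold W. rewrite !Cmod_mult.
      assert (A : Cmod (rpowc t c) < eps / K).
      { unfold rpowc. rewrite Cmod_cexp. replace (fst (RtoC (ln t) * c)) with (ln t * alpha)%R
          by (unfold c, Cmult, RtoC; simpl; ring).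
        rewrite <- (exp_ln (eps / K)) by (apply Rdiv_lt_0_compat; lra). apply exp_increasing.
        assert (ln t < ln (eps / K) / alpha).
        { rewrite <- (ln_exp (ln (eps / K) / alpha)). apply ln_increasing; [exact Ht0 | apply T1]. }
        apply (Rmult_lt_compat_r alpha) in H; [|exact Ha].
        replace (ln (eps / K) / alpha * alpha)%R with (ln (eps / K)) in H by (field; lra). exact H. }
      assert (B : Cmod (cexp (c * L (0 + RtoC t * z))) <= Cmod u0 + 1).
      { specialize (Hdd t ltac:(rewrite Rminus_0_r, Rabs_right; lra)). fold u0 in Hdd.
        pose proof (Cmod_ge_sub (cexp (c * L (0 + RtoC t * z))) u0). lra. }
      pose proof (Cmod_ge_0 (/ c)). pose proof (Cmod_ge_0 (rpowc t c)). pose proof (Cmod_ge_0 u0).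
      apply Rle_lt_trans with (Cmod (rpowc t c) * K)%R.
      * assert (0 <= Cmod (/ c) * Cmod (rpowc t c)) by (apply Rmult_le_pos; assumption).
        assert (Cmod (/ c) * Cmod (rpowc t c) * Cmod (cexp (c * L (0 + RtoC t * z)))
           <= Cmod (/ c) * Cmod (rpowc t c) * (Cmod u0 + 1)) by (apply Rmult_le_compat_l; assumption).
        unfold K. lra.
      * apply (Rmult_lt_compat_r K) in A; [|lra]. replace (eps / K * K)%R with (pos eps) in A by (field; lra). exact A.
Qed.

Lemma bazilevic_of_log_data : classA f -> Bazilevic alpha beta f.
Proof.
  intros Hf. split; [exact Hf|].
  assert (Hholo : forall g g', holo_disk g g' -> analytic_on_disk g).
  { intros g g' Hg z Hz. exists (g' z). apply holo_at_iff, Hg, Hz. }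
  exists (fun z => z), (fun _ => RtoC 0), h, (fun z => c * L z), (fun z => / c * cexp (c * L z)), 0%R.
  assert (HL := ld_L D).
  split; [|split; [|split; [|split; [|split; [|split; [|split; [|split; [|split; [|split; [|split]]]]]]]]]].
  - split; [split; [|split]|split].
    + apply (Hholo _ (fun _ => RtoC 1)). intros z _. apply holo_at_id.
    + reflexivity.
    + apply holo_at_iff, holo_at_id.
    + intros z w _ _ E. exact E.
    + intros z t Hz Ht. exists (RtoC t * z). split; [|reflexivity]. unfold disk in *.
      rewrite Cmod_mult, Cmod_R, Rabs_right by lra. pose proof (Cmod_ge_0 z). nra.
  - apply (Hholo _ (fun _ => RtoC 0)). intros z _. apply holo_at_const.
  - reflexivity.
  - intros z _ n. rewrite cexp_0. field. exact n.
  - apply (Hholo _ (fun z => cexp (l z) * l' z)). intros z Hz.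
    apply (holo_at_comp l cexp); [apply log_h_holo, Hz | apply holo_at_cexp].
  - unfold h. rewrite log_h_0. apply cexp_0.
  - intros z Hz. change ((0%R, 0%R) : C) with (RtoC 0). rewrite cexp_0, Cmult_1_l. apply h_re_pos, Hz.
  - intros z Hz. apply bazilevic_integral, Hz.
  - apply (Hholo _ (fun z => c * L' z)). intros z Hz. apply holo_at_scal, HL, Hz.
  - rewrite (ld_L0 D). ring.
  - intros z _. change ((alpha, beta) : C) with c. field. exact c_neq_0.
  - intros z Hz. rewrite (ld_f D) by exact Hz. f_equal. f_equal.
    change ((alpha, beta) : C) with c. field. exact c_neq_0.
Qed.

End BazilevicPart.

(** * Strictly differentiable proper maps of the plane *)

Definition anypair (x y : C) : Prop := True.

Lemma anypair_based (z : C) : based anypair z.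
Proof. intros x y _. split; exact I. Qed.

Section GlobalHomeomorphism.

Variables (F : C -> C) (k m m0 : R).
Hypothesis Hk : 0 <= k < 1.
Hypothesis F_strict : forall z, exists A B, pair_diff anypair F z A B /\ A <> 0 /\ Cmod B <= k * Cmod A.
Hypothesis Hm : 0 < m.
Hypothesis F_proper : forall z, m * Cmod z - m0 <= Cmod (F z).
Hypothesis F_neq_0 : forall z : C, z <> 0 -> F z <> 0.

Lemma qc_map_cont (z : C) : cont_at F z.
Proof.
  destruct (F_strict z) as [A [B [H _]]]. intros eps He.
  destruct (pair_diff_lim _ _ (anypair_based z) F _ _ H (eps / 2)%R ltac:(lra)) as [d [Hd H1]].
  exists d. split; [exact Hd|]. intros x Hx. destruct (H1 x x I Hx Hx). lra.
Qed.

Lemma qc_linear_lower (A B h : C) : Cmod B <= k * Cmod A -> (1 - k) * Cmod A * Cmod h <= Cmod (A * h + B * Cconj h).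
Proof.
  intros HB. pose proof (Cmod_ge_sub (A * h) (- (B * Cconj h))) as T.
  replace (A * h - - (B * Cconj h)) with (A * h + B * Cconj h) in T by ring.
  rewrite Cmod_opp, !Cmod_mult, Cmod_conj in T. pose proof (Cmod_ge_0 h). nra.
Qed.

(** The linear part expands by at least [(1 - k) |A|], and half of this absorbs the strict
    remainder. In particular [F] is injective near every point. *)
Lemma local_lower (z : C) : exists d q, 0 < d /\ 0 < q /\ forall x y, Cmod (x - z) < d -> Cmod (y - z) < d ->
  q * Cmod (x - y) <= Cmod (F x - F y).
Proof.
  destruct (F_strict z) as [A [B [H [HA HB]]]]. pose proof (proj1 (Cmod_gt_0 A) HA) as PA.
  set (q := ((1 - k) * Cmod A / 2)%R). assert (Hq : 0 < q) by (unfold q; nra).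
  destruct (H q Hq) as [d [Hd H1]]. exists d, q. split; [exact Hd|]. split; [exact Hq|].
  intros x y Hx Hy. specialize (H1 x y I Hx Hy). cbv beta in H1.
  pose proof (qc_linear_lower A B (x - y) HB) as L.
  pose proof (Cmod_ge_sub (A * (x - y) + B * Cconj (x - y)) (- (F x - F y - A * (x - y) - B * Cconj (x - y)))) as T.
  rewrite Cmod_opp in T.
  replace (A * (x - y) + B * Cconj (x - y) - - (F x - F y - A * (x - y) - B * Cconj (x - y))) with (F x - F y) in T by ring.
  unfold q in *. lra.
Qed.

Lemma qc_linear_solve (A B D : C) : A <> 0 -> Cmod B <= k * Cmod A ->
  exists h, A * h + B * Cconj h = D /\ (1 - k) * Cmod A * Cmod h <= Cmod D.
Proof.
  intros HA HB. pose proof (proj1 (Cmod_gt_0 A) HA) as PA. pose proof (Cmod_ge_0 B) as PB.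
  assert (HBA : Cmod B < Cmod A) by nra.
  set (n := (Cmod A * Cmod A - Cmod B * Cmod B)%R). assert (Hn : 0 < n) by (unfold n; nra).
  assert (Hnc : RtoC n <> 0) by (intros E; apply (f_equal fst) in E; simpl in E; lra).
  assert (En : RtoC n = A * Cconj A - B * Cconj B).
  { unfold n. rewrite RtoC_minus, <- !Cmod2_conj. simpl pow. rewrite !Rmult_1_r. reflexivity. }
  (* The real-linear map is inverted explicitly; [n] is its Jacobian determinant [|A|^2 - |B|^2]. *)
  set (h := / RtoC n * (Cconj A * D - B * Cconj D)).
  assert (Eh : A * h + B * Cconj h = D).
  { unfold h. rewrite Cmult_conj, Cminus_conj, !Cmult_conj, !Cconj_conj, Cinv_conj, Cconj_RtoC by exact Hnc.
    replace (A * (/ RtoC n * (Cconj A * D - B * Cconj D)) + B * (/ RtoC n * (A * Cconj D - Cconj B * D)))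
      with (/ RtoC n * ((A * Cconj A - B * Cconj B) * D)) by ring.
    rewrite <- En. field. exact Hnc. }
  exists h. split; [exact Eh|]. rewrite <- Eh. apply qc_linear_lower, HB.
Qed.

(* Minimise |F - w| over a small closed disk: at an interior minimum with nonzero value
   the invertible differential would allow a decrease. *)
Lemma local_surj (z : C) (rho : R) : 0 < rho ->
  exists eta, 0 < eta /\ forall w, Cmod (w - F z) < eta -> exists x, Cmod (x - z) < rho /\ F x = w.
Proof.
  intros Hrho. destruct (F_strict z) as [A [B [H [HA HB]]]]. pose proof (proj1 (Cmod_gt_0 A) HA) as PA.
  destruct (local_lower z) as [d1 [q [Hd1 [Hq Hlow]]]].
  set (e := ((1 - k) * Cmod A / 2)%R). assert (He : 0 < e) by (unfold e; nra).
  destruct (H e He) as [d2 [Hd2 Hst]].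
  set (r := (Rmin rho (Rmin d1 d2) / 2)%R).
  assert (Hr : 0 < r) by (unfold r; assert (0 < Rmin rho (Rmin d1 d2)) by (repeat apply Rmin_pos; lra); lra).
  assert (Hr2 : 2 * r <= rho /\ 2 * r <= d1 /\ 2 * r <= d2).
  { unfold r. pose proof (Rmin_l rho (Rmin d1 d2)). pose proof (Rmin_r rho (Rmin d1 d2)).
    pose proof (Rmin_l d1 d2). pose proof (Rmin_r d1 d2). lra. }
  (* On the circle [|x - z| = r] one has [|F x - F z| >= q r], so [|F x - w|] exceeds [q r / 2],
     while [|F z - w|] is smaller. The minimum is therefore interior. *)
  clearbody r. exists (q * r / 2)%R. split; [nra|]. intros w Hw.
  destruct (compact_max (fun x => - Cmod (F x - w))%R (fun x => Cmod (x - z) <= r) (r + Cmod z) z) as [x1 [Hx1 Hmax]].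
  - rewrite Cmod_self_sub. lra.
  - intros x Hx. pose proof (Cmod_ge_sub x z). lra.
  - intros p Hp. apply closed_disk_closed. intros eps Heps. destruct (Hp eps Heps) as [x [X1 X2]].
    exists (x - z). split; [exact X1|]. replace (x - z - (p - z)) with (x - p) by ring. exact X2.
  - intros x _ eps Heps.
    destruct (rcont_Cmod (fun x => F x - w) x) with (eps := eps) as [d [Hd Hdd]]; [|exact Heps|].
    { intros e' He'. destruct (qc_map_cont x e' He') as [d [Hd Hdd]]. exists d. split; [exact Hd|].
      intros y Hy. replace (F y - w - (F x - w)) with (F y - F x) by ring. apply Hdd, Hy. }
    exists d. split; [exact Hd|]. intros y Hy. specialize (Hdd y Hy). cbv beta in Hdd.
    replace (- Cmod (F y - w) - - Cmod (F x - w))%R with (- (Cmod (F y - w) - Cmod (F x - w)))%R by ring.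
    rewrite Rabs_Ropp. exact Hdd.
  - cbv beta in Hmax.
    assert (Hz : Cmod (F x1 - w) <= Cmod (F z - w)).
    { specialize (Hmax z ltac:(rewrite Cmod_self_sub; lra)). lra. }
    rewrite (Cmod_sub_sym (F z)) in Hz.
    assert (Hin : Cmod (x1 - z) < r).
    { apply Rnot_le_lt. intros Hge.
      pose proof (Hlow x1 z ltac:(lra) ltac:(rewrite Cmod_self_sub; lra)) as L.
      pose proof (Cmod_tri_sub (F x1) w (F z)). nra. }
    exists x1. split; [lra|].
    apply NNPP. intros Hne. set (D := F x1 - w) in *.
    assert (HD : 0 < Cmod D).
    { apply Cmod_gt_0. intros E. apply Hne. replace (F x1) with (D + w) by (unfold D; ring). rewrite E. ring. }
    (* A step [s h] in this direction changes the linear part of [F - w] by exactly [-s D]. The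
       remainder is at most [s |D| / 2], so the modulus drops below the supposed minimum. *)
    destruct (qc_linear_solve A B (- D) HA HB) as [h [Eh Bh]]. rewrite Cmod_opp in Bh.
    pose proof (Cmod_ge_0 h) as Ph.
    set (s := Rmin 1 ((r - Cmod (x1 - z)) / (Cmod h + 1))).
    assert (Hs : 0 < s) by (apply Rmin_pos; [lra | apply Rdiv_lt_0_compat; lra]).
    assert (Hs1 : s <= 1) by apply Rmin_l.
    assert (Hs2 : s * Cmod h <= r - Cmod (x1 - z)).
    { apply Rle_trans with ((r - Cmod (x1 - z)) / (Cmod h + 1) * (Cmod h + 1))%R.
      - apply Rmult_le_compat; [lra | lra | apply Rmin_r | lra].
      - right. field. lra. }
    set (x2 := x1 + RtoC s * h).
    assert (E12 : x2 - x1 = RtoC s * h) by (unfold x2; ring).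
    assert (M12 : Cmod (x2 - x1) = (s * Cmod h)%R) by (rewrite E12, Cmod_mult, Cmod_R, Rabs_right; lra).
    assert (Hx2 : Cmod (x2 - z) <= r).
    { eapply Rle_trans; [apply (Cmod_tri_sub x2 x1 z)|]. lra. }
    specialize (Hst x2 x1 I ltac:(lra) ltac:(lra)). cbv beta in Hst.
    specialize (Hmax x2 Hx2).
    assert (Efin : F x2 - w = RtoC (1 - s) * D + (F x2 - F x1 - A * (x2 - x1) - B * Cconj (x2 - x1))).
    { rewrite E12, Cmult_conj, Cconj_RtoC.
      replace (A * (RtoC s * h)) with (RtoC s * (A * h)) by ring.
      replace (B * (RtoC s * Cconj h)) with (RtoC s * (B * Cconj h)) by ring.
      replace (F x2 - F x1 - RtoC s * (A * h) - RtoC s * (B * Cconj h))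
        with (F x2 - F x1 - RtoC s * (A * h + B * Cconj h)) by ring.
      rewrite Eh, RtoC_minus. unfold D. ring. }
    assert (Bfin : Cmod (F x2 - w) <= (1 - s) * Cmod D + e * (s * Cmod h)).
    { rewrite Efin. eapply Rle_trans; [apply Cmod_triangle|].
      rewrite Cmod_mult, Cmod_R, Rabs_right by lra. rewrite M12 in Hst. lra. }
    assert (e * (s * Cmod h) <= s * (Cmod D / 2)).
    { replace (e * (s * Cmod h))%R with (s * (e * Cmod h))%R by ring. apply Rmult_le_compat_l; [lra|]. unfold e. lra. }
    fold D in Hmax. nra.
Qed.

(** Properness gives a global minimiser of [|F - w|]. Were the minimum positive, local surjectivity
    would produce a value slightly closer to [w]. *)
Lemma qc_map_surj (w : C) : exists x, F x = w.
Proof.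
  (* Beyond this radius properness makes [|F x - w|] larger than [|F 0 - w|], so a minimiser on the
     disk is a global one. *)
  set (rad := ((Cmod w + Cmod (F 0 - w) + Rabs m0 + 1) / m)%R).
  pose proof (Cmod_ge_0 w) as Pw. pose proof (Cmod_ge_0 (F 0 - w)) as Pw2. pose proof (Rabs_pos m0) as Pm.
  assert (Hrad : 0 < rad) by (apply Rdiv_lt_0_compat; lra).
  destruct (compact_max (fun x => - Cmod (F x - w))%R (fun x => Cmod x <= rad) rad 0) as [x1 [Hx1 Hmax]].
  - rewrite Cmod_0. lra.
  - auto.
  - apply closed_disk_closed.
  - intros x _ eps Heps.
    destruct (rcont_Cmod (fun x => F x - w) x) with (eps := eps) as [d [Hd Hdd]]; [|exact Heps|].
    { intros e' He'. destruct (qc_map_cont x e' He') as [d [Hd Hdd]]. exists d. split; [exact Hd|].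
      intros y Hy. replace (F y - w - (F x - w)) with (F y - F x) by ring. apply Hdd, Hy. }
    exists d. split; [exact Hd|]. intros y Hy. specialize (Hdd y Hy). cbv beta in Hdd.
    replace (- Cmod (F y - w) - - Cmod (F x - w))%R with (- (Cmod (F y - w) - Cmod (F x - w)))%R by ring.
    rewrite Rabs_Ropp. exact Hdd.
  - cbv beta in Hmax.
    assert (Hall : forall x, Cmod (F x1 - w) <= Cmod (F x - w)).
    { intros x. destruct (Rle_lt_dec (Cmod x) rad) as [Hle|Hgt]; [specialize (Hmax x Hle); lra|].
      specialize (Hmax 0 ltac:(rewrite Cmod_0; lra)). pose proof (F_proper x) as Pr.
      apply (Rmult_lt_compat_l m) in Hgt; [|exact Hm].
      replace (m * rad)%R with (Cmod w + Cmod (F 0 - w) + Rabs m0 + 1)%R in Hgt by (unfold rad; field; lra).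
      pose proof (Cmod_ge_sub (F x) w). pose proof (Rle_abs m0). lra. }
    exists x1. apply NNPP. intros Hne. set (D := F x1 - w) in *.
    assert (HD : 0 < Cmod D).
    { apply Cmod_gt_0. intros E. apply Hne. replace (F x1) with (D + w) by (unfold D; ring). rewrite E. ring. }
    destruct (local_surj x1 1 ltac:(lra)) as [eta [Heta Hs]].
    set (s := Rmin 1 (eta / (2 * Cmod D))).
    assert (Hs0 : 0 < s) by (apply Rmin_pos; [lra | apply Rdiv_lt_0_compat; lra]).
    assert (Hs1 : s <= 1) by apply Rmin_l.
    assert (Hs2 : s * Cmod D <= eta / 2).
    { apply Rle_trans with (eta / (2 * Cmod D) * Cmod D)%R; [apply Rmult_le_compat_r; [lra | apply Rmin_r] | right; field; lra]. }
    destruct (Hs (F x1 - RtoC s * D)) as [x [_ Hx]].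
    { replace (F x1 - RtoC s * D - F x1) with (- (RtoC s * D)) by ring.
      rewrite Cmod_opp, Cmod_mult, Cmod_R, Rabs_right by lra. lra. }
    specialize (Hall x). rewrite Hx in Hall.
    replace (F x1 - RtoC s * D - w) with (RtoC (1 - s) * D) in Hall by (unfold D; rewrite RtoC_minus; ring).
    rewrite Cmod_mult, Cmod_R, Rabs_right in Hall by lra. nra.
Qed.

Lemma seq_lim_cont (u : nat -> C) (l : C) : seq_lim u l -> seq_lim (fun n => F (u n)) (F l).
Proof.
  intros Hu eps He. destruct (qc_map_cont l eps He) as [d [Hd H]]. destruct (Hu d Hd) as [N HN].
  exists N. intros n Hn. apply H, HN, Hn.
Qed.

Lemma seq_lim_sub (u : nat -> C) (l : C) (phi : nat -> nat) : (forall n, (n <= phi n)%nat) ->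
  seq_lim u l -> seq_lim (fun n => u (phi n)) l.
Proof.
  intros Hphi Hu eps He. destruct (Hu eps He) as [N HN]. exists N. intros n Hn. apply HN. specialize (Hphi n). lia.
Qed.

Lemma seq_lim_unique (u : nat -> C) (l l' : C) : seq_lim u l -> seq_lim u l' -> l = l'.
Proof.
  intros H H'. assert (E : l - l' = 0).
  { apply Cmod_eq_0, Rle_antisym; [|apply Cmod_ge_0]. apply Rle_plus_epsilon. intros eps He.
    destruct (H (eps / 2)%R ltac:(lra)) as [N HN]. destruct (H' (eps / 2)%R ltac:(lra)) as [N' HN'].
    specialize (HN (Nat.max N N') ltac:(lia)). specialize (HN' (Nat.max N N') ltac:(lia)).
    pose proof (Cmod_tri_sub l (u (Nat.max N N')) l') as T. rewrite (Cmod_sub_sym l (u (Nat.max N N'))) in T. lra. }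
  replace l with (l - l' + l') by ring. rewrite E. ring.
Qed.

(* The points t w, 0 <= t <= 1, with two preimages form a closed set (properness and local
   injectivity) that is open towards smaller t (local surjectivity) and misses t = 0. *)
Lemma qc_map_inj (x0 y0 : C) : F x0 = F y0 -> x0 = y0.
Proof.
  intros E0. apply NNPP. intros N0. set (w := F x0) in *.
  set (S := fun t : R => 0 <= t <= 1 /\ exists x y, x <> y /\ F x = RtoC t * w /\ F y = RtoC t * w).
  assert (S1 : S 1%R).
  { split; [lra|]. exists x0, y0. rewrite Cmult_1_l. split; [exact N0|]. split; [reflexivity | symmetry; exact E0]. }
  (* A supremum of the reflected set serves as the infimum [ts] of [S]. *)
  destruct (completeness (fun s => S (- s)%R)) as [b [Hb1 Hb2]].
  { exists 0%R. intros s [Hs _]. lra. }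
  { exists (-1)%R. replace (- -1)%R with 1%R by ring. exact S1. }
  set (ts := (- b)%R).
  assert (Hlow : forall t, S t -> ts <= t).
  { intros t Ht. assert (- t <= b); [|unfold ts; lra]. apply Hb1. rewrite Ropp_involutive. exact Ht. }
  assert (Happ : forall n : nat, exists t, S t /\ t < ts + / INR (Datatypes.S n)).
  { intros n. apply NNPP. intros Hn. assert (P : 0 < / INR (Datatypes.S n)) by (apply Rinv_0_lt_compat, lt_0_INR; lia).
    assert (b <= b - / INR (Datatypes.S n)); [|lra]. apply Hb2. intros s Hs.
    apply Rnot_lt_le. intros Hlt. apply Hn. exists (- s)%R. split; [exact Hs | unfold ts; lra]. }
  assert (Hch : forall n : nat, exists T : R * (C * C), ts <= fst T < ts + / INR (Datatypes.S n) /\ 0 <= fst T <= 1 /\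
     fst (snd T) <> snd (snd T) /\ F (fst (snd T)) = RtoC (fst T) * w /\ F (snd (snd T)) = RtoC (fst T) * w).
  { intros n. destruct (Happ n) as [t [Ht Hlt]]. pose proof (Hlow t Ht). destruct Ht as [Ht01 [x [y [H1 [H2 H3]]]]].
    exists (t, (x, y)). simpl. tauto. }
  set (T := fun n => proj1_sig (constructive_indefinite_description _ (Hch n))).
  assert (HT : forall n, ts <= fst (T n) < ts + / INR (Datatypes.S n) /\ 0 <= fst (T n) <= 1 /\
     fst (snd (T n)) <> snd (snd (T n)) /\ F (fst (snd (T n))) = RtoC (fst (T n)) * w /\ F (snd (snd (T n))) = RtoC (fst (T n)) * w).
  { intros n. exact (proj2_sig (constructive_indefinite_description _ (Hch n))). }
  clearbody T.
  set (bd := ((Cmod w + m0) / m)%R).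
  assert (Hbd : forall x t, 0 <= t <= 1 -> F x = RtoC t * w -> Cmod x <= bd).
  { intros x t Ht Hx. pose proof (F_proper x) as Pr. rewrite Hx, Cmod_mult, Cmod_R, Rabs_right in Pr by lra.
    pose proof (Cmod_ge_0 w). apply Rmult_le_reg_l with m; [exact Hm|]. unfold bd.
    replace (m * ((Cmod w + m0) / m))%R with (Cmod w + m0)%R by (field; lra). nra. }
  destruct (C_bolzano (fun n => fst (snd (T n))) bd) as [p1 [x [Hp1 Lx]]].
  { intros n. destruct (HT n) as [_ [A1 [_ [A2 _]]]]. apply (Hbd _ _ A1 A2). }
  destruct (C_bolzano (fun n => snd (snd (T (p1 n)))) bd) as [p2 [y [Hp2 Ly]]].
  { intros n. destruct (HT (p1 n)) as [_ [A1 [_ [_ A2]]]]. apply (Hbd _ _ A1 A2). }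
  set (ph := fun n => p1 (p2 n)).
  assert (Hph : forall n, (n <= ph n)%nat) by (intros n; unfold ph; specialize (Hp1 (p2 n)); specialize (Hp2 n); lia).
  pose proof (seq_lim_sub _ _ p2 Hp2 Lx) as Lx2. cbv beta in Lx2.
  assert (Lt : seq_lim (fun n => RtoC (fst (T (ph n))) * w) (RtoC ts * w)).
  { intros eps He. destruct (inv_INR_small (eps / (Cmod w + 1))%R) as [N HN].
    { apply Rdiv_lt_0_compat; [exact He|]. pose proof (Cmod_ge_0 w). lra. }
    exists N. intros n Hn. specialize (HN (ph n) ltac:(specialize (Hph n); lia)). destruct (HT (ph n)) as [A _].
    replace (RtoC (fst (T (ph n))) * w - RtoC ts * w) with (RtoC (fst (T (ph n)) - ts) * w) by (rewrite RtoC_minus; ring).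
    rewrite Cmod_mult, Cmod_R, Rabs_right by lra. pose proof (Cmod_ge_0 w) as Pw.
    assert (Q : fst (T (ph n)) - ts < eps / (Cmod w + 1)) by lra.
    apply (Rmult_lt_compat_r (Cmod w + 1)) in Q; [|lra].
    replace (eps / (Cmod w + 1) * (Cmod w + 1))%R with eps in Q by (field; lra). nra. }
  assert (Fx : F x = RtoC ts * w).
  { apply (seq_lim_unique (fun n => RtoC (fst (T (ph n))) * w)); [|exact Lt].
    intros eps He. destruct (seq_lim_cont _ _ Lx2 eps He) as [N HN]. exists N. intros n Hn. specialize (HN n Hn).
    destruct (HT (ph n)) as [_ [_ [_ [A _]]]]. rewrite <- A. exact HN. }
  assert (Fy : F y = RtoC ts * w).
  { apply (seq_lim_unique (fun n => RtoC (fst (T (ph n))) * w)); [|exact Lt].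
    intros eps He. destruct (seq_lim_cont _ _ Ly eps He) as [N HN]. exists N. intros n Hn. specialize (HN n Hn).
    destruct (HT (ph n)) as [_ [_ [_ [_ A]]]]. rewrite <- A. exact HN. }
  (* If the limits of the two preimages coincide, local injectivity is violated along the sequence.
     If they differ, [ts] itself is in [S], and one may pass below it. *)
  destruct (Ceq_dec x y) as [Exy|Nxy].
  - subst y. destruct (local_lower x) as [d [q [Hd [Hq Hl]]]].
    destruct (Lx2 d Hd) as [N1 H1]. destruct (Ly d Hd) as [N2 H2].
    set (n := Nat.max N1 N2). specialize (H1 n ltac:(lia)). specialize (H2 n ltac:(lia)).
    specialize (Hl _ _ H1 H2). destruct (HT (ph n)) as [_ [_ [A1 [A2 A3]]]]. unfold ph in A1, A2, A3.
    rewrite A2, A3, Cmod_self_sub in Hl. apply A1.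
    assert (E : fst (snd (T (p1 (p2 n)))) - snd (snd (T (p1 (p2 n)))) = 0).
    { apply Cmod_eq_0. pose proof (Cmod_ge_0 (fst (snd (T (p1 (p2 n)))) - snd (snd (T (p1 (p2 n)))))). nra. }
    replace (fst (snd (T (p1 (p2 n))))) with (fst (snd (T (p1 (p2 n)))) - snd (snd (T (p1 (p2 n)))) + snd (snd (T (p1 (p2 n))))) by ring.
    rewrite E. ring.
  - assert (Hts0 : 0 <= ts).
    { assert (b <= 0); [|unfold ts; lra]. apply Hb2. intros s [Hs _]. lra. }
    assert (Hts1 : ts <= 1) by (apply Hlow, S1).
    destruct (Req_dec ts 0) as [Ez|Nz].
    { rewrite Ez, Cmult_0_l in Fx, Fy.
      destruct (Ceq_dec x 0) as [->|nx]; [|exact (F_neq_0 x nx Fx)].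
      destruct (Ceq_dec y 0) as [->|ny]; [apply Nxy; reflexivity | exact (F_neq_0 y ny Fy)]. }
    assert (Pxy : 0 < Cmod (x - y)).
    { apply Cmod_gt_0. intros E. apply Nxy. replace x with (x - y + y) by ring. rewrite E. ring. }
    destruct (local_surj x (Cmod (x - y) / 2)%R ltac:(lra)) as [e1 [He1 Hx]].
    destruct (local_surj y (Cmod (x - y) / 2)%R ltac:(lra)) as [e2 [He2 Hy]].
    pose proof (Cmod_ge_0 w) as Pw.
    set (e := Rmin e1 e2). assert (He : 0 < e) by (apply Rmin_pos; assumption).
    (* The parameter stays nonnegative and the new target lies within reach of both local inverses,
       whose values remain distinct because each moves less than half of [|x - y|]. *)
    set (s := Rmin (ts / 2) (e / (2 * (Cmod w + 1)))).
    assert (Hs : 0 < s) by (apply Rmin_pos; [lra | apply Rdiv_lt_0_compat; lra]).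
    assert (Hs1 : s <= ts / 2) by apply Rmin_l.
    assert (Hs2 : s * Cmod w < e).
    { apply Rle_lt_trans with (e / (2 * (Cmod w + 1)) * (Cmod w + 1))%R.
      - apply Rmult_le_compat; [lra | lra | apply Rmin_r | lra].
      - replace (e / (2 * (Cmod w + 1)) * (Cmod w + 1))%R with (e / 2)%R by (field; lra). lra. }
    assert (Hd : Cmod (RtoC (ts - s) * w - RtoC ts * w) < e).
    { replace (RtoC (ts - s) * w - RtoC ts * w) with (- (RtoC s * w)) by (rewrite RtoC_minus; ring).
      rewrite Cmod_opp, Cmod_mult, Cmod_R, Rabs_right by lra. exact Hs2. }
    destruct (Hx (RtoC (ts - s) * w)) as [x' [X1 X2]].
    { rewrite Fx. eapply Rlt_le_trans; [exact Hd | apply Rmin_l]. }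
    destruct (Hy (RtoC (ts - s) * w)) as [y' [Y1 Y2]].
    { rewrite Fy. eapply Rlt_le_trans; [exact Hd | apply Rmin_r]. }
    assert (Hin : S (ts - s)%R).
    { split; [lra|]. exists x', y'. split; [|split; assumption]. intros E. subst y'.
      pose proof (Cmod_tri_sub x x' y) as Tr. rewrite (Cmod_sub_sym x x') in Tr. lra. }
    specialize (Hlow _ Hin). lra.
Qed.

(** Local surjectivity at [G w] provides a preimage of [x] near [G w]; by injectivity it is [G x],
    so the inverse is continuous. *)
Lemma qc_map_inverse : exists G : C -> C, (forall z, cont_at G z) /\ (forall z, G (F z) = z) /\ (forall w, F (G w) = w).
Proof.
  set (G := fun w => proj1_sig (constructive_indefinite_description _ (qc_map_surj w))).
  assert (FG : forall w, F (G w) = w).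
  { intros w. exact (proj2_sig (constructive_indefinite_description _ (qc_map_surj w))). }
  exists G. split; [|split; [|exact FG]].
  - intros w eps He. destruct (local_surj (G w) eps He) as [eta [Heta H]]. exists eta. split; [exact Heta|].
    intros x Hx. rewrite FG in H. destruct (H x Hx) as [y [Y1 Y2]].
    replace (G x) with y; [exact Y1|]. apply qc_map_inj. rewrite FG. exact Y2.
  - intros z. apply qc_map_inj, FG.
Qed.

(** Otherwise pairs with difference quotients above every integer would have convergent
    subsequences. Boundedness of the increments of [F] forces a common limit, where strict
    differentiability gives a local Lipschitz bound. The result serves the comparison of circles and
    absolute continuity on lines. *)
Lemma qc_map_lipschitz (b : R) : exists K, 0 < K /\
  forall x y, Cmod x <= b -> Cmod y <= b -> Cmod (F x - F y) <= K * Cmod (x - y).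
Proof.
  apply NNPP. intros Hn.
  assert (H : forall n : nat, exists T : C * C, Cmod (fst T) <= b /\ Cmod (snd T) <= b /\
    INR (S n) * Cmod (fst T - snd T) < Cmod (F (fst T) - F (snd T))).
  { intros n. apply NNPP. intros H. apply Hn. exists (INR (S n)). split; [apply lt_0_INR; lia|].
    intros x y Hx Hy. apply Rnot_lt_le. intros Hlt. apply H. exists (x, y). simpl fst; simpl snd. auto. }
  set (T := fun n => proj1_sig (constructive_indefinite_description _ (H n))).
  assert (HT : forall n, Cmod (fst (T n)) <= b /\ Cmod (snd (T n)) <= b /\
    INR (S n) * Cmod (fst (T n) - snd (T n)) < Cmod (F (fst (T n)) - F (snd (T n)))).
  { intros n. exact (proj2_sig (constructive_indefinite_description _ (H n))). }
  clearbody T.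
  destruct (C_bolzano (fun n => fst (T n)) b (fun n => proj1 (HT n))) as [p1 [x [Hp1 Lx]]].
  destruct (C_bolzano (fun n => snd (T (p1 n))) b (fun n => proj1 (proj2 (HT (p1 n))))) as [p2 [y [Hp2 Ly]]].
  pose proof (seq_lim_sub _ _ p2 Hp2 Lx) as Lx2. cbv beta in Lx2.
  assert (Exy : x = y).
  { assert (E : x - y = 0).
    { apply Cmod_eq_0, Rle_antisym; [|apply Cmod_ge_0]. apply Rle_plus_epsilon. intros eps He.
      destruct (Lx2 (eps / 3)%R ltac:(lra)) as [N1 H1]. destruct (Ly (eps / 3)%R ltac:(lra)) as [N2 H2].
      destruct (seq_lim_cont _ _ Lx2 1%R ltac:(lra)) as [N3 H3]. destruct (seq_lim_cont _ _ Ly 1%R ltac:(lra)) as [N4 H4].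
      set (B := (Cmod (F x - F y) + 2)%R). pose proof (Cmod_ge_0 (F x - F y)) as PB.
      destruct (inv_INR_small (eps / (3 * B))%R ltac:(apply Rdiv_lt_0_compat; unfold B; lra)) as [N5 H5].
      set (n := (N1 + N2 + N3 + N4 + N5)%nat).
      specialize (H1 n ltac:(lia)). specialize (H2 n ltac:(lia)). specialize (H3 n ltac:(lia)). specialize (H4 n ltac:(lia)).
      specialize (H5 (p1 (p2 n)) ltac:(specialize (Hp2 n); specialize (Hp1 (p2 n)); lia)).
      destruct (HT (p1 (p2 n))) as [_ [_ A]].
      set (xn := fst (T (p1 (p2 n)))) in *. set (yn := snd (T (p1 (p2 n)))) in *.
      assert (PI' : 0 < INR (S (p1 (p2 n)))) by (apply lt_0_INR; lia).
      assert (A2 : Cmod (F xn - F yn) <= B).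
      { pose proof (Cmod_tri_sub (F xn) (F x) (F yn)). pose proof (Cmod_tri_sub (F x) (F y) (F yn)) as T2.
        rewrite (Cmod_sub_sym (F y) (F yn)) in T2. unfold B. lra. }
      assert (A3 : Cmod (xn - yn) <= eps / 3).
      { apply Rle_trans with (/ INR (S (p1 (p2 n))) * B)%R.
        - apply Rmult_le_reg_l with (INR (S (p1 (p2 n)))); [exact PI'|].
          rewrite <- Rmult_assoc, Rinv_r by lra. lra.
        - apply Rle_trans with (eps / (3 * B) * B)%R; [apply Rmult_le_compat_r; unfold B in *; lra | right; field; unfold B; lra]. }
      pose proof (Cmod_tri_sub x xn y). pose proof (Cmod_tri_sub xn yn y). rewrite (Cmod_sub_sym x xn) in H0. lra. }
    replace x with (x - y + y) by ring. rewrite E. ring. }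
  subst y. destruct (F_strict x) as [A [B [Hs _]]].
  destruct (pair_diff_lipschitz _ _ F A B Hs) as [K [HK [d [Hd Hl]]]].
  destruct (Lx2 d Hd) as [N1 H1]. destruct (Ly d Hd) as [N2 H2].
  destruct (INR_unbounded K) as [N3 H3].
  set (n := (N1 + N2 + N3)%nat). specialize (H1 n ltac:(lia)). specialize (H2 n ltac:(lia)).
  specialize (Hl _ _ I H1 H2). cbv beta in Hl. destruct (HT (p1 (p2 n))) as [_ [_ Q]].
  assert (K <= INR (S (p1 (p2 n)))).
  { left. eapply Rlt_le_trans; [exact H3|]. apply le_INR. specialize (Hp2 n). specialize (Hp1 (p2 n)). lia. }
  pose proof (Cmod_ge_0 (fst (T (p1 (p2 n))) - snd (T (p1 (p2 n))))). nra.
Qed.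

End GlobalHomeomorphism.

Lemma cont_at_continuous (f : C -> C) (z : C) : cont_at f z ->
  continuous (T := C_UniformSpace) (U := C_UniformSpace) f z.
Proof.
  intros H. apply filterlim_locally. intros eps. destruct (H eps (cond_pos eps)) as [d [Hd H1]].
  assert (Hd2 : 0 < d / 2) by lra.
  exists (mkposreal _ Hd2). intros x [B1 B2].
  change (Rabs (fst x - fst z) < d / 2) in B1. change (Rabs (snd x - snd z) < d / 2) in B2.
  assert (Hx : Cmod (x - z) < d).
  { eapply Rle_lt_trans; [apply Cmod_le_add|].
    change (Rabs (fst x - fst z) + Rabs (snd x - snd z) < d). lra. }
  specialize (H1 x Hx). split.
  - change (Rabs (fst (f x) - fst (f z)) < eps). eapply Rle_lt_trans; [|exact H1]. apply (Cmod_fst (f x - f z)).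
  - change (Rabs (snd (f x) - snd (f z)) < eps). eapply Rle_lt_trans; [|exact H1]. apply (Cmod_snd (f x - f z)).
Qed.

(** * Arguments of closed curves and the orientation of the map *)

Lemma cexp_im_plus (s t : R) : cexp (0%R, (s + t)%R) = cexp (0%R, s) * cexp (0%R, t).
Proof. rewrite <- cexp_plus. f_equal. unfold Cplus; simpl. f_equal; ring. Qed.

Lemma Cmod_cexp_im (t : R) : Cmod (cexp (0%R, t)) = 1%R.
Proof. rewrite Cmod_cexp. apply exp_0. Qed.

Lemma polar_rhp (q : C) : 0 < fst q -> q = RtoC (Cmod q) * cexp (0%R, snd (Clog q)).
Proof.
  intros Hq. rewrite <- (cexp_Clog q Hq) at 1 2. rewrite Cmod_cexp.
  unfold cexp, Cmult, RtoC; simpl. rewrite exp_0. f_equal; ring.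
Qed.

Lemma polar (A : C) : A <> 0 -> exists th, A = RtoC (Cmod A) * cexp (0%R, th).
Proof.
  intros HA.
  assert (Hrot : forall th0, 0 < fst (A * cexp (0%R, (- th0)%R))%C -> exists th, A = RtoC (Cmod A) * cexp (0%R, th)).
  { intros th0 Hp. set (q := A * cexp (0%R, (- th0)%R)) in *. exists (snd (Clog q) + th0)%R.
    pose proof (polar_rhp q Hp) as E.
    assert (Em : Cmod q = Cmod A) by (unfold q; rewrite Cmod_mult, Cmod_cexp_im; ring).
    rewrite cexp_im_plus, Cmult_assoc, <- Em, <- E. unfold q. rewrite <- Cmult_assoc, <- cexp_im_plus.
    replace (- th0 + th0)%R with 0%R by ring. change ((0%R, 0%R) : C) with (RtoC 0). rewrite cexp_0. ring. }
  destruct A as [p q].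
  destruct (Rtotal_order p 0) as [Hp|[Hp|Hp]].
  - apply (Hrot PI). unfold cexp, Cmult; simpl. rewrite exp_0, cos_neg, sin_neg, cos_PI, sin_PI. lra.
  - destruct (Rtotal_order q 0) as [Hq|[Hq|Hq]].
    + apply (Hrot (- (PI / 2))%R). unfold cexp, Cmult; simpl.
      rewrite Ropp_involutive, exp_0, cos_PI2, sin_PI2. lra.
    + exfalso. apply HA. subst. reflexivity.
    + apply (Hrot (PI / 2)%R). unfold cexp, Cmult; simpl.
      rewrite exp_0, cos_neg, sin_neg, cos_PI2, sin_PI2. lra.
  - apply (Hrot 0%R). unfold cexp, Cmult; simpl. rewrite Ropp_0, exp_0, cos_0, sin_0. lra.
Qed.

Definition winds_once (V : R -> C) : Prop := exists theta : R -> R,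
  (forall t, continuous theta t) /\ (forall t, V t = RtoC (Cmod (V t)) * cexp (0%R, theta t)) /\
  (theta 1 - theta 0 = 2 * PI)%R.

(** A closed factor in the right half-plane adds its principal argument, which is continuous and
    returns to its starting value; the total increase is unchanged. *)
Lemma winds_once_mult (V q W : R -> C) : winds_once V -> (forall t, curve_cont q t) ->
  (forall t, 0 < fst (q t)) -> q 1%R = q 0%R -> (forall t, W t = V t * q t) -> winds_once W.
Proof.
  intros [th [H1 [H2 H3]]] Hq Hp Hper HW.
  exists (fun t => th t + snd (Clog (q t)))%R. split; [|split].
  - intros t. apply (continuous_plus (V := R_NormedModule) th (fun t => snd (Clog (q t)))); [apply H1|].
    apply (curve_cont_snd (fun t => Clog (q t))). apply (cont_curve_comp Clog q); [apply Clog_cont, Hp | apply Hq].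
  - intros t. rewrite HW, cexp_im_plus, Cmod_mult, RtoC_mult.
    rewrite (H2 t) at 1. rewrite (polar_rhp (q t) (Hp t)) at 1. ring.
  - rewrite Hper. lra.
Qed.

Lemma fst_pos_near_1 (q : C) : Cmod (q - 1) < 1 -> 0 < fst q.
Proof.
  intros H. pose proof (Cmod_fst (q - 1)) as F. change (Rabs (fst q - 1) <= Cmod (q - 1)) in F.
  apply Rabs_le_between in F. lra.
Qed.

Lemma cexp_2PI_cont (t : R) : curve_cont (fun s => cexp (0%R, (2 * PI * s)%R)) t.
Proof.
  pose proof (curve_deriv_segment 0 (Ci * RtoC (2 * PI)) t) as D.
  apply curve_deriv_cont in D.
  intros eps He. destruct (holo_at_cont _ _ _ (holo_at_cexp (0 + RtoC t * (Ci * RtoC (2 * PI)))) eps He) as [d [Hd H]].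
  destruct (D d Hd) as [d' [Hd' H']]. exists d'. split; [exact Hd'|]. intros s Hs.
  assert (E : forall s, cexp (0%R, (2 * PI * s)%R) = cexp (0 + RtoC s * (Ci * RtoC (2 * PI)))).
  { intros x. f_equal. unfold Ci, Cplus, Cmult, RtoC; simpl. f_equal; ring. }
  rewrite !E. apply H, H', Hs.
Qed.

Section SensePreserving.

Variables (F : C -> C) (k m m0 : R).
Hypothesis Hk : 0 <= k < 1.
Hypothesis F_strict : forall z, exists A B, pair_diff anypair F z A B /\ A <> 0 /\ Cmod B <= k * Cmod A.
Hypothesis Hm : 0 < m.
Hypothesis F_proper : forall z, m * Cmod z - m0 <= Cmod (F z).
Hypothesis F_neq_0 : forall z : C, z <> 0 -> F z <> 0.

Let circle_diff (z0 : C) (r t : R) : C := F (z0 + RtoC r * cexp (0%R, (2 * PI * t)%R)) - F z0.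

Lemma circle_diff_cont (z0 : C) (r t : R) : curve_cont (circle_diff z0 r) t.
Proof.
  apply curve_cont_minus; [|apply curve_cont_const].
  apply (cont_curve_comp F (fun t => z0 + RtoC r * cexp (0%R, (2 * PI * t)%R))); [apply (qc_map_cont F k F_strict)|].
  intros eps He. destruct (curve_cont_mult _ _ t (curve_cont_const (RtoC r) t) (cexp_2PI_cont t) eps He) as [d [Hd H]].
  exists d. split; [exact Hd|]. intros s Hs. specialize (H s Hs).
  replace (z0 + RtoC r * cexp (0%R, (2 * PI * s)%R) - (z0 + RtoC r * cexp (0%R, (2 * PI * t)%R)))
    with (RtoC r * cexp (0%R, (2 * PI * s)%R) - RtoC r * cexp (0%R, (2 * PI * t)%R)) by ring. exact H.
Qed.

Lemma cexp_2PI_periodic : cexp (0%R, (2 * PI * 1)%R) = cexp (0%R, (2 * PI * 0)%R).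
Proof.
  unfold cexp; simpl. rewrite Rmult_1_r, Rmult_0_r, cos_2PI, sin_2PI, cos_0, sin_0. reflexivity.
Qed.

Lemma circle_diff_closed (z0 : C) (r : R) : circle_diff z0 r 1%R = circle_diff z0 r 0%R.
Proof. unfold circle_diff. rewrite cexp_2PI_periodic. reflexivity. Qed.

Lemma curve_cont_inv (q : R -> C) (t : R) : q t <> 0 -> curve_cont q t -> curve_cont (fun s => / q s) t.
Proof. intros Hn Hq. apply (cont_curve_comp Cinv q); [eapply holo_at_cont, holo_at_inv, Hn | exact Hq]. Qed.

(** With [h = z - z0], the increment of [F] is [A h] times a factor whose distance from 1 is at most
    [k + (1 - k)/2 < 1]. So it winds like [A h]. *)
Lemma small_circle (z0 : C) : exists r0, 0 < r0 /\ forall r, 0 < r < r0 -> winds_once (circle_diff z0 r).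
Proof.
  destruct (F_strict z0) as [A [B [H [HA HB]]]]. pose proof (proj1 (Cmod_gt_0 A) HA) as PA.
  set (e := ((1 - k) * Cmod A / 2)%R). assert (He : 0 < e) by (unfold e; nra).
  destruct (H e He) as [d [Hd Hst]]. exists d. split; [exact Hd|]. intros r Hr.
  destruct (polar A HA) as [th Hth].
  set (E := fun t => cexp (0%R, (2 * PI * t)%R)).
  assert (HE : forall t, E t <> 0) by (intros; apply cexp_neq_0).
  assert (Hrc : RtoC r <> 0) by (intros Er; apply (f_equal fst) in Er; simpl in Er; lra).
  set (V := fun t => A * (RtoC r * E t)).
  assert (HV : forall t, V t <> 0) by (intros t; unfold V; repeat apply Cmult_neq_0; auto).
  assert (VC : forall t, curve_cont V t).
  { intros t. apply curve_cont_mult; [apply curve_cont_const|]. apply curve_cont_mult; [apply curve_cont_const | apply cexp_2PI_cont]. }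
  apply (winds_once_mult V (fun t => circle_diff z0 r t * / V t)).
  - exists (fun t => th + 2 * PI * t)%R. split; [|split].
    + intros t. apply (continuous_plus (V := R_NormedModule) (fun _ => th) (fun t => 2 * PI * t)%R).
      * apply continuous_const.
      * apply (continuous_scal_r (V := R_NormedModule) (2 * PI)%R (fun t => t)). apply continuous_id.
    + intros t. unfold V. rewrite cexp_im_plus, !Cmod_mult, Cmod_R, Rabs_right by lra. unfold E. rewrite Cmod_cexp_im.
      rewrite Hth at 1. rewrite !RtoC_mult. ring.
    + ring.
  - intros t. apply curve_cont_mult; [apply circle_diff_cont | apply curve_cont_inv; auto].
  - intros t. apply fst_pos_near_1.
    set (h := RtoC r * E t).
    assert (Mh : Cmod h = r) by (unfold h, E; rewrite Cmod_mult, Cmod_R, Cmod_cexp_im, Rabs_right; lra).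
    specialize (Hst (z0 + h) z0 I). cbv beta in Hst.
    replace (z0 + h - z0) with h in Hst by ring. specialize (Hst ltac:(lra) ltac:(rewrite Cmod_self_sub; lra)).
    change (circle_diff z0 r t) with (F (z0 + h) - F z0). change (V t) with (A * h).
    assert (Hh : h <> 0) by (apply Cmult_neq_0; auto).
    assert (HAh : A * h <> 0) by (apply Cmult_neq_0; auto).
    replace ((F (z0 + h) - F z0) * / (A * h) - 1) with
      (((F (z0 + h) - F z0 - A * h - B * Cconj h) + B * Cconj h) / (A * h)) by (field; split; assumption).
    rewrite Cmod_div, Cmod_mult, Mh by exact HAh.
    apply Rmult_lt_reg_r with (Cmod A * r)%R; [nra|]. unfold Rdiv. rewrite Rmult_assoc, Rinv_l by nra.
    rewrite Rmult_1_r, Rmult_1_l. eapply Rle_lt_trans; [apply Cmod_triangle|].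
    rewrite Cmod_mult, Cmod_conj, Mh. rewrite Mh in Hst. unfold e in Hst.
    pose proof (Rmult_le_compat_r r _ _ ltac:(lra) HB).
    assert (0 < (1 - k) * Cmod A * r) by (repeat apply Rmult_lt_0_compat; lra). lra.
  - rewrite circle_diff_closed. f_equal. f_equal. unfold V, E. rewrite cexp_2PI_periodic. reflexivity.
  - intros t. field. apply HV.
Qed.

(** The radius grows from a small circle in finitely many equal steps. The image curve keeps a
    distance [mu] from [F z0] and moves by less than [mu] per step, so consecutive curves differ by
    a factor within 1 of the constant 1. *)
Lemma circle_winds (z0 : C) (r : R) : 0 < r -> winds_once (circle_diff z0 r).
Proof.
  intros Hr. destruct (small_circle z0) as [r0 [Hr0 Hsmall]].
  destruct (Rlt_le_dec r r0) as [Hlt|Hge]; [apply Hsmall; lra|].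
  set (r1 := (r0 / 2)%R).
  destruct (qc_map_inverse F k m m0 Hk F_strict Hm F_proper F_neq_0) as [G [Gc [GF FG]]].
  (* Continuity of the inverse at [F z0]: values within [mu] of [F z0] come only from points within
     [r1] of [z0]. *)
  destruct (Gc (F z0) r1 ltac:(unfold r1; lra)) as [mu [Hmu Hinv]]. rewrite GF in Hinv.
  destruct (qc_map_lipschitz F k F_strict (Cmod z0 + r)) as [K [HK Hlip]].
  assert (Hlow : forall s t, r1 <= s -> mu <= Cmod (circle_diff z0 s t)).
  { intros s t Hs. apply Rnot_lt_le. intros Hc. unfold circle_diff in Hc. specialize (Hinv _ Hc).
    rewrite GF in Hinv. replace (z0 + RtoC s * cexp (0%R, (2 * PI * t)%R) - z0) with (RtoC s * cexp (0%R, (2 * PI * t)%R)) in Hinv by ring.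
    rewrite Cmod_mult, Cmod_R, Cmod_cexp_im, Rabs_right in Hinv by (unfold r1 in Hs; lra). lra. }
  assert (Hstep : forall s s', r1 <= s <= r -> r1 <= s' <= r -> Rabs (s' - s) < mu / K ->
     winds_once (circle_diff z0 s) -> winds_once (circle_diff z0 s')).
  { intros s s' Hs Hs' Hd Hw.
    assert (Hn : forall t, circle_diff z0 s t <> 0).
    { intros t. apply Cmod_gt_0. specialize (Hlow s t (proj1 Hs)). lra. }
    apply (winds_once_mult (circle_diff z0 s) (fun t => circle_diff z0 s' t * / circle_diff z0 s t)).
    - exact Hw.
    - intros t. apply curve_cont_mult; [apply circle_diff_cont|]. apply curve_cont_inv; [apply Hn | apply circle_diff_cont].
    - intros t. apply fst_pos_near_1.
      replace (circle_diff z0 s' t * / circle_diff z0 s t - 1) with ((circle_diff z0 s' t - circle_diff z0 s t) / circle_diff z0 s t)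
        by (field; apply Hn).
      rewrite Cmod_div by apply Hn. specialize (Hlow s t (proj1 Hs)).
      apply Rmult_lt_reg_r with (Cmod (circle_diff z0 s t)); [lra|].
      unfold Rdiv. rewrite Rmult_assoc, Rinv_l, Rmult_1_r, Rmult_1_l by lra.
      eapply Rlt_le_trans; [|exact Hlow].
      set (E := cexp (0%R, (2 * PI * t)%R)).
      assert (ME : Cmod E = 1%R) by apply Cmod_cexp_im.
      unfold circle_diff. fold E.
      replace (F (z0 + RtoC s' * E) - F z0 - (F (z0 + RtoC s * E) - F z0)) with (F (z0 + RtoC s' * E) - F (z0 + RtoC s * E)) by ring.
      assert (Hball : forall x, r1 <= x <= r -> Cmod (z0 + RtoC x * E) <= Cmod z0 + r).
      { intros x Hx. eapply Rle_trans; [apply Cmod_triangle|]. rewrite Cmod_mult, Cmod_R, ME, Rabs_right by (unfold r1 in Hx; lra). lra. }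
      eapply Rle_lt_trans; [apply Hlip; apply Hball; assumption|].
      replace (z0 + RtoC s' * E - (z0 + RtoC s * E)) with (RtoC (s' - s) * E) by (rewrite RtoC_minus; ring).
      rewrite Cmod_mult, Cmod_R, ME, Rmult_1_r.
      apply (Rmult_lt_compat_l K) in Hd; [|exact HK]. replace (K * (mu / K))%R with mu in Hd by (field; lra). exact Hd.
    - rewrite !circle_diff_closed. reflexivity.
    - intros t. field. apply Hn. }
  set (h := (mu / (2 * K))%R). assert (Hh : 0 < h) by (apply Rdiv_lt_0_compat; lra).
  assert (Hhh : h < mu / K).
  { unfold h. replace (mu / (2 * K))%R with (mu / K / 2)%R by (field; lra).
    assert (0 < mu / K) by (apply Rdiv_lt_0_compat; lra). lra. }
  assert (Hr1 : 0 < r1 < r0 /\ r1 <= r) by (unfold r1; lra).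
  assert (Hind : forall n : nat, winds_once (circle_diff z0 (Rmin r (r1 + INR n * h)))).
  { induction n as [|n IH].
    - simpl INR. rewrite Rmult_0_l, Rplus_0_r, Rmin_right by lra. apply Hsmall. lra.
    - assert (P : 0 <= INR n * h) by (apply Rmult_le_pos; [apply pos_INR | lra]).
      rewrite S_INR. revert IH. apply Hstep.
      + split; [apply Rmin_glb; lra | apply Rmin_l].
      + split; [apply Rmin_glb; nra | apply Rmin_l].
      + unfold Rmin. destruct (Rle_dec r (r1 + (INR n + 1) * h)), (Rle_dec r (r1 + INR n * h)); apply Rabs_def1; nra. }
  destruct (INR_unbounded ((r - r1) / h)) as [n Hn]. specialize (Hind n).
  rewrite Rmin_left in Hind; [exact Hind|].
  apply (Rmult_lt_compat_r h) in Hn; [|exact Hh].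
  replace ((r - r1) / h * h)%R with (r - r1)%R in Hn by (field; lra). lra.
Qed.

Lemma qc_map_sense_preserving : sense_preserving F.
Proof.
  intros z0 r Hr. destruct (circle_winds z0 r Hr) as [th [H1 [H2 H3]]].
  exists th. split; [exact H1|]. split; [|exact H3]. intros t _. exact (H2 t).
Qed.

Lemma qc_map_homeomorphism : homeomorphism_C F.
Proof.
  destruct (qc_map_inverse F k m m0 Hk F_strict Hm F_proper F_neq_0) as [G [Gc [GF FG]]].
  exists G. split; [|split; [|split; assumption]]; intros z; apply cont_at_continuous; [apply (qc_map_cont F k F_strict) | apply Gc].
Qed.

(** * Partial derivatives, dilatation and absolute continuity on lines *)

Lemma curve_partial (W : R -> C) (t : R) (A B l : C) : pair_diff anypair F (W t) A B -> curve_deriv W t l ->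
  curve_deriv (fun s => F (W s)) t (A * l + B * Cconj l).
Proof.
  intros HF HW.
  assert (Hr : ev_pair (curve_rel t) t (fun x y => anypair (W (fst x)) (W (fst y)))).
  { exists 1%R. split; [lra|]. intros; exact I. }
  pose proof (pair_diff_comp _ _ (curve_rel_based t) anypair _ _ _ _ _ _ HW HF Hr) as H. simpl in H.
  intros eps He. destruct (H eps He) as [d [Hd H1]]. exists d. split; [exact Hd|].
  intros x y Hxy Hx Hy. specialize (H1 x y Hxy Hx Hy). destruct Hxy as [Hx0 ->].
  assert (Ec : Cconj (x - RtoC t) = x - RtoC t).
  { destruct x as [x1 x2]. simpl in Hx0. subst x2. unfold Cconj, Cminus, Cplus, Copp, RtoC; simpl. f_equal; ring. }
  rewrite Ec in *. rewrite Cconj_RtoC in H1.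
  replace (F (W (fst x)) - F (W (fst (RtoC t))) - (A * l + B * Cconj l) * (x - RtoC t) - 0 * (x - RtoC t))
    with (F (W (fst x)) - F (W t) - (A * l + B * 0) * (x - RtoC t) - (A * 0 + B * Cconj l) * (x - RtoC t)) by (simpl; ring).
  exact H1.
Qed.

(** The chain rule along the coordinate lines gives [F_x = A + B] and [F_y = i (A - B)], so the two
    combinations in the definition are [2 B] and [2 A]. *)
Lemma qc_map_dilatation (K : R) (z : C) : k <= K -> dilatation_bound_at K F z.
Proof.
  intros HkK. destruct (F_strict z) as [A [B [H [HA HB]]]]. exists (A + B), (Ci * (A - B)).
  assert (Ecx : forall x, (x, snd z) = (0%R, snd z) + RtoC x * 1) by (intros; unfold Cplus, Cmult, RtoC; simpl; f_equal; ring).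
  assert (Ecy : forall y, (fst z, y) = RtoC (fst z) + RtoC y * Ci) by (intros; unfold Ci, Cplus, Cmult, RtoC; simpl; f_equal; ring).
  split; [|split].
  - apply curve_deriv_iff.
    apply (curve_deriv_eq _ _ (A * 1 + B * Cconj 1)); [|rewrite Cconj_RtoC; ring].
    apply (curve_partial (fun x => (x, snd z))).
    + destruct z. exact H.
    + apply (pair_diff_eq _ _ _ _ _ _ _ _ (curve_deriv_segment (0%R, snd z) 1 (fst z))); try reflexivity.
      exists 1%R. split; [lra|]. intros x y _ _ _. split; symmetry; apply Ecx.
  - apply curve_deriv_iff.
    assert (Eci : Cconj Ci = - Ci) by (unfold Cconj, Ci, Copp; simpl; f_equal; ring).
    apply (curve_deriv_eq _ _ (A * Ci + B * Cconj Ci)); [|rewrite Eci; ring].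
    apply (curve_partial (fun y => (fst z, y))).
    + destruct z. exact H.
    + apply (pair_diff_eq _ _ _ _ _ _ _ _ (curve_deriv_segment (RtoC (fst z)) Ci (snd z))); try reflexivity.
      exists 1%R. split; [lra|]. intros x y _ _ _. split; symmetry; apply Ecy.
  - change (Cmod (A + B + Ci * (Ci * (A - B))) <= K * Cmod (A + B - Ci * (Ci * (A - B)))).
    assert (Ei : Ci * Ci = - (1)) by (unfold Ci, Cmult, Copp, RtoC; simpl; f_equal; ring).
    replace (A + B + Ci * (Ci * (A - B))) with (A + B + (Ci * Ci) * (A - B)) by ring.
    replace (A + B - Ci * (Ci * (A - B))) with (A + B - (Ci * Ci) * (A - B)) by ring.
    rewrite Ei. replace (A + B + - (1) * (A - B)) with (2 * B) by ring. replace (A + B - - (1) * (A - B)) with (2 * A) by ring.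
    rewrite !Cmod_mult, Cmod_R, Rabs_right by lra. pose proof (Cmod_ge_0 A). nra.
Qed.

Lemma abs_cont_lipschitz (a b K : R) (phi : R -> C) : 0 < K ->
  (forall s t, a <= s <= b -> a <= t <= b -> Cmod (phi s - phi t) <= K * Rabs (s - t)) -> abs_cont_on a b phi.
Proof.
  intros HK Hl eps He. exists (eps / K)%R. split; [apply Rdiv_lt_0_compat; assumption|].
  intros l Hin _ Hsum.
  assert (B : sum_list (List.map (fun p => Cmod (phi (snd p) - phi (fst p))) l) <=
     K * sum_list (List.map (fun p => (snd p - fst p)%R) l)).
  { clear Hsum. induction l as [|p l IH]; simpl; [lra|].
    pose proof (Hin 0%nat ltac:(simpl; lia)) as Hp. simpl in Hp.
    assert (IH' := IH (fun i Hi => Hin (S i) ltac:(simpl; lia))).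
    pose proof (Hl (snd p) (fst p) ltac:(lra) ltac:(lra)) as L. rewrite Rabs_right in L by lra. lra. }
  apply (Rmult_lt_compat_l K) in Hsum; [|exact HK]. replace (K * (eps / K))%R with eps in Hsum by (field; lra). lra.
Qed.

Lemma qc_map_abs_cont_horizontal (y a b : R) : abs_cont_on a b (fun x => F (x, y)).
Proof.
  destruct (qc_map_lipschitz F k F_strict (Rabs a + Rabs b + Rabs y)) as [K [HK H]].
  apply abs_cont_lipschitz with K; [exact HK|]. intros s t Hs Ht.
  assert (Hb : forall x, a <= x <= b -> Cmod (x, y) <= Rabs a + Rabs b + Rabs y).
  { intros x Hx. eapply Rle_trans; [apply Cmod_le_add|]. simpl.
    assert (Rabs x <= Rabs a + Rabs b); [|lra]. apply Rabs_le.
    pose proof (Rle_abs b). pose proof (Rle_abs (- a)) as T. rewrite Rabs_Ropp in T.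
    pose proof (Rabs_pos a). pose proof (Rabs_pos b). lra. }
  eapply Rle_trans; [apply H; apply Hb; assumption|].
  replace ((s, y) - (t, y)) with (RtoC (s - t)) by (unfold RtoC, Cminus, Cplus, Copp; simpl; f_equal; ring).
  rewrite Cmod_R. lra.
Qed.

Lemma qc_map_abs_cont_vertical (x a b : R) : abs_cont_on a b (fun y => F (x, y)).
Proof.
  destruct (qc_map_lipschitz F k F_strict (Rabs a + Rabs b + Rabs x)) as [K [HK H]].
  apply abs_cont_lipschitz with K; [exact HK|]. intros s t Hs Ht.
  assert (Hb : forall y, a <= y <= b -> Cmod (x, y) <= Rabs a + Rabs b + Rabs x).
  { intros y Hy. eapply Rle_trans; [apply Cmod_le_add|]. simpl.
    assert (Rabs y <= Rabs a + Rabs b); [|lra]. apply Rabs_le.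
    pose proof (Rle_abs b). pose proof (Rle_abs (- a)) as T. rewrite Rabs_Ropp in T.
    pose proof (Rabs_pos a). pose proof (Rabs_pos b). lra. }
  eapply Rle_trans; [apply H; apply Hb; assumption|].
  replace ((x, s) - (x, t)) with (RtoC (s - t) * Ci) by (unfold Ci, RtoC, Cminus, Cmult, Cplus, Copp; simpl; f_equal; ring).
  rewrite Cmod_mult, Cmod_R, Cmod_Ci. lra.
Qed.

End SensePreserving.

(** * The extension to the closed disk *)

Definition rel_in (x y : C) : Prop := Cmod x <= 1 /\ Cmod y <= 1.
Definition rel_out (x y : C) : Prop := 1 <= Cmod x /\ 1 <= Cmod y.

Lemma segment_crosses_circle (x y : C) : Cmod x <= 1 -> 1 <= Cmod y ->
  exists t : R, 0 <= t <= 1 /\ Cmod (x + RtoC t * (y - x)) = 1%R.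
Proof.
  intros Hx Hy.
  destruct (IVT_gen (fun t => Cmod (x + RtoC t * (y - x))) 0 1 1) as [t [Ht E]].
  - intros t. apply continuity_pt_filterlim, filterlim_locally. intros eps.
    destruct (curve_deriv_cont _ _ _ (curve_deriv_segment x (y - x) t) eps (cond_pos eps)) as [d [Hd H]].
    exists (mkposreal d Hd). intros s Hs. specialize (H s Hs).
    change (Rabs (Cmod (x + RtoC s * (y - x)) - Cmod (x + RtoC t * (y - x))) < eps).
    pose proof (Cmod_ge_sub (x + RtoC s * (y - x)) (x + RtoC t * (y - x))).
    pose proof (Cmod_ge_sub (x + RtoC t * (y - x)) (x + RtoC s * (y - x))) as H1.
    rewrite Cmod_sub_sym in H1. apply Rabs_def1; lra.
  - replace (x + RtoC 0 * (y - x)) with x by ring. replace (x + RtoC 1 * (y - x)) with y by ring.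
    rewrite Rmin_left, Rmax_right by lra. lra.
  - rewrite Rmin_left, Rmax_right in Ht by lra. exists t. split; [exact Ht | exact E].
Qed.

(* A pair separated by the unit circle is split at a crossing point of its segment. *)
Lemma pair_diff_glue (F : C -> C) (z A B : C) :
  pair_diff rel_in F z A B -> pair_diff rel_out F z A B -> pair_diff anypair F z A B.
Proof.
  intros Hi Ho eps He. destruct (Hi eps He) as [d1 [Hd1 H1]]. destruct (Ho eps He) as [d2 [Hd2 H2]].
  set (R := fun x y => F x - F y - A * (x - y) - B * Cconj (x - y)).
  set (d := Rmin d1 d2). assert (Hd : 0 < d) by (apply Rmin_pos; assumption).
  assert (D1 : d <= d1) by apply Rmin_l. assert (D2 : d <= d2) by apply Rmin_r.
  assert (Hc : forall x y, Cmod x <= 1 -> 1 <= Cmod y -> Cmod (x - z) < d -> Cmod (y - z) < d ->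
     Cmod (R x y) <= eps * Cmod (x - y)).
  { intros x y Hx Hy Dx Dy. destruct (segment_crosses_circle x y Hx Hy) as [t [Ht Ep]].
    set (p := x + RtoC t * (y - x)) in *.
    assert (Dp : Cmod (p - z) < d) by (apply ball_convex; assumption).
    assert (Ip : Cmod p <= 1) by lra. assert (Op : 1 <= Cmod p) by lra.
    pose proof (H1 x p (conj Hx Ip) ltac:(lra) ltac:(lra)) as B1.
    pose proof (H2 p y (conj Op Hy) ltac:(lra) ltac:(lra)) as B2. cbv beta in B1, B2.
    assert (E : R x y = R x p + R p y).
    { unfold R. replace (x - y) with ((x - p) + (p - y)) by ring. rewrite Cplus_conj. ring. }
    assert (L1 : Cmod (x - p) = (t * Cmod (x - y))%R).
    { replace (x - p) with (RtoC t * (x - y)) by (unfold p; ring). rewrite Cmod_mult, Cmod_R, Rabs_right; lra. }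
    assert (L2 : Cmod (p - y) = ((1 - t) * Cmod (x - y))%R).
    { replace (p - y) with (RtoC (1 - t) * (x - y)) by (unfold p; rewrite RtoC_minus; ring). rewrite Cmod_mult, Cmod_R, Rabs_right; lra. }
    rewrite E. eapply Rle_trans; [apply Cmod_triangle|]. unfold R. rewrite L1 in B1. rewrite L2 in B2. lra. }
  exists d. split; [exact Hd|]. intros x y _ Dx Dy. change (Cmod (R x y) <= eps * Cmod (x - y)).
  destruct (Rle_lt_dec (Cmod x) 1) as [Ix|Ox]; destruct (Rle_lt_dec (Cmod y) 1) as [Iy|Oy].
  - apply H1; [split; assumption | lra | lra].
  - apply Hc; lra.
  - assert (E : R x y = - R y x).
    { unfold R. replace (x - y) with (- (y - x)) by ring. rewrite Copp_conj. ring. }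
    rewrite E, Cmod_opp, (Cmod_sub_sym x). apply Hc; lra.
  - apply H2; [split; lra | lra | lra].
Qed.

(** At a zero of [g] the second factor need only be Lipschitz: every term containing an increment of
    [h] also carries [g y] or [g x - g y]. On the unit circle this applies to [B] and the boundary
    values of [Q]. *)
Lemma pair_diff_mult_vanishing (rel : C -> C -> Prop) (g h : C -> C) (z A B : C) (K : R) : based rel z ->
  pair_diff rel g z A B -> g z = 0 -> 0 < K ->
  (forall x y, rel x y -> Cmod (h x - h y) <= K * Cmod (x - y)) ->
  pair_diff rel (fun x => g x * h x) z (A * h z) (B * h z).
Proof.
  intros Hb Hg Hg0 HK Hh eps He.
  destruct (pair_diff_lipschitz rel z g A B Hg) as [N [HN HNl]].
  pose proof (Cmod_ge_0 (h z)) as Ph.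
  set (q := (Cmod (h z) + N * K + K + 1)%R).
  assert (PNK : 0 < N * K) by (apply Rmult_lt_0_compat; assumption).
  assert (Hq : 0 < q) by (unfold q; lra).
  set (e := Rmin 1 (eps / q)). assert (He' : 0 < e) by (apply Rmin_pos; [lra | apply Rdiv_lt_0_compat; assumption]).
  assert (Heq : e * q <= eps).
  { apply Rle_trans with (eps / q * q)%R; [apply Rmult_le_compat_r; [lra | apply Rmin_r] | right; field; lra]. }
  destruct (ev_pair_and _ _ _ _ HNl (ev_pair_and _ _ _ _ (Hg e He') (pair_diff_lim rel z Hb g A B Hg e He'))) as [d [Hd H]].
  exists (Rmin d e). split; [apply Rmin_pos; assumption|]. intros x y Hxy Hx Hy.
  pose proof (Rmin_l d e). pose proof (Rmin_r d e).
  destruct (H x y Hxy ltac:(lra) ltac:(lra)) as [B1 [B2 [_ B3]]]. rewrite Hg0 in B3. replace (g y - 0) with (g y) in B3 by ring.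
  destruct (Hb x y Hxy) as [Rx Ry].
  pose proof (Hh x y Hxy) as C1. pose proof (Hh x z Rx) as C2.
  set (r := g x - g y - A * (x - y) - B * Cconj (x - y)) in *.
  replace (g x * h x - g y * h y - A * h z * (x - y) - B * h z * Cconj (x - y)) with
    (r * h z + ((g x - g y) * (h x - h z) + g y * (h x - h y))) by (unfold r; ring).
  eapply Rle_trans; [apply Cmod_triangle|]. eapply Rle_trans; [apply Rplus_le_compat_l, Cmod_triangle|].
  rewrite !Cmod_mult. pose proof (Cmod_ge_0 (x - y)) as P0.
  assert (T1 : Cmod r * Cmod (h z) <= e * Cmod (x - y) * Cmod (h z)) by (apply Rmult_le_compat_r; assumption).
  assert (C2' : Cmod (h x - h z) <= K * e) by (eapply Rle_trans; [exact C2|]; apply Rmult_le_compat_l; lra).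
  assert (T2 : Cmod (g x - g y) * Cmod (h x - h z) <= N * Cmod (x - y) * (K * e))
    by (apply Rmult_le_compat; try apply Cmod_ge_0; assumption).
  assert (T3 : Cmod (g y) * Cmod (h x - h y) <= e * (K * Cmod (x - y)))
    by (apply Rmult_le_compat; try apply Cmod_ge_0; assumption).
  apply Rle_trans with (e * q * Cmod (x - y))%R; [|apply Rmult_le_compat_r; assumption].
  unfold q. assert (0 <= e * Cmod (x - y)) by nra. lra.
Qed.

(** Radii tending to 1; the double successor makes them start at [1/2], so that all are positive. *)
Definition rho (n : nat) : R := (1 - / INR (S (S n)))%R.

Lemma rho_range (n : nat) : 0 < rho n < 1.
Proof.
  unfold rho. assert (1 < INR (S (S n))) by (rewrite !S_INR; pose proof (pos_INR n); lra).
  assert (0 < / INR (S (S n))) by (apply Rinv_0_lt_compat; lra).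
  assert (/ INR (S (S n)) < 1) by (rewrite <- Rinv_1; apply Rinv_lt_contravar; lra). lra.
Qed.

Lemma rho_disk (n : nat) (z : C) : Cmod z <= 1 -> disk (RtoC (rho n) * z).
Proof.
  intros Hz. unfold disk. pose proof (rho_range n). rewrite Cmod_mult, Cmod_R, Rabs_right by lra.
  pose proof (Cmod_ge_0 z). nra.
Qed.

Lemma rho_lim (z : C) : seq_lim (fun n => RtoC (rho n) * z) z.
Proof.
  intros eps He. pose proof (Cmod_ge_0 z) as Pz.
  destruct (inv_INR_small (eps / (Cmod z + 1))%R ltac:(apply Rdiv_lt_0_compat; lra)) as [N HN].
  exists N. intros n Hn. specialize (HN (S n) ltac:(lia)).
  replace (RtoC (rho n) * z - z) with (- (RtoC (/ INR (S (S n))) * z)) by (unfold rho; rewrite RtoC_minus; ring).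
  assert (P : 0 < / INR (S (S n))) by (apply Rinv_0_lt_compat, lt_0_INR; lia).
  rewrite Cmod_opp, Cmod_mult, Cmod_R, Rabs_right by lra.
  apply (Rmult_lt_compat_r (Cmod z + 1)) in HN; [|lra].
  replace (eps / (Cmod z + 1) * (Cmod z + 1))%R with eps in HN by (field; lra). lra.
Qed.

(** Radial limits, taken along the same radii at every point, so that inequalities between several
    values pass to the closed disk term by term. *)
Lemma closed_disk_extension (u : C -> C) (K : R) : 0 < K ->
  (forall x y, disk x -> disk y -> Cmod (u x - u y) <= K * Cmod (x - y)) ->
  exists U, (forall z, disk z -> U z = u z) /\ (forall z, Cmod z <= 1 -> seq_lim (fun n => u (RtoC (rho n) * z)) (U z)).
Proof.
  intros HK Hu.
  assert (H : forall z, exists l, (disk z -> l = u z) /\ (Cmod z <= 1 -> seq_lim (fun n => u (RtoC (rho n) * z)) l)).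
  { intros z. destruct (Rle_lt_dec (Cmod z) 1) as [Hz|Hz].
    (* Outside the closed disk the value 0 is a placeholder. *)
    2:{ exists 0. unfold disk. split; intros; exfalso; lra. }
    destruct (Rlt_le_dec (Cmod z) 1) as [Hz1|Hz1].
    - exists (u z). split; [reflexivity|]. intros _ eps He.
      destruct (rho_lim z (eps / K)%R ltac:(apply Rdiv_lt_0_compat; assumption)) as [N HN]. exists N. intros n Hn.
      specialize (HN n Hn). eapply Rle_lt_trans; [apply Hu; [apply rho_disk, Hz | exact Hz1]|].
      apply (Rmult_lt_compat_l K) in HN; [|exact HK]. replace (K * (eps / K))%R with eps in HN by (field; lra). exact HN.
    - destruct (C_complete (fun n => u (RtoC (rho n) * z))) as [l Hl].
      { intros eps He. destruct (rho_lim z (eps / (2 * K))%R ltac:(apply Rdiv_lt_0_compat; lra)) as [N HN].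
        exists N. intros n p Hn Hp. pose proof (HN n Hn) as A1. pose proof (HN p Hp) as A2.
        eapply Rle_lt_trans; [apply Hu; apply rho_disk, Hz|].
        pose proof (Cmod_tri_sub (RtoC (rho n) * z) z (RtoC (rho p) * z)) as T.
        rewrite (Cmod_sub_sym z (RtoC (rho p) * z)) in T.
        assert (T2 : Cmod (RtoC (rho n) * z - RtoC (rho p) * z) < eps / K).
        { replace (eps / K)%R with (eps / (2 * K) + eps / (2 * K))%R by (field; lra). lra. }
        apply (Rmult_lt_compat_l K) in T2; [|exact HK]. replace (K * (eps / K))%R with eps in T2 by (field; lra). exact T2. }
      exists l. split; [unfold disk; intros; exfalso; lra | intros _; exact Hl]. }
  exists (fun z => proj1_sig (constructive_indefinite_description _ (H z))).
  split; intros z; apply (proj2_sig (constructive_indefinite_description _ (H z))).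
Qed.

Lemma seq_lim_minus (u v : nat -> C) (l l' : C) : seq_lim u l -> seq_lim v l' -> seq_lim (fun n => u n - v n) (l - l').
Proof.
  intros Hu Hv eps He. destruct (Hu (eps / 2)%R ltac:(lra)) as [N1 H1]. destruct (Hv (eps / 2)%R ltac:(lra)) as [N2 H2].
  exists (Nat.max N1 N2). intros n Hn. specialize (H1 n ltac:(lia)). specialize (H2 n ltac:(lia)).
  replace (u n - v n - (l - l')) with ((u n - l) + - (v n - l')) by ring.
  eapply Rle_lt_trans; [apply Cmod_triangle|]. rewrite Cmod_opp. lra.
Qed.

Lemma seq_lim_scal (q : C) (u : nat -> C) (l : C) : seq_lim u l -> seq_lim (fun n => q * u n) (q * l).
Proof.
  intros Hu eps He. pose proof (Cmod_ge_0 q).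
  destruct (Hu (eps / (Cmod q + 1))%R ltac:(apply Rdiv_lt_0_compat; lra)) as [N HN]. exists N. intros n Hn.
  specialize (HN n Hn). replace (q * u n - q * l) with (q * (u n - l)) by ring. rewrite Cmod_mult.
  apply (Rmult_lt_compat_r (Cmod q + 1)) in HN; [|lra].
  replace (eps / (Cmod q + 1) * (Cmod q + 1))%R with eps in HN by (field; lra).
  pose proof (Cmod_ge_0 (u n - l)). lra.
Qed.

Lemma seq_lim_const (l : C) : seq_lim (fun _ => l) l.
Proof. intros eps He. exists 0%nat. intros n _. rewrite Cmod_self_sub. exact He. Qed.

(** The affine bound covers both uses: [e = 0] for constant bounds and [b = 0] for Lipschitz
    bounds. *)
Lemma seq_lim_le (u v : nat -> C) (l l' : C) (e b : R) (N : nat) : 0 <= e -> seq_lim u l -> seq_lim v l' ->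
  (forall n, (N <= n)%nat -> Cmod (u n) <= b + e * Cmod (v n)) -> Cmod l <= b + e * Cmod l'.
Proof.
  intros He Hu Hv H. apply Rle_plus_epsilon. intros eps Heps.
  destruct (Hu (eps / 2)%R ltac:(lra)) as [N1 H1].
  destruct (Hv (eps / (2 * (e + 1)))%R ltac:(apply Rdiv_lt_0_compat; lra)) as [N2 H2].
  set (n := (N + N1 + N2)%nat). specialize (H n ltac:(lia)). specialize (H1 n ltac:(lia)). specialize (H2 n ltac:(lia)).
  pose proof (Cmod_ge_sub l (u n)) as T1. rewrite Cmod_sub_sym in T1. pose proof (Cmod_ge_sub (v n) l') as T2.
  assert (e * Cmod (v n - l') <= eps / 2).
  { apply Rle_trans with ((e + 1) * (eps / (2 * (e + 1))))%R.
    - apply Rmult_le_compat; [lra | apply Cmod_ge_0 | lra | lra].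
    - right. field. lra. }
  nra.
Qed.

Section Extension.

Variables (f : C -> C) (alpha beta a M k : R) (L L' Q Q' : C -> C).
Let c : C := (alpha, beta).
Hypothesis Ha : 0 < alpha.
Hypothesis HM : 0 <= M.
Hypothesis Hk : 0 <= k < 1.
Hypothesis Ea : a = ((alpha ^ 2 + beta ^ 2) / alpha)%R.
Hypothesis HMk : M <= k * a.
Hypothesis D : log_data f c a M L L' Q Q'.

Let HQ := ld_Q D.
Let HL := ld_L D.
Let HQL := ld_QL D.
Let HQn := ld_Qn D.
Let P (z : C) : C := Q z + z * Q' z / Q z.

Lemma center_pos : 0 < a.
Proof. rewrite Ea. apply Rdiv_lt_0_compat; [nra | exact Ha]. Qed.

Lemma log_data_Q_bound (z : C) : disk z -> Cmod (Q z - RtoC a) <= M.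
Proof.
  pose proof center_pos.
  apply (briot_bouquet Q Q' a M HQ HQn); [split; [exact HM | nra] | exact (ld_P D)].
Qed.

(** Near 0 compactness suffices. For [|z| > 1/2] the relations [z L' = Q/c - 1] and
    [z Q' = Q ((P - a) - (Q - a))] have bounded right-hand sides, and division by [|z|] costs the
    factor 2 in [K3] and [K4]. *)
Lemma derivatives_bounded : exists K, 0 < K /\ forall z, disk z -> Cmod (L' z) <= K /\ Cmod (Q' z) <= K.
Proof.
  assert (Hhalf : forall u u', holo_disk u u' -> exists K, forall z, Cmod z <= 1 / 2 -> Cmod (u z) <= K).
  { intros u u' Hu. destruct (compact_max (fun z => Cmod (u z)) (fun z => Cmod z <= 1 / 2) (1 / 2) 0) as [z0 [_ Hz0]].
    - rewrite Cmod_0. lra.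
    - auto.
    - apply closed_disk_closed.
    - intros z Hz. apply rcont_Cmod. eapply holo_at_cont, Hu. unfold disk. lra.
    - exists (Cmod (u z0)). exact Hz0. }
  destruct (Hhalf _ _ (holo_disk_deriv _ _ HL)) as [K1 HK1]. destruct (Hhalf _ _ (holo_disk_deriv _ _ HQ)) as [K2 HK2].
  pose proof center_pos as Pa.
  set (K3 := (2 * (Cmod (/ c) * (a + M) + 1))%R). set (K4 := (2 * ((a + M) * (2 * M)))%R).
  assert (Qb : forall z, disk z -> Cmod (Q z) <= a + M).
  { intros z Hz. pose proof (log_data_Q_bound z Hz). pose proof (Cmod_ge_sub (Q z) (RtoC a)) as T.
    rewrite Cmod_R, Rabs_right in T; lra. }
  pose proof (Cmod_ge_0 (/ c)) as Pc.
  assert (PK3 : 0 <= K3) by (unfold K3; assert (0 <= Cmod (/ c) * (a + M)) by (apply Rmult_le_pos; lra); lra).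
  assert (PK4 : 0 <= K4) by (unfold K4; assert (0 <= (a + M) * (2 * M)) by (apply Rmult_le_pos; lra); lra).
  exists (Rabs K1 + Rabs K2 + K3 + K4 + 1)%R.
  pose proof (Rabs_pos K1). pose proof (Rabs_pos K2). pose proof (Rle_abs K1). pose proof (Rle_abs K2).
  split; [lra|]. intros z Hz. destruct (Rle_lt_dec (Cmod z) (1 / 2)) as [Hs|Hl].
  - specialize (HK1 z Hs). specialize (HK2 z Hs). lra.
  - specialize (Qb z Hz). split.
    + assert (E : z * L' z = / c * Q z - 1) by (rewrite HQL; field; exact (c_neq_0 alpha beta Ha)).
      apply (f_equal Cmod) in E. rewrite Cmod_mult in E.
      pose proof (Cmod_triangle (/ c * Q z) (- (1))) as T. rewrite Cmod_opp, Cmod_1, Cmod_mult in T.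
      change (/ c * Q z + - (1)) with (/ c * Q z - 1) in T.
      assert (Cmod (/ c) * Cmod (Q z) <= Cmod (/ c) * (a + M)) by (apply Rmult_le_compat_l; assumption).
      pose proof (Cmod_ge_0 (L' z)). unfold K3. unfold K3 in PK3. nra.
    + assert (E : z * Q' z = Q z * ((P z - RtoC a) - (Q z - RtoC a))) by (unfold P; field; apply HQn, Hz).
      apply (f_equal Cmod) in E. rewrite !Cmod_mult in E.
      pose proof (Cmod_triangle (P z - RtoC a) (- (Q z - RtoC a))) as T. rewrite Cmod_opp in T.
      change (P z - RtoC a + - (Q z - RtoC a)) with (P z - RtoC a - (Q z - RtoC a)) in T.
      pose proof (ld_P D z Hz) as PB. change (Cmod (P z - RtoC a) <= M) in PB.
      pose proof (log_data_Q_bound z Hz).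
      assert (Cmod (Q z) * Cmod (P z - RtoC a - (Q z - RtoC a)) <= (a + M) * (2 * M))
        by (apply Rmult_le_compat; try apply Cmod_ge_0; lra).
      pose proof (Cmod_ge_0 (Q' z)). unfold K4. unfold K4 in PK4. nra.
Qed.

Lemma disk_lipschitz (u u' : C -> C) (K : R) : holo_disk u u' -> (forall z, disk z -> Cmod (u' z) <= K) ->
  forall x y, disk x -> disk y -> Cmod (u x - u y) <= K * Cmod (x - y).
Proof.
  intros Hu Hb x y Hx Hy.
  assert (Hd : forall t, 0 <= t <= 1 -> disk (y + RtoC t * (x - y))).
  { intros t Ht. unfold disk. replace (y + RtoC t * (x - y)) with (y + RtoC t * (x - y) - 0) by ring.
    apply ball_convex; [| |exact Ht]; [replace (x - 0) with x by ring | replace (y - 0) with y by ring]; assumption. }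
  replace (u x - u y) with (u x - u y - 0 * (x - y)) by ring.
  apply segment_mvt with u'; intros t Ht.
  - apply Hu, Hd, Ht.
  - replace (u' (y + RtoC t * (x - y)) - 0) with (u' (y + RtoC t * (x - y))) by ring. apply Hb, Hd, Ht.
Qed.

(** Extensions of [L] and [Q] to the closed disk. On the circle [Qx] is merely Lipschitz, whereas
    [Lx] is strictly differentiable relative to the closed disk, its derivative being the boundary
    value of [L' = (Q/c - 1)/z]. *)
Record boundary_data (K : R) (Lx Qx : C -> C) : Prop := {
  bd_K : 0 < K;
  bd_L : forall z, disk z -> Lx z = L z;
  bd_Q : forall z, disk z -> Qx z = Q z;
  bd_Lb : forall z, Cmod z <= 1 -> Cmod (Lx z) <= K;
  bd_Qb : forall z, Cmod z <= 1 -> Cmod (Qx z - RtoC a) <= M;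
  bd_Ql : forall x y, Cmod x <= 1 -> Cmod y <= 1 -> Cmod (Qx x - Qx y) <= K * Cmod (x - y);
  bd_Ld : forall z, Cmod z = 1%R -> pair_diff rel_in Lx z ((/ c * Qx z - 1) / z) 0 }.

Lemma boundary_data_exists : exists K Lx Qx, boundary_data K Lx Qx.
Proof.
  destruct derivatives_bounded as [K [HK Hb]].
  pose proof (disk_lipschitz L L' K HL (fun z Hz => proj1 (Hb z Hz))) as LL.
  pose proof (disk_lipschitz Q Q' K HQ (fun z Hz => proj2 (Hb z Hz))) as LQ.
  destruct (closed_disk_extension L K HK LL) as [Lx [HLx LLx]].
  destruct (closed_disk_extension Q K HK LQ) as [Qx [HQx LQx]].
  assert (Qlip : forall x y, Cmod x <= 1 -> Cmod y <= 1 -> Cmod (Qx x - Qx y) <= K * Cmod (x - y)).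
  { intros x y Hx Hy. replace (K * Cmod (x - y))%R with (0 + K * Cmod (x - y))%R by ring.
    apply (seq_lim_le _ _ _ _ K 0 0 ltac:(lra) (seq_lim_minus _ _ _ _ (LQx x Hx) (LQx y Hy))
       (seq_lim_minus _ _ _ _ (rho_lim x) (rho_lim y))).
    intros n _. rewrite Rplus_0_l. apply LQ; apply rho_disk; assumption. }
  exists K, Lx, Qx. constructor; try assumption.
  - intros z Hz. replace K with (K + 0 * Cmod z)%R by ring.
    apply (seq_lim_le _ _ _ _ 0 K 0 ltac:(lra) (LLx z Hz) (seq_lim_const z)).
    intros n _. pose proof (rho_disk n z Hz) as Dn. pose proof (LL _ 0 Dn disk_0) as B.
    rewrite (ld_L0 D) in B.
    replace (L (RtoC (rho n) * z) - 0) with (L (RtoC (rho n) * z)) in B by ring.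
    replace (RtoC (rho n) * z - 0) with (RtoC (rho n) * z) in B by ring. unfold disk in Dn. nra.
  - intros z Hz. replace M with (M + 0 * Cmod z)%R by ring.
    apply (seq_lim_le _ _ _ _ 0 M 0 ltac:(lra) (seq_lim_minus _ _ _ _ (LQx z Hz) (seq_lim_const (RtoC a))) (seq_lim_const z)).
    intros n _. pose proof (log_data_Q_bound _ (rho_disk n z Hz)). lra.
  - intros z Hz eps He.
    assert (Hz0 : z <> 0) by (apply Cmod_gt_0; lra).
    set (lam := (/ c * Qx z - 1) / z).
    (* [L'] tends to [lam] at the boundary point. The mean value inequality is then applied to
       radially contracted pairs, which lie in the open disk, and the estimate passes to the
       limit. *)
    assert (Hlam : forall eps, 0 < eps -> exists d, 0 < d /\ forall w, disk w -> Cmod (w - z) < d -> Cmod (L' w - lam) <= eps).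
    { intros e He'.
      set (N := (2 * (Cmod (/ c) * K + Cmod (/ c * Qx z - 1) + 1))%R).
      pose proof (Cmod_ge_0 (/ c)) as Pc. pose proof (Cmod_ge_0 (/ c * Qx z - 1)) as Pq.
      assert (HN : 0 < N) by (unfold N; assert (0 <= Cmod (/ c) * K) by (apply Rmult_le_pos; lra); lra).
      exists (Rmin (1 / 2) (e / N)). split; [apply Rmin_pos; [lra | apply Rdiv_lt_0_compat; assumption]|].
      intros w Hw Hwz. pose proof (Rmin_l (1 / 2) (e / N)). pose proof (Rmin_r (1 / 2) (e / N)).
      assert (Mw : 1 / 2 <= Cmod w) by (pose proof (Cmod_ge_sub z w) as T; rewrite Cmod_sub_sym in T; lra).
      assert (Hw0 : w <> 0) by (apply Cmod_gt_0; lra).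
      assert (E : L' w - lam = (/ c * (Qx w - Qx z) - (/ c * Qx z - 1) * / z * (w - z)) / w).
      { rewrite HQx, HQL by exact Hw. unfold lam. field. repeat split; try assumption. exact (c_neq_0 alpha beta Ha). }
      rewrite E, Cmod_div by exact Hw0.
      assert (B : Cmod (/ c * (Qx w - Qx z) - (/ c * Qx z - 1) * / z * (w - z)) <= N / 2 * Cmod (w - z)).
      { pose proof (Cmod_triangle (/ c * (Qx w - Qx z)) (- ((/ c * Qx z - 1) * / z * (w - z)))) as T.
        rewrite Cmod_opp, !Cmod_mult, (Cmod_inv z Hz0), Hz, Rinv_1 in T.
        unfold Cminus at 1. eapply Rle_trans; [exact T|].
        unfold disk in Hw. pose proof (Qlip w z ltac:(lra) ltac:(lra)) as B2.
        assert (Cmod (/ c) * Cmod (Qx w - Qx z) <= Cmod (/ c) * (K * Cmod (w - z))) by (apply Rmult_le_compat_l; assumption).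
        pose proof (Cmod_ge_0 (w - z)). unfold N. lra. }
      apply Rmult_le_reg_r with (Cmod w); [lra|]. unfold Rdiv at 1. rewrite Rmult_assoc, Rinv_l, Rmult_1_r by lra.
      eapply Rle_trans; [exact B|].
      apply Rle_trans with (N / 2 * (e / N))%R; [apply Rmult_le_compat_l; lra|].
      replace (N / 2 * (e / N))%R with (e * (1 / 2))%R by (field; lra). apply Rmult_le_compat_l; lra. }
    destruct (Hlam eps He) as [d [Hd Hdd]]. exists (d / 2)%R. split; [lra|]. intros x y [Ix Iy] Dx Dy.
    rewrite Cmult_0_l. unfold Cminus at 1. rewrite Copp_0, Cplus_0_r.
    replace (eps * Cmod (x - y))%R with (0 + eps * Cmod (x - y))%R by ring.
    destruct (rho_lim x (d / 2)%R ltac:(lra)) as [N1 H1]. destruct (rho_lim y (d / 2)%R ltac:(lra)) as [N2 H2].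
    pose proof (seq_lim_minus _ _ _ _ (rho_lim x) (rho_lim y)) as Lxy.
    apply (seq_lim_le _ _ _ _ eps 0 (N1 + N2) ltac:(lra)
      (seq_lim_minus _ _ _ _ (seq_lim_minus _ _ _ _ (LLx x Ix) (LLx y Iy)) (seq_lim_scal lam _ _ Lxy)) Lxy).
    intros n Hn. rewrite Rplus_0_l. specialize (H1 n ltac:(lia)). specialize (H2 n ltac:(lia)).
    set (xn := RtoC (rho n) * x) in *. set (yn := RtoC (rho n) * y) in *.
    assert (Dxn : disk xn) by (apply rho_disk, Ix). assert (Dyn : disk yn) by (apply rho_disk, Iy).
    assert (Bx : Cmod (xn - z) < d) by (eapply Rle_lt_trans; [apply (Cmod_tri_sub xn x z)|]; lra).
    assert (By : Cmod (yn - z) < d) by (eapply Rle_lt_trans; [apply (Cmod_tri_sub yn y z)|]; lra).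
    assert (Hdk : forall t, 0 <= t <= 1 -> disk (yn + RtoC t * (xn - yn))).
    { intros t Ht. unfold disk. replace (yn + RtoC t * (xn - yn)) with (yn + RtoC t * (xn - yn) - 0) by ring.
      apply ball_convex; [| |exact Ht]; [replace (xn - 0) with xn by ring | replace (yn - 0) with yn by ring]; assumption. }
    apply segment_mvt with L'; intros t Ht.
    + apply HL, Hdk, Ht.
    + apply Hdd; [apply Hdk, Ht | apply ball_convex; assumption].
Qed.

End Extension.

Arguments bd_K {alpha beta a M L Q K Lx Qx} _.
Arguments bd_L {alpha beta a M L Q K Lx Qx} _.
Arguments bd_Q {alpha beta a M L Q K Lx Qx} _.
Arguments bd_Lb {alpha beta a M L Q K Lx Qx} _.
Arguments bd_Qb {alpha beta a M L Q K Lx Qx} _.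
Arguments bd_Ql {alpha beta a M L Q K Lx Qx} _.
Arguments bd_Ld {alpha beta a M L Q K Lx Qx} _.

(** * The quasiconformal extension *)

Lemma holo_strict_deriv (rel : C -> C -> Prop) (f f' : C -> C) (z l : C) (r : R) : 0 < r ->
  (forall x, Cmod (x - z) < r -> holo_at f x (f' x)) -> holo_at f' z l -> pair_diff rel f z (f' z) 0.
Proof. intros Hr Hf Hl. apply (holo_strict rel f f' z r Hr Hf). exact (holo_at_cont _ _ _ Hl). Qed.

Lemma cexp_strict (rel : C -> C -> Prop) (z : C) : pair_diff rel cexp z (cexp z) 0.
Proof. apply (holo_strict_deriv rel cexp cexp z (cexp z) 1); [lra | intros; apply holo_at_cexp | apply holo_at_cexp]. Qed.

Lemma inv_strict (rel : C -> C -> Prop) (z : C) : z <> 0 -> pair_diff rel Cinv z (- / (z * z)) 0.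
Proof.
  intros Hz. pose proof (proj1 (Cmod_gt_0 z) Hz) as Pz.
  apply (holo_strict_deriv rel Cinv (fun x => - / (x * x)) z (- (1) * (- / ((z * z) * (z * z)) * (1 * z + z * 1))) (Cmod z)); [exact Pz | |].
  - intros x Hx. apply holo_at_inv. intros ->. rewrite Cmod_sub_sym in Hx. replace (z - 0) with z in Hx by ring. lra.
  - apply (holo_at_local (fun x => - (1) * / (x * x)) _ z _ 1); [lra | intros; ring|].
    apply holo_at_scal. apply (holo_at_comp (fun x => x * x) Cinv).
    + apply (holo_at_mult (fun x => x) (fun x => x)); apply holo_at_id.
    + apply holo_at_inv, Cmult_neq_0; assumption.
Qed.

Lemma Clog_strict (rel : C -> C -> Prop) (z : C) : 0 < fst z -> pair_diff rel Clog z (/ z) 0.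
Proof.
  intros Hz. apply (holo_strict_deriv rel Clog Cinv z (- / (z * z)) (fst z)); [exact Hz | |].
  - intros x Hx. apply holo_at_Clog. pose proof (Cmod_fst (x - z)) as F.
    change (Rabs (fst x - fst z) <= Cmod (x - z)) in F. apply Rabs_le_between in F. lra.
  - apply holo_at_inv, rhp_neq_0, Hz.
Qed.

Lemma ev_any (rel : C -> C -> Prop) (z : C) (f : C -> C) : ev_pair rel z (fun x y => anypair (f x) (f y)).
Proof. exists 1%R. split; [lra|]. intros; exact I. Qed.

Lemma ev_refl (rel : C -> C -> Prop) (z : C) (f : C -> C) : ev_pair rel z (fun x y => f x = f x /\ f y = f y).
Proof. exists 1%R. split; [lra|]. intros; split; reflexivity. Qed.

Lemma pair_diff_holo_comp (rel : C -> C -> Prop) (f g : C -> C) (z A B l : C) : based rel z ->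
  pair_diff rel f z A B -> pair_diff anypair g (f z) l 0 -> pair_diff rel (fun x => g (f x)) z (l * A) (l * B).
Proof.
  intros Hb Hf Hg. pose proof (pair_diff_comp rel z Hb anypair f g _ _ _ _ Hf Hg (ev_any rel z f)) as H.
  apply (pair_diff_eq _ _ _ _ _ _ _ _ H (ev_refl rel z _)); ring.
Qed.

Lemma Cconj_neq_0 (z : C) : z <> 0 -> Cconj z <> 0.
Proof. intros Hz E. apply Hz. rewrite <- (Cconj_conj z), E. apply Cconj_RtoC. Qed.

(** * The exterior formula and its Wirtinger derivatives *)

Section Outer.

Variables (c : C) (a : R) (Lx Qx : C -> C).
Hypothesis Hc : c <> 0.
Hypothesis Ha : 0 < a.

Definition zeta (z : C) : C := / Cconj z.
(** The function [|z|^(2a)], written as [exp (a log (z conj z))] so that its derivatives follow from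
    the product and chain rules. *)
Definition Epow (z : C) : C := cexp (RtoC a * Clog (z * Cconj z)).
Definition Bfac (z : C) : C := / RtoC a * (Epow z + - (1)).
Definition Xfac (z : C) : C := 1 + Bfac z * Qx (zeta z).
(** The logarithm of [F z / zeta], with the power [1/c] taken through the principal branch at
    [Xfac], whose real part is positive for [|z| >= 1]. *)
Definition Sexp (z : C) : C := Lx (zeta z) + / c * Clog (Xfac z).
Definition outer (z : C) : C := zeta z * cexp (Sexp z).

Lemma RtoC_a : RtoC a <> 0.
Proof. intros E. apply (f_equal fst) in E. simpl in E. lra. Qed.

Lemma zeta_diff (rel : C -> C -> Prop) (z : C) : based rel z -> z <> 0 ->
  pair_diff rel zeta z 0 (- (zeta z * zeta z)).
Proof.
  intros Hb Hz. pose proof (Cconj_neq_0 z Hz) as Hcz.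
  pose proof (pair_diff_holo_comp rel Cconj Cinv z _ _ _ Hb (pair_diff_conj rel z) (inv_strict anypair _ Hcz)) as H.
  apply (pair_diff_eq _ _ _ _ _ _ _ _ H (ev_refl rel z _)); [ring | unfold zeta; field; exact Hcz].
Qed.

Lemma norm_sqr_re (z : C) : fst (z * Cconj z)%C = (Cmod z * Cmod z)%R.
Proof. rewrite Cmult_comm. apply Cmod_sqr_re. Qed.

Lemma Epow_diff (rel : C -> C -> Prop) (z : C) : based rel z -> z <> 0 ->
  pair_diff rel Epow z (RtoC a * Epow z / z) (RtoC a * Epow z * zeta z).
Proof.
  intros Hb Hz. pose proof (Cconj_neq_0 z Hz) as Hcz. pose proof (proj1 (Cmod_gt_0 z) Hz) as Pz.
  assert (Hp : 0 < fst (z * Cconj z)%C) by (rewrite norm_sqr_re; nra).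
  pose proof (pair_diff_mult rel z Hb (fun x => x) Cconj _ _ _ _ (pair_diff_id rel z) (pair_diff_conj rel z)) as H1.
  pose proof (pair_diff_holo_comp rel (fun x => x * Cconj x) Clog z _ _ _ Hb H1 (Clog_strict anypair _ Hp)) as H2.
  pose proof (pair_diff_scal rel z _ _ _ (RtoC a) H2) as H3.
  pose proof (pair_diff_holo_comp rel _ cexp z _ _ _ Hb H3 (cexp_strict anypair _)) as H4.
  apply (pair_diff_eq _ _ _ _ _ _ _ _ H4 (ev_refl rel z _)); unfold Epow, zeta; field; try split; assumption.
Qed.

Lemma Bfac_diff (rel : C -> C -> Prop) (z : C) : based rel z -> z <> 0 ->
  pair_diff rel Bfac z (Epow z / z) (Epow z * zeta z).
Proof.
  intros Hb Hz.
  pose proof (pair_diff_plus rel z _ _ _ _ _ _ (Epow_diff rel z Hb Hz) (pair_diff_const rel z (- (1)))) as H1.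
  pose proof (pair_diff_scal rel z _ _ _ (/ RtoC a) H1) as H2.
  pose proof RtoC_a.
  apply (pair_diff_eq _ _ _ _ _ _ _ _ H2 (ev_refl rel z _)); field; try split; assumption.
Qed.

(** The derivative data [L1] and [Q1] are parameters so that the formula serves twice: outside the
    closed disk with the derivatives of [L] and [Q], and on the circle with [Q1 = 0], where [Qx]
    need not be differentiable but [Bfac] vanishes. *)
Lemma outer_diff (rel : C -> C -> Prop) (z L1 Q1 : C) : based rel z -> z <> 0 -> 0 < fst (Xfac z) ->
  pair_diff rel (fun x => Lx (zeta x)) z 0 (- (zeta z * zeta z) * L1) ->
  pair_diff rel (fun x => Bfac x * Qx (zeta x)) z (Epow z / z * Qx (zeta z))
    (Epow z * zeta z * Qx (zeta z) - Bfac z * (zeta z * zeta z) * Q1) ->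
  pair_diff rel outer z (cexp (Sexp z) * zeta z * (Epow z * Qx (zeta z) / (z * c * Xfac z)))
    (cexp (Sexp z) * (zeta z * zeta z) *
       (- (1 + zeta z * L1) + (Epow z * Qx (zeta z) - Bfac z * zeta z * Q1) / (c * Xfac z))).
Proof.
  intros Hb Hz Hp HL HBQ. pose proof (rhp_neq_0 _ Hp) as Hx.
  pose proof (pair_diff_plus rel z _ _ _ _ _ _ (pair_diff_const rel z 1) HBQ) as H1.
  pose proof (pair_diff_holo_comp rel Xfac Clog z _ _ _ Hb H1 (Clog_strict anypair _ Hp)) as H2.
  pose proof (pair_diff_plus rel z _ _ _ _ _ _ HL (pair_diff_scal rel z _ _ _ (/ c) H2)) as H3.
  pose proof (pair_diff_holo_comp rel Sexp cexp z _ _ _ Hb H3 (cexp_strict anypair _)) as H4.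
  pose proof (pair_diff_mult rel z Hb zeta _ _ _ _ _ (zeta_diff rel z Hb Hz) H4) as H5.
  apply (pair_diff_eq _ _ _ _ _ _ _ _ H5 (ev_refl rel z _)); field; repeat split; assumption.
Qed.

Lemma Epow_real (z : C) : z <> 0 -> Epow z = RtoC (exp (a * ln (Cmod z * Cmod z))).
Proof.
  intros Hz. pose proof (proj1 (Cmod_gt_0 z) Hz) as Pz.
  assert (E : z * Cconj z = RtoC (Cmod z * Cmod z)).
  { rewrite <- Cmod2_conj. f_equal. ring. }
  unfold Epow. rewrite E. unfold Clog. rewrite Cmod_R, Rabs_right by nra. simpl fst; simpl snd.
  replace (0 / (Cmod z * Cmod z))%R with 0%R by (field; lra). rewrite atan_0.
  unfold cexp, Cmult, RtoC; simpl.
  replace (a * 0 + 0 * ln (Cmod z * Cmod z))%R with 0%R by ring. rewrite cos_0, sin_0.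
  replace (a * ln (Cmod z * Cmod z) - 0 * 0)%R with (a * ln (Cmod z * Cmod z))%R by ring. f_equal; ring.
Qed.

Lemma Cmod_zeta (z : C) : z <> 0 -> Cmod (zeta z) = (/ Cmod z)%R.
Proof. intros Hz. unfold zeta. rewrite Cmod_inv, Cmod_conj by (apply Cconj_neq_0, Hz). reflexivity. Qed.

Lemma Bfac_real (z : C) : z <> 0 -> Bfac z = RtoC ((exp (a * ln (Cmod z * Cmod z)) - 1) / a).
Proof.
  intros Hz. unfold Bfac. rewrite Epow_real by exact Hz. unfold Rdiv.
  rewrite RtoC_mult, RtoC_minus, RtoC_inv by lra. ring.
Qed.

Lemma Epow_ge_1 (z : C) : 1 <= Cmod z -> 1 <= exp (a * ln (Cmod z * Cmod z)).
Proof.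
  intros Hz. rewrite <- exp_0.
  assert (0 <= ln (Cmod z * Cmod z)).
  { rewrite <- ln_1. destruct (Req_dec (Cmod z * Cmod z) 1) as [->|n]; [lra|]. left. apply ln_increasing; nra. }
  destruct (Req_dec (a * ln (Cmod z * Cmod z)) 0) as [->|n]; [rewrite exp_0; lra|].
  left. rewrite exp_0. rewrite <- exp_0 at 1. apply exp_increasing. nra.
Qed.

(** From [Re Q >= (1 - k) a] follows [Re X >= 1 + (E - 1) (1 - k)] with [E = |z|^(2a) >= 1], and
    this is at least [(1 - k) E]. *)
Lemma Xfac_lower (z : C) (k : R) : 0 <= k < 1 -> 1 <= Cmod z -> Cmod (Qx (zeta z) - RtoC a) <= k * a ->
  (1 - k) * exp (a * ln (Cmod z * Cmod z)) <= fst (Xfac z).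
Proof.
  intros Hk Hz HQ. assert (Hz0 : z <> 0) by (apply Cmod_gt_0; lra).
  unfold Xfac. rewrite Bfac_real by exact Hz0. pose proof (Epow_ge_1 z Hz) as E1.
  set (e := exp (a * ln (Cmod z * Cmod z))) in *.
  pose proof (Cmod_fst (Qx (zeta z) - RtoC a)) as F. change (Rabs (fst (Qx (zeta z)) - a) <= Cmod (Qx (zeta z) - RtoC a)) in F.
  apply Rabs_le_between in F. set (q := fst (Qx (zeta z))) in *.
  replace (fst (1 + RtoC ((e - 1) / a) * Qx (zeta z))) with (1 + (e - 1) / a * q)%R
    by (unfold q, Cplus, Cmult, RtoC; simpl; ring).
  assert ((e - 1) * (1 - k) <= (e - 1) / a * q).
  { unfold Rdiv. rewrite Rmult_assoc. apply Rmult_le_compat_l; [lra|].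
    apply Rmult_le_reg_l with a; [exact Ha|]. rewrite <- Rmult_assoc, Rinv_r by lra. lra. }
  lra.
Qed.

End Outer.

Lemma Clog_1 : Clog 1 = 0.
Proof. unfold Clog. rewrite Cmod_1, ln_1. simpl. replace (0 / 1)%R with 0%R by field. rewrite atan_0. reflexivity. Qed.

Lemma Cinv_neq_0 (z : C) : z <> 0 -> / z <> 0.
Proof.
  intros Hz. apply Cmod_gt_0. rewrite Cmod_inv by exact Hz. apply Rinv_0_lt_compat, Cmod_gt_0, Hz.
Qed.

(** * Dilatation and growth of the extended map *)

Section QuasiconformalExtension.

Variables (f : C -> C) (alpha beta a M k K : R) (L L' Q Q' Lx Qx : C -> C).
Let c : C := (alpha, beta).
Hypothesis Ha : 0 < alpha.
Hypothesis HM : 0 <= M.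
Hypothesis Hk : 0 <= k < 1.
Hypothesis Ea : a = ((alpha ^ 2 + beta ^ 2) / alpha)%R.
Hypothesis HMk : M <= k * a.
Hypothesis D : log_data f c a M L L' Q Q'.
Hypothesis BD : boundary_data alpha beta a M L Q K Lx Qx.

Let out := outer c a Lx Qx.

Definition extension (z : C) : C := if Rle_dec (Cmod z) 1 then z * cexp (Lx z) else out z.

Let Pa : 0 < a := center_pos alpha beta a Ha Ea.
Let Hc : c <> 0 := c_neq_0 alpha beta Ha.
Let bK := bd_K BD.
Let bL := bd_L BD.
Let bQ := bd_Q BD.

Lemma zeta_in (z : C) : 1 <= Cmod z -> Cmod (zeta z) <= 1.
Proof.
  intros Hz. rewrite Cmod_zeta by (apply Cmod_gt_0; lra). rewrite <- Rinv_1. apply Rinv_le_contravar; lra.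
Qed.

Lemma Xfac_rhp (z : C) : 1 <= Cmod z -> 0 < fst (Xfac a Qx z).
Proof.
  intros Hz. pose proof (bd_Qb BD _ (zeta_in z Hz)) as B.
  pose proof (Xfac_lower a Qx Pa z k Hk Hz ltac:(lra)) as T.
  pose proof (exp_pos (a * ln (Cmod z * Cmod z))). nra.
Qed.

Lemma circle_values (z : C) : Cmod z = 1%R ->
  zeta z = z /\ Epow a z = 1 /\ Bfac a z = 0 /\ Xfac a Qx z = 1 /\ Sexp c a Lx Qx z = Lx z.
Proof.
  intros Hz. assert (Hz0 : z <> 0) by (apply Cmod_gt_0; lra).
  pose proof (Cconj_neq_0 z Hz0) as Hcz.
  assert (E : z * Cconj z = 1) by (rewrite <- Cmod2_conj, Hz; f_equal; ring).
  assert (E1 : zeta z = z).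
  { unfold zeta. transitivity (/ Cconj z * (z * Cconj z)); [rewrite E; ring | field; exact Hcz]. }
  assert (E2 : Epow a z = 1).
  { rewrite Epow_real, Hz by exact Hz0. replace (1 * 1)%R with 1%R by ring. rewrite ln_1, Rmult_0_r, exp_0. reflexivity. }
  assert (E3 : Bfac a z = 0) by (unfold Bfac; rewrite E2; ring).
  assert (E4 : Xfac a Qx z = 1) by (unfold Xfac; rewrite E3; ring).
  repeat split; try assumption.
  unfold Sexp. rewrite E4, E1, Clog_1. ring.
Qed.

Lemma extension_in (z : C) : Cmod z <= 1 -> extension z = z * cexp (Lx z).
Proof. intros Hz. unfold extension. destruct (Rle_dec (Cmod z) 1); [reflexivity | contradiction]. Qed.

Lemma extension_out (z : C) : 1 <= Cmod z -> extension z = out z.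
Proof.
  intros Hz. unfold extension. destruct (Rle_dec (Cmod z) 1) as [Hle|]; [|reflexivity].
  destruct (circle_values z ltac:(lra)) as [E1 [_ [_ [_ E2]]]].
  unfold out, outer. rewrite E1, E2. reflexivity.
Qed.

Lemma extension_disk (z : C) : disk z -> extension z = f z.
Proof.
  intros Hz. rewrite extension_in by (unfold disk in Hz; lra). rewrite bL by exact Hz.
  symmetry. apply (ld_f D), Hz.
Qed.

Lemma holo_local_strict (u u' U : C -> C) (z : C) : holo_disk u u' -> (forall x, disk x -> U x = u x) ->
  disk z -> pair_diff anypair U z (u' z) 0.
Proof.
  intros Hu HU Hz. destruct (disk_open z Hz) as [r [Hr Ho]].
  apply (holo_strict_deriv anypair U u' z (C_derive u' z) r Hr).
  - intros x Hx. destruct (disk_open x (Ho x Hx)) as [r' [Hr' Ho']].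
    apply (holo_at_local u U x _ r' Hr'); [|apply Hu, Ho, Hx].
    intros y Hy. symmetry. apply HU, Ho', Hy.
  - apply (holo_disk_deriv u u' Hu), Hz.
Qed.

Lemma strict_inside (z : C) : disk z -> exists A B, pair_diff anypair extension z A B /\ A <> 0 /\ Cmod B <= k * Cmod A.
Proof.
  intros Hz. exists (cexp (L z) * (1 + z * L' z)), 0. split; [|split].
  - apply (holo_local_strict f _ extension z (ld_f' D)); [apply extension_disk | exact Hz].
  - apply Cmult_neq_0; [apply cexp_neq_0|]. intros E. apply (ld_Qn D z Hz).
    rewrite (ld_QL D), E. ring.
  - rewrite Cmod_0. apply Rmult_le_pos; [lra | apply Cmod_ge_0].
Qed.

(** In the coefficient of [conj] everything collapses to [P - a]: with [E = 1 + a B], [X = 1 + B Q]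
    and [w Q' = Q (P - Q)], the bracket [-X + E - B (P - Q)] equals [-B (P - a)]. *)
Lemma strict_outside (z : C) : 1 < Cmod z -> exists A B, pair_diff anypair extension z A B /\ A <> 0 /\ Cmod B <= k * Cmod A.
Proof.
  intros Hz. assert (Hz0 : z <> 0) by (apply Cmod_gt_0; lra).
  set (w := zeta z).
  assert (Mw : Cmod w = (/ Cmod z)%R) by (apply Cmod_zeta, Hz0).
  assert (Dw : disk w) by (unfold disk; rewrite Mw, <- Rinv_1; apply Rinv_lt_contravar; lra).
  pose proof (Xfac_rhp z ltac:(lra)) as HX. pose proof (rhp_neq_0 _ HX) as HX0.
  pose proof (anypair_based z) as Hb.
  pose proof (zeta_diff anypair z Hb Hz0) as Hzeta.
  pose proof (pair_diff_holo_comp anypair zeta Lx z _ _ _ Hb Hzeta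
    (holo_local_strict L L' Lx _ (ld_L D) bL Dw)) as HLz.
  pose proof (pair_diff_holo_comp anypair zeta Qx z _ _ _ Hb Hzeta
    (holo_local_strict Q Q' Qx _ (ld_Q D) bQ Dw)) as HQz.
  pose proof (pair_diff_mult anypair z Hb _ _ _ _ _ _ (Bfac_diff a Pa anypair z Hb Hz0) HQz) as HBQ.
  fold w in HLz, HBQ.
  assert (HO : pair_diff anypair out z (cexp (Sexp c a Lx Qx z) * w * (Epow a z * Qx w / (z * c * Xfac a Qx z)))
    (cexp (Sexp c a Lx Qx z) * (w * w) *
       (- (1 + w * L' w) + (Epow a z * Qx w - Bfac a z * w * Q' w) / (c * Xfac a Qx z)))).
  { apply (outer_diff c a Lx Qx Hc anypair z (L' w) (Q' w) Hb Hz0 HX).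
    - apply (pair_diff_eq _ _ _ _ _ _ _ _ HLz (ev_refl anypair z _)); fold w; ring.
    - apply (pair_diff_eq _ _ _ _ _ _ _ _ HBQ (ev_refl anypair z _)); fold w; ring. }
  set (S := cexp (Sexp c a Lx Qx z)) in *. assert (HS : S <> 0) by apply cexp_neq_0.
  assert (HQw : Qx w = Q w) by (apply bQ, Dw).
  pose proof (ld_Qn D w Dw) as HQn.
  set (p := Q w + w * Q' w / Q w).
  pose proof (ld_P D w Dw) as HP. fold p in HP.
  assert (Hw0 : w <> 0) by (apply Cmod_gt_0; rewrite Mw; apply Rinv_0_lt_compat; lra).
  pose proof (RtoC_a a Pa) as Ha0.
  set (e := exp (a * ln (Cmod z * Cmod z))).
  assert (Ee : Epow a z = RtoC e) by (apply Epow_real; assumption).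
  assert (Eb : Bfac a z = RtoC ((e - 1) / a)) by (apply Bfac_real; assumption).
  assert (He1 : 1 <= e) by (apply Epow_ge_1; [exact Pa | lra]).
  eexists. eexists. split; [|split].
  - apply (pair_diff_eq _ _ _ _ _ _ _ _ HO); [| reflexivity | reflexivity].
    exists (Cmod z - 1)%R. split; [lra|]. intros x y _ Hx Hy.
    assert (Hfar : forall v, Cmod (v - z) < Cmod z - 1 -> 1 <= Cmod v).
    { intros v Hv. pose proof (Cmod_ge_sub z v) as T. rewrite Cmod_sub_sym in T. lra. }
    split; symmetry; apply extension_out, Hfar; assumption.
  - rewrite Ee, HQw. unfold Cdiv. repeat apply Cmult_neq_0; try assumption.
    + intros E. apply (f_equal fst) in E. simpl in E. lra.
    + apply Cinv_neq_0. repeat apply Cmult_neq_0; assumption.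
  - set (X := Xfac a Qx z) in *.
    (* The relations that eliminate [L'], [Q'], [X] and [E] in favour of [Q], [p] and [B]. *)
    assert (E1 : 1 + w * L' w = / c * Q w) by (rewrite (ld_QL D); field; exact Hc).
    assert (E2 : w * Q' w = Q w * (p - Q w)) by (unfold p; field; exact HQn).
    assert (EX : X = 1 + Bfac a z * Q w) by (unfold X, Xfac; fold w; rewrite HQw; reflexivity).
    assert (EE : Epow a z = 1 + RtoC a * Bfac a z) by (unfold Bfac; field; exact Ha0).
    assert (EB : S * (w * w) * (- (1 + w * L' w) + (Epow a z * Qx w - Bfac a z * w * Q' w) / (c * X))
      = - (S * (w * w) * (/ c * Q w) * (Bfac a z * (p - RtoC a)) / X)).
    { rewrite E1, HQw. replace (Bfac a z * w * Q' w) with (Bfac a z * (w * Q' w)) by ring. rewrite E2, EE.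
      rewrite EX in HX0 |- *. field. split; assumption. }
    rewrite EB, HQw, Ee, Eb. unfold Cdiv.
    rewrite Cmod_opp, !Cmod_mult.
    rewrite !Cmod_inv by (repeat apply Cmult_neq_0; assumption).
    rewrite !Cmod_mult, !Cmod_R, Mw.
    assert (Peb : 0 <= (e - 1) / a) by (apply Rmult_le_pos; [lra | left; apply Rinv_0_lt_compat, Pa]).
    rewrite (Rabs_right ((e - 1) / a)), (Rabs_right e) by lra.
    pose proof (proj1 (Cmod_gt_0 S) HS) as PS. pose proof (proj1 (Cmod_gt_0 X) HX0) as PX.
    pose proof (proj1 (Cmod_gt_0 c) Hc) as Pc. pose proof (proj1 (Cmod_gt_0 _) HQn) as PQ.
    (* The first factor times [e] is the modulus of the other coefficient, since [|w| = 1/|z|]. It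
       remains to see that [(e - 1)/a |p - a| <= k (e - 1) <= k e]. *)
    apply Rle_trans with ((Cmod S * / Cmod z * / Cmod z * / Cmod c * Cmod (Q w) * / Cmod X) * ((e - 1) / a * Cmod (p - RtoC a)))%R;
      [right; ring|].
    apply Rle_trans with ((Cmod S * / Cmod z * / Cmod z * / Cmod c * Cmod (Q w) * / Cmod X) * (k * e))%R.
    + apply Rmult_le_compat_l.
      * repeat apply Rmult_le_pos; try (left; apply Rinv_0_lt_compat; lra); lra.
      * apply Rle_trans with ((e - 1) / a * (k * a))%R; [apply Rmult_le_compat_l; lra|].
        replace ((e - 1) / a * (k * a))%R with (k * (e - 1))%R by (field; lra). apply Rmult_le_compat_l; lra.
    + right. field. lra.
Qed.

(** From either side the derivative is [exp (Lx z) Qx z / c] and the conjugate coefficient is 0,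
    because [B] vanishes and the reflected derivative of [Lx] cancels the rest; the two sides are
    then glued. *)
Lemma strict_circle (z : C) : Cmod z = 1%R -> exists A B, pair_diff anypair extension z A B /\ A <> 0 /\ Cmod B <= k * Cmod A.
Proof.
  intros Hz. assert (Hz0 : z <> 0) by (apply Cmod_gt_0; lra).
  destruct (circle_values z Hz) as [E1 [E2 [E3 [E4 E5]]]].
  set (lam := (/ c * Qx z - 1) / z).
  assert (HQz : Qx z <> 0).
  { pose proof (bd_Qb BD z ltac:(lra)) as B. intros E. rewrite E in B.
    replace (0 - RtoC a) with (- RtoC a) in B by ring. rewrite Cmod_opp, Cmod_R, Rabs_right in B by lra. nra. }
  exists (cexp (Lx z) * (/ c * Qx z)), 0. split; [|split].
  - apply pair_diff_glue.
    + assert (Hb : based rel_in z) by (intros x y [Hx Hy]; repeat split; lra).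
      pose proof (bd_Ld BD z Hz) as HL.
      pose proof (pair_diff_holo_comp rel_in Lx cexp z _ _ _ Hb HL (cexp_strict anypair _)) as H1.
      pose proof (pair_diff_mult rel_in z Hb _ _ _ _ _ _ (pair_diff_id rel_in z) H1) as H2.
      apply (pair_diff_eq _ _ _ _ _ _ _ _ H2).
      * exists 1%R. split; [lra|]. intros x y [Hx Hy] _ _. split; symmetry; apply extension_in; assumption.
      * change ((alpha, beta) : C) with c. field. split; assumption.
      * ring.
    + assert (Hb : based rel_out z) by (intros x y [Hx Hy]; repeat split; lra).
      pose proof (bd_Ld BD z Hz) as HL. change ((alpha, beta) : C) with c in HL.
      assert (HL' : pair_diff rel_out (fun x => Lx (zeta x)) z 0 (- (zeta z * zeta z) * lam)).
      { assert (HLz : pair_diff rel_in Lx (zeta z) lam 0) by (rewrite E1; exact HL).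
        assert (Hr : ev_pair rel_out z (fun x y => rel_in (zeta x) (zeta y))).
        { exists 1%R. split; [lra|]. intros x y [Hx Hy] _ _. split; apply zeta_in; assumption. }
        pose proof (pair_diff_comp rel_out z Hb rel_in zeta Lx _ _ _ _ (zeta_diff rel_out z Hb Hz0) HLz Hr) as H.
        apply (pair_diff_eq _ _ _ _ _ _ _ _ H (ev_refl rel_out z _)); ring. }
      assert (HBQ : pair_diff rel_out (fun x => Bfac a x * Qx (zeta x)) z (Epow a z / z * Qx (zeta z))
         (Epow a z * zeta z * Qx (zeta z) - Bfac a z * (zeta z * zeta z) * 0)).
      { pose proof (pair_diff_mult_vanishing rel_out (Bfac a) (fun x => Qx (zeta x)) z _ _ K Hb
          (Bfac_diff a Pa rel_out z Hb Hz0) E3 bK) as H.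
        apply (pair_diff_eq _ _ (fun x => Bfac a x * Qx (zeta x)) _ (Epow a z / z * Qx (zeta z)) (Epow a z * zeta z * Qx (zeta z)) _ _);
          [|apply ev_refl | reflexivity | ring].
        apply H. intros x y [Hx Hy].
        assert (Hx0 : x <> 0) by (apply Cmod_gt_0; lra). assert (Hy0 : y <> 0) by (apply Cmod_gt_0; lra).
        eapply Rle_trans; [apply (bd_Ql BD); apply zeta_in; assumption|].
        apply Rmult_le_compat_l; [left; exact bK|].
        pose proof (Cconj_neq_0 x Hx0) as Cx. pose proof (Cconj_neq_0 y Hy0) as Cy.
        (* Reflection does not increase distances between points outside the open disk, so
           [Qx (zeta x)] is Lipschitz there with the constant of [Qx]. *)
        replace (zeta x - zeta y) with (- (Cconj (x - y) * (zeta x * zeta y))).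
        2:{ rewrite Cminus_conj. unfold zeta. field. split; assumption. }
        rewrite Cmod_opp, !Cmod_mult, Cmod_conj.
        pose proof (zeta_in x Hx). pose proof (zeta_in y Hy).
        pose proof (Cmod_ge_0 (zeta x)). pose proof (Cmod_ge_0 (zeta y)). pose proof (Cmod_ge_0 (x - y)).
        assert (Cmod (zeta x) * Cmod (zeta y) <= 1) by nra. nra. }
      pose proof (outer_diff c a Lx Qx Hc rel_out z lam 0 Hb Hz0 (Xfac_rhp z ltac:(lra)) HL' HBQ) as HO.
      apply (pair_diff_eq _ _ _ _ _ _ _ _ HO).
      * exists 1%R. split; [lra|]. intros x y [Hx Hy] _ _. split; symmetry; apply extension_out; assumption.
      * rewrite E5, E4, E2, E1. field. split; assumption.
      * rewrite E5, E4, E2, E3, E1. unfold lam. field. split; assumption.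
  - repeat apply Cmult_neq_0; [apply cexp_neq_0 | apply Cinv_neq_0, Hc | exact HQz].
  - rewrite Cmod_0. apply Rmult_le_pos; [lra | apply Cmod_ge_0].
Qed.

Lemma extension_strict (z : C) : exists A B, pair_diff anypair extension z A B /\ A <> 0 /\ Cmod B <= k * Cmod A.
Proof.
  destruct (Rtotal_order (Cmod z) 1) as [H|[H|H]].
  - apply strict_inside, H.
  - apply strict_circle, H.
  - apply strict_outside, H.
Qed.

Lemma extension_neq_0 (z : C) : z <> 0 -> extension z <> 0.
Proof.
  intros Hz. unfold extension. destruct (Rle_dec (Cmod z) 1).
  - apply Cmult_neq_0; [exact Hz | apply cexp_neq_0].
  - apply Cmult_neq_0; [apply Cinv_neq_0, Cconj_neq_0, Hz | apply cexp_neq_0].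
Qed.

(** Since [Re (1/c) = 1/a] and [|X| >= (1 - k) |z|^(2a)], the power of [X] is at least a constant
    times [|z|^2]; the bounded argument of [X] and the bounded [Lx] change only the constant. The
    factor [zeta] leaves linear growth. *)
Lemma extension_proper : exists m m0, 0 < m /\ forall z, m * Cmod z - m0 <= Cmod (extension z).
Proof.
  set (n := (alpha ^ 2 + beta ^ 2)%R). assert (Hn : 0 < n) by (unfold n; nra).
  (* The exponent of the constant: [-K] bounds [Re Lx], the logarithm comes from the lower bound for
     [|X|], and [2 |beta|] bounds the part of [Re (log X / c)] due to the argument, which is below
     2. *)
  set (q := (- K + (alpha * ln (1 - k) - 2 * Rabs beta) / n)%R).
  set (m := exp q). assert (Hm : 0 < m) by apply exp_pos.
  (* Taking [m0 = m] makes the left side nonpositive on the closed disk. *)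
  exists m, m. split; [exact Hm|]. intros z.
  destruct (Rle_lt_dec (Cmod z) 1) as [Hle|Hgt].
  { pose proof (Cmod_ge_0 (extension z)). nra. }
  assert (Hz0 : z <> 0) by (apply Cmod_gt_0; lra).
  rewrite extension_out by lra. unfold out, outer. rewrite Cmod_mult, Cmod_cexp, Cmod_zeta by exact Hz0.
  set (X := Xfac a Qx z). set (e := exp (a * ln (Cmod z * Cmod z))).
  pose proof (bd_Qb BD _ (zeta_in z ltac:(lra))) as BQ.
  pose proof (Xfac_lower a Qx Pa z k Hk ltac:(lra) ltac:(lra)) as HX. fold X e in HX.
  assert (He : 0 < e) by apply exp_pos.
  assert (HXm : (1 - k) * e <= Cmod X) by (eapply Rle_trans; [exact HX|]; eapply Rle_trans; [apply Rle_abs | apply Cmod_fst]).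
  assert (Hpos : 0 < (1 - k) * e) by (apply Rmult_lt_0_compat; lra).
  assert (HlnX : ln (1 - k) + 2 * a * ln (Cmod z) <= ln (Cmod X)).
  { replace (ln (1 - k) + 2 * a * ln (Cmod z))%R with (ln ((1 - k) * e)).
    - destruct (Rle_lt_or_eq_dec _ _ HXm) as [Hlt|Heq]; [left; apply ln_increasing; assumption | rewrite Heq; lra].
    - rewrite ln_mult by lra. unfold e. rewrite ln_exp, ln_mult by lra. ring. }
  assert (HS : fst (Sexp c a Lx Qx z) = (fst (Lx (zeta z)) + (alpha * ln (Cmod X) + beta * snd (Clog X)) / n)%R).
  { unfold Sexp. fold X. unfold c, Cinv, Cplus, Cmult; simpl. unfold n. simpl. field. unfold n in Hn; simpl in Hn. lra. }
  assert (HLb : - K <= fst (Lx (zeta z))).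
  { pose proof (bd_Lb BD _ (zeta_in z ltac:(lra))) as B.
    pose proof (Cmod_fst (Lx (zeta z))) as F. apply Rabs_le_between in F. lra. }
  assert (Harg : - (2 * Rabs beta) <= beta * snd (Clog X)).
  { assert (Rabs (snd (Clog X)) <= 2).
    { change (snd (Clog X)) with (atan (snd X / fst X)). pose proof (atan_bound (snd X / fst X)). pose proof PI_4. apply Rabs_le. lra. }
    pose proof (Rle_abs (- (beta * snd (Clog X)))) as T. rewrite Rabs_Ropp, Rabs_mult in T.
    pose proof (Rabs_pos beta). nra. }
  assert (HSl : q + 2 * ln (Cmod z) <= fst (Sexp c a Lx Qx z)).
  { rewrite HS. unfold q.
    assert (alpha * (ln (1 - k) + 2 * a * ln (Cmod z)) <= alpha * ln (Cmod X)) by (apply Rmult_le_compat_l; lra).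
    assert (E : (2 * ln (Cmod z) = (alpha * (2 * a * ln (Cmod z))) / n)%R).
    { rewrite Ea. fold n. field. lra. }
    rewrite E. unfold Rdiv. assert (0 < / n) by (apply Rinv_0_lt_compat, Hn). nra. }
  assert (Hexp : m * (Cmod z * Cmod z) <= exp (fst (Sexp c a Lx Qx z))).
  { unfold m. rewrite <- (exp_ln (Cmod z)) by lra. rewrite <- !exp_plus.
    replace (q + (ln (Cmod z) + ln (Cmod z)))%R with (q + 2 * ln (Cmod z))%R by ring.
    destruct (Rle_lt_or_eq_dec _ _ HSl) as [Hlt|Heq]; [left; apply exp_increasing, Hlt | rewrite Heq; lra]. }
  apply Rle_trans with (/ Cmod z * (m * (Cmod z * Cmod z)))%R.
  - replace (/ Cmod z * (m * (Cmod z * Cmod z)))%R with (m * Cmod z)%R by (field; lra). lra.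
  - apply Rmult_le_compat_l; [left; apply Rinv_0_lt_compat; lra | exact Hexp].
Qed.

End QuasiconformalExtension.

(** * The constants of the theorem *)

(** With [s = sqrt (alpha^2 + beta^2)] and [b = |beta|], clearing the denominator leaves
    [(1 - k^2) (k alpha + b - k s) >= 0] and [(1 - k)^2 alpha + (1 - k^2) (s - b) > 0]. Both follow
    from [b <= s <= alpha + b]. *)
Lemma k_tilde_bounds (alpha beta k : R) : 0 < alpha -> 0 <= k < 1 ->
  k <= k_tilde alpha beta k < 1.
Proof.
  intros Ha Hk. unfold k_tilde.
  assert (S1 : Rabs beta <= sqrt (alpha ^ 2 + beta ^ 2)).
  { rewrite <- sqrt_Rsqr_abs. apply sqrt_le_1_alt. unfold Rsqr. nra. }
  assert (S2 : sqrt (alpha ^ 2 + beta ^ 2) <= alpha + Rabs beta).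
  { pose proof (Rabs_pos beta) as Pb. apply Rsqr_incr_0_var; [|lra]. rewrite Rsqr_sqrt by nra.
    assert (E : (beta ^ 2 = Rabs beta * Rabs beta)%R) by (rewrite <- Rabs_mult, Rabs_right; nra).
    rewrite E. unfold Rsqr. nra. }
  set (s := sqrt (alpha ^ 2 + beta ^ 2)) in *. set (b := Rabs beta) in *.
  assert (Pb : 0 <= b) by apply Rabs_pos.
  assert (Pk : 0 < 1 - k ^ 2) by nra.
  assert (Dp : 0 < (1 + k ^ 2) * alpha + (1 - k ^ 2) * s).
  { assert (0 < (1 + k ^ 2) * alpha) by (apply Rmult_lt_0_compat; nra).
    assert (0 <= (1 - k ^ 2) * s) by (apply Rmult_le_pos; lra). lra. }
  split.
  - apply Rmult_le_reg_r with ((1 + k ^ 2) * alpha + (1 - k ^ 2) * s)%R; [exact Dp|].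
    unfold Rdiv. rewrite Rmult_assoc, Rinv_l by lra.
    assert (0 <= (1 - k ^ 2) * (k * alpha + b - k * s)).
    { apply Rmult_le_pos; [lra|]. assert (k * s <= k * (alpha + b)) by (apply Rmult_le_compat_l; lra). nra. }
    nra.
  - apply Rmult_lt_reg_r with ((1 + k ^ 2) * alpha + (1 - k ^ 2) * s)%R; [exact Dp|].
    unfold Rdiv. rewrite Rmult_assoc, Rinv_l by lra.
    assert (0 < (1 - k) * (1 - k) * alpha) by (repeat apply Rmult_lt_0_compat; lra).
    assert (0 <= (1 - k ^ 2) * (s - b)) by (apply Rmult_le_pos; lra). nra.
Qed.

(** The case distinction compares [a] with 1, so the bound is [k min (1, a)]. *)
Lemma bound_M_bounds (alpha beta k a : R) : 0 < alpha -> 0 <= k < 1 -> a = ((alpha ^ 2 + beta ^ 2) / alpha)%R ->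
  0 <= bound_M alpha beta k <= k /\ bound_M alpha beta k <= k * a.
Proof.
  intros Ha Hk Ea. unfold bound_M.
  assert (E : (a * alpha = alpha ^ 2 + beta ^ 2)%R) by (rewrite Ea; field; lra).
  (* The conditional in [bound_M] passes through the coercion [is_left] to booleans, which has to be
     unfolded before it reduces. *)
  destruct (Rlt_dec alpha (alpha ^ 2 + beta ^ 2)) as [H|H]; cbv iota beta delta [ssrbool.is_left].
  - assert (H1 : 1 <= a) by (apply Rmult_le_reg_r with alpha; lra).
    pose proof (Rmult_le_compat_l k _ _ (proj1 Hk) H1). lra.
  - replace (k * (alpha ^ 2 + beta ^ 2) / alpha)%R with (k * a)%R by (rewrite Ea; field; lra).
    assert (H0 : 0 < a) by (rewrite Ea; apply Rdiv_lt_0_compat; nra).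
    assert (H1 : a <= 1) by (apply Rmult_le_reg_r with alpha; lra).
    pose proof (Rmult_le_compat_l k _ _ (proj1 Hk) H1). pose proof (Rmult_le_pos k a). lra.
Qed.

(** * Negligibility of empty exceptional sets *)

Module EmptyNullSets.
Import ssreflect all_analysis.

Lemma null1_empty (N : R -> Prop) : (forall x, ~ N x) -> null1 N.
Proof.
  intros H. unfold null1, leb1.
  replace N with (@classical_sets.set0 R) by (apply boolp.funext; intros x; apply boolp.propext; split; [intros [] | apply H]).
  apply negligible_set0.
Qed.

(** The product measure is the integral of the measures of sections, and all sections of the empty
    set are empty. *)
Lemma null2_empty (N : C -> Prop) : (forall x, ~ N x) -> null2 N.
Proof.
  intros H. unfold null2.
  replace N with (@classical_sets.set0 C) by (apply boolp.funext; intros x; apply boolp.propext; split; [intros [] | apply H]).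
  exists classical_sets.set0. split.
  - apply measurable0.
  - unfold leb2, product_measure1. apply integral0_eq. intros x _.
    cbv beta delta [ssrfun.comp]. rewrite classical_sets.xsection0. unfold leb1. rewrite measure0. reflexivity.
  - intros x Hx. exact Hx.
Qed.

End EmptyNullSets.

(** The two nonvanishing hypotheses express that the quotients in the estimate are defined: [f'] has
    no zero, and [f] has none besides the origin. *)
Theorem theorem2 (alpha beta k : R) (f : C -> C) :
  (0 < alpha)%R -> (0 <= k < 1)%R ->
  classA f ->
  (forall z, disk z -> C_derive f z <> 0) ->
  (forall z, disk z -> z <> 0 -> f z <> 0) ->
  (forall z, disk z ->
     (Cmod (1 + z * C_derive (C_derive f) z / C_derive f z
              + ((alpha, beta) - 1) * zfp_over_f f z
              - RtoC ((alpha ^ 2 + beta ^ 2) / alpha))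
      <= bound_M alpha beta k)%R) ->
  Bazilevic alpha beta f /\
  exists F : C -> C,
    qc_automorphism (k_tilde alpha beta k) F /\ (forall z, disk z -> F z = f z).
Proof.
  intros Ha Hk Hf Hn1 Hn2 HP.
  set (a := ((alpha ^ 2 + beta ^ 2) / alpha)%R) in *.
  destruct (bound_M_bounds alpha beta k a Ha Hk eq_refl) as [HM HMk].
  pose proof (center_pos alpha beta a Ha eq_refl) as Pa.
  destruct (log_data_exists f alpha beta a (bound_M alpha beta k) (c_neq_0 alpha beta Ha) Hf Hn1 Hn2 HP)
    as [L [L' [Q [Q' D]]]].
  split.
  - apply (bazilevic_of_log_data f alpha beta a (bound_M alpha beta k) k L L' Q Q' Ha HM (proj2 Hk)); [nra | exact D | exact Hf].
  - destruct (boundary_data_exists f alpha beta a (bound_M alpha beta k) k L L' Q Q' Ha (proj1 HM) Hk eq_refl HMk D)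
      as [K [Lx [Qx BD]]].
    set (F := extension alpha beta a Lx Qx).
    assert (HS : forall z, exists A B, pair_diff anypair F z A B /\ A <> 0 /\ (Cmod B <= k * Cmod A)%R)
      by (apply (extension_strict f alpha beta a (bound_M alpha beta k) k K L L' Q Q'); try assumption; apply HM || reflexivity).
    destruct (extension_proper alpha beta a (bound_M alpha beta k) k K L Q Lx Qx) as [m [m0 [Hm Hprop]]];
      try assumption; try apply HM; try reflexivity.
    assert (HN : forall z : C, z <> 0 -> F z <> 0) by apply extension_neq_0.
    exists F. split; [|exact (extension_disk f alpha beta a (bound_M alpha beta k) K L L' Q Q' Lx Qx D BD)].
    destruct (k_tilde_bounds alpha beta k Ha Hk) as [Hk1 Hk2].
    split; [lra|]. split; [|split; [|split; [split|]]].
    + apply (qc_map_homeomorphism F k m m0); assumption.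
    + apply (qc_map_sense_preserving F k m m0); assumption.
    (* [F] is Lipschitz on bounded sets, hence absolutely continuous on every compact interval of
       every line. *)
    + apply EmptyNullSets.null1_empty. intros y Hy. apply Hy. intros s t _. apply (qc_map_abs_cont_horizontal F k HS).
    + apply EmptyNullSets.null1_empty. intros x Hx. apply Hx. intros s t _. apply (qc_map_abs_cont_vertical F k HS).
    + apply EmptyNullSets.null2_empty. intros z Hz. apply Hz. apply (qc_map_dilatation F k HS). exact Hk1.
Qed.
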